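(* Let $s\in(0,1)$. (i) Let $u\in L^1_{loc}(\mathbb{R}^n)$ and let $\Omega\subset\mathbb{R}^n$ be an open set. If $\mathcal{F}(u,\Omega)<\infty$, then $$\lim_{\varepsilon\to0^+}\mathcal{F}(u_\varepsilon,\Omega')=\mathcal{F}(u,\Omega')\qquad\text{for every open }\Omega'\subset\subset\Omega.$$ (ii) Let $u\in W^{s,1}(\mathbb{R}^n)$. Then $$\lim_{\varepsilon\to0}[u_\varepsilon]_{W^{s,1}(\mathbb{R}^n)}=[u]_{W^{s,1}(\mathbb{R}^n)}.$$ (iii) Let $u\in W^{s,1}(\mathbb{R}^n)$. Then there exists a sequence $\{u_k\}\subset C_c^\infty(\mathbb{R}^n)$ such that $$\|u-u_k\|_{L^1(\mathbb{R}^n)}\longrightarrow0\qquad\text{and}\qquad\lim_{k\to\infty}[u_k]_{W^{s,1}(\mathbb{R}^n)}=[u]_{W^{s,1}(\mathbb{R}^n)}.$$ Moreover, if $u=\chi_E$ for some $E\subset\mathbb{R}^n$, then the $u_k$ can be taken with $0\leq u_k\leq1$.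
   Context: For an open set $\Omega\subset\mathbb{R}^n$ and a measurable function $u:\mathbb{R}^n\to\mathbb{R}$, $$\mathcal{F}(u,\Omega):=\frac12\int_\Omega\int_\Omega\frac{|u(x)-u(y)|}{|x-y|^{n+s}}\,dx\,dy+\int_\Omega\int_{\mathbb{R}^n\setminus\Omega}\frac{|u(x)-u(y)|}{|x-y|^{n+s}}\,dx\,dy\in[0,\infty].$$ $[u]_{W^{s,1}(\mathbb{R}^n)}=\int_{\mathbb{R}^n}\int_{\mathbb{R}^n}\frac{|u(x)-u(y)|}{|x-y|^{n+s}}\,dx\,dy$, and $u\in W^{s,1}(\mathbb{R}^n)$ means $u\in L^1(\mathbb{R}^n)$ and $[u]_{W^{s,1}(\mathbb{R}^n)}<\infty$. Fix a symmetric mollifier $\eta\in C_c^\infty(\mathbb{R}^n)$ with $\operatorname{supp}\eta\subset B_1$, $\eta\geq0$, $\eta(-x)=\eta(x)$, $\int_{\mathbb{R}^n}\eta=1$; put $\eta_\varepsilon(x)=\varepsilon^{-n}\eta(x/\varepsilon)$ for $\varepsilon\in(0,1)$, and $u_\varepsilon=u\ast\eta_\varepsilon$. $A\subset\subset B$ means that $\overline{A}$ is compact and $\overline{A}\subset B$. *)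

(* Defs.v *)
From HB Require Import structures.
From mathcomp Require Import all_boot all_order all_algebra.
From mathcomp Require Import all_classical all_reals all_analysis.

Set Implicit Arguments.
Unset Strict Implicit.
Unset Printing Implicit Defensive.
Import Order.TTheory GRing.Theory Num.Theory.
Import numFieldNormedType.Exports.

Local Open Scope classical_set_scope.
Local Open Scope ring_scope.

(* R^d is 'rV[R]_n.+1 with d = n.+1, since the dimension is at least 1.  Its
   library topology (sup norm) is the usual one; metric notions go through the
   Euclidean norm [enorm] below. *)

Section lebesgue.
Context {R : realType} {n : nat}.
Local Notation V := 'rV[R]_n.+1.
Local Open Scope ereal_scope.

(* The half-open box of points x with I.1 < x <= I.2 coordinatewise.  Covers only
   use boxes with I.1 <= I.2, so that [hobox_volume] is nonnegative. *)
Definition hobox (I : V * V) : set V :=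
  [set x | forall i, x ord0 i \in `](I.1 ord0 i), (I.2 ord0 i)]].

Definition hobox_volume (I : V * V) : R :=
  \prod_(i < n.+1) (I.2 ord0 i - I.1 ord0 i)%R.

Definition hobox_cover (A : set V) : set (nat -> V * V) :=
  [set I : nat -> V * V | (forall k i, ((I k).1 ord0 i <= (I k).2 ord0 i)%R) /\
           A `<=` \bigcup_k hobox (I k)].

Definition lebesgue_outer (A : set V) : \bar R :=
  ereal_inf [set \sum_(0 <= k <oo) (hobox_volume (I k))%:E
            | I in hobox_cover A].

Lemma hobox_volume_ge0 (I : V * V) :
  (forall i, (I.1 ord0 i <= I.2 ord0 i)%R) -> (0 <= hobox_volume I)%R.
Proof. by move=> h; apply: prodr_ge0 => i _; rewrite subr_ge0. Qed.

Lemma hobox_cover_ge0 A I : hobox_cover A I ->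
  forall k, 0 <= (hobox_volume (I k))%:E.
Proof. by move=> [h _] k; rewrite lee_fin; exact: hobox_volume_ge0. Qed.

Lemma le_lebesgue_outer : {homo lebesgue_outer : A B / A `<=` B >-> A <= B}.
Proof.
move=> A B AB; apply/ereal_inf_le_tmp => x [I [h BI]] <-{x}.
by exists I => //; split => //; exact: subset_trans BI.
Qed.

Lemma lebesgue_outer_ge0 A : 0 <= lebesgue_outer A.
Proof.
apply: le_ereal_inf_tmp => x [I AI] <-{x}.
by apply: nneseries_ge0 => k _ _; exact: hobox_cover_ge0 AI k.
Qed.

Lemma lebesgue_outer0 : lebesgue_outer set0 = 0.
Proof.
apply/eqP; rewrite eq_le lebesgue_outer_ge0 andbT.
apply: ereal_inf_lbound; exists (fun=> (0, 0)%R); first by split.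
by rewrite eseries0// => k _ _; rewrite /hobox_volume big_ord_recl subrr mul0r.
Qed.

Lemma lebesgue_outer_sigma_subadditive : sigma_subadditive lebesgue_outer.
Proof.
move=> A; have [[i ioo]|] := pselect (exists i, lebesgue_outer (A i) = +oo).
  rewrite (eseries_pinfty _ _ ioo) ?leey// => m _.
  by rewrite -ltNye (lt_le_trans _ (lebesgue_outer_ge0 _)).
rewrite -forallNE => Aoo.
suff add2e (e : {posnum R}) : lebesgue_outer (\bigcup_m A m) <=
    \sum_(i <oo) lebesgue_outer (A i) + e%:num%:E.
  by apply/lee_addgt0Pr => _/posnumP[].
rewrite (le_trans _ (epsilon_trick _ _ _))//; last first.
  by move=> m; exact: lebesgue_outer_ge0.
pose P m (B : nat -> V * V) := hobox_cover (A m) B /\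
  \sum_(k <oo) (hobox_volume (B k))%:E <=
  lebesgue_outer (A m) + (e%:num / (2 ^ m.+1)%:R)%:E.
have [G PG] : {G : nat -> nat -> V * V & forall m, P m (G m)}.
  apply: (@choice _ _ P) => m; rewrite /P /lebesgue_outer.
  set S := (X in ereal_inf X); move infS : (ereal_inf S) => iS.
  case: iS infS => [r Sr|Soo|Soo].
  - have en1 : (0 < e%:num / (2 ^ m.+1)%:R)%R by [].
    have /(lb_ereal_inf_adherent en1) : ereal_inf S \is a fin_num by rewrite Sr.
    move=> [x [B AB muBx] xS].
    by exists B; split => //; rewrite muBx -Sr; exact/ltW.
  - by have := Aoo m; rewrite /lebesgue_outer Soo.
  - suff : lbound S 0 by move/le_ereal_inf_tmp; rewrite Soo.
    move=> /= _ [B AB <-]; apply: nneseries_ge0 => k _ _.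
    exact: hobox_cover_ge0 AB k.
pose w (p : nat * nat) : \bar R := (hobox_volume (G p.1 p.2))%:E.
have w_ge0 p : 0 <= w p by exact: hobox_cover_ge0 (PG p.1).1 p.2.
apply: (@le_trans _ _ (\esum_(p in setT) w p)).
  have /card_esym/ppcard_eqP[f] := card_nat2.
  apply: ereal_inf_lbound => /=; exists (uncurry G \o f).
    split => [k i|t [i _]].
      by rewrite /= /uncurry; case: (f k) => a b /=; exact: (PG a).1.1.
    move=> /((PG i).1.2) [j _ ijt]; exists (f^-1%FUN (i, j)) => //=.
    by rewrite invK ?inE.
  have Gw k : (hobox_volume ((uncurry G \o f) k))%:E = w (f k).
    by rewrite /= /uncurry /w; case: (f k).
  rewrite (eq_eseriesr (fun k _ => Gw k)).
  by rewrite nneseries_esumT// -(reindex_esum setT setT f).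
rewrite (_ : esum _ _ = \sum_(i <oo) \sum_(j <oo) w (i, j)); last first.
  rewrite (_ : setT = [set: nat] `*`` (fun=> [set: nat])); last first.
    by apply/seteqP; split => // -[].
  rewrite [RHS]nneseries_esumT; last by move=> i; exact: nneseries_ge0.
  rewrite (_ : esum _ _ =
      \esum_(p in [set: nat] `*`` (fun=> [set: nat])) w (p.1, p.2)); last first.
    by apply: eq_esum => -[].
  rewrite -(@esum_esum _ _ _ _ _ (fun i j => w (i, j))); last by [].
  by apply: eq_esum => i _; rewrite nneseries_esumT.
apply: lee_nneseries => [i _ _|i _]; first exact: nneseries_ge0.
exact: (PG i).2.
Qed.

HB.instance Definition _ := isOuterMeasure.Build R V lebesgue_outer
  lebesgue_outer0 lebesgue_outer_ge0 le_lebesgue_outer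
  lebesgue_outer_sigma_subadditive.

End lebesgue.

(* Type synonym of 'rV[R]_n.+1 whose measurable sets are the Lebesgue (i.e. the
   Caratheodory) measurable ones; [leb] is the complete Lebesgue measure. *)
Definition Rd (R : realType) (n : nat) : Type :=
  caratheodory_type (@lebesgue_outer R n).
HB.instance Definition _ (R : realType) (n : nat) :=
  Measurable.on (Rd R n).

Definition leb {R : realType} {n : nat} : set (Rd R n) -> \bar R :=
  @lebesgue_outer R n.
HB.instance Definition _ (R : realType) (n : nat) :=
  isMeasure.Build _ (Rd R n) R (@leb R n)
    (caratheodory_measure0 (@lebesgue_outer R n))
    (@caratheodory_measure_ge0 _ _ (@lebesgue_outer R n))
    (@caratheodory_measure_sigma_additive _ _ (@lebesgue_outer R n)).

Section fractional.
Context {R : realType} {n : nat}.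
Local Notation V := 'rV[R]_n.+1.
Implicit Types (u f eta : V -> R) (s eps : R) (Omega : set V).

Definition enorm (x : V) : R := Num.sqrt (\sum_(i < n.+1) x ord0 i ^+ 2).

(* On the (null) diagonal x = y the numerator, hence the quotient, is 0. *)
Definition fractional_kernel s u (x y : V) : R :=
  `|u x - u y| / enorm (x - y) `^ (n.+1%:R + s).

Definition fractional_energy s u Omega : \bar R :=
  ((2^-1)%:E * \int[leb]_(y in Omega) \int[leb]_(x in Omega)
                 (fractional_kernel s u x y)%:E
   + \int[leb]_(y in Omega) \int[leb]_(x in ~` Omega)
       (fractional_kernel s u x y)%:E)%E.

Definition gagliardo_seminorm s u : \bar R :=
  (\int[leb]_y \int[leb]_x (fractional_kernel s u x y)%:E)%E.

Definition sobolev_Ws1 s u : Prop :=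
  leb.-integrable setT (EFin \o u) /\ (gagliardo_seminorm s u < +oo)%E.

Definition L1loc u : Prop :=
  measurable_fun [set: Rd R n] u /\
  forall K : set V, compact K -> (\int[leb]_(x in K) `|u x|%:E < +oo)%E.

Definition compactly_contained (A B : set V) : Prop :=
  compact (closure A) /\ closure A `<=` B.

(* C^k: the partial derivatives of order at most k exist and are continuous. *)
Fixpoint class_C (k : nat) f : Prop :=
  continuous f /\
  if k is k'.+1 then
    forall i : 'I_n.+1,
      (forall x, derivable f x (delta_mx ord0 i)) /\
      class_C k' (fun x => 'D_(delta_mx ord0 i) f x)
  else True.

Definition fsupport f : set V := closure [set x | f x != 0].

(* C_c^oo *)
Definition test_function f : Prop :=
  (forall k, class_C k f) /\ compact (fsupport f).

Definition symmetric_mollifier eta : Prop :=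
  [/\ test_function eta,
      fsupport eta `<=` [set x | enorm x < 1],
      forall x, 0 <= eta x,
      forall x, eta (- x) = eta x &
      (\int[leb]_x (eta x)%:E = 1)%E].

Definition rescale eta eps (x : V) : R := eps ^- n.+1 * eta (eps^-1 *: x).

Definition mollify eta eps u (x : V) : R :=
  \int[leb]_y (u y * rescale eta eps (x - y)).

End fractional.

(* Main.v *)
Require Import Defs.
From HB Require Import structures.
From mathcomp Require Import all_boot all_order all_algebra.
From mathcomp Require Import all_classical all_reals all_analysis.
From mathcomp Require Import measurable_realfun simple_functions ring lra.
Import Order.TTheory GRing.Theory Num.Theory.
Import numFieldNormedType.Exports.
Set Implicit Arguments.
Unset Strict Implicit.
Unset Printing Implicit Defensive.

Local Open Scope classical_set_scope.
Local Open Scope ring_scope.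

(* Write both functionals as PE(k, u) = int int k(x,y) |u(x) - u(y)| dx dy with a
   weight k >= 0: k is the Riesz kernel |x-y|^(-d-s) for the seminorm, and that
   kernel times 1_Omega(y) (1 - 1_Omega(x)/2) for F(., Omega).

   Lower bound: truncating k to bounded kernels of bounded support gives energies
   that are continuous under L^1_loc convergence and increase to PE(k, u), so
   PE(k, .) is lower semicontinuous, and u_eps -> u in L^1_loc.

   Upper bound: by Tonelli PE(k, u_eps) is at most the supremum over |z| < eps of
   PE(k(.-z,.-z), u).  The Riesz kernel is translation invariant, which settles
   the seminorm.  For F(., Omega') only the indicators move; as Omega' +- z stays
   inside Omega, the error is an integral of a function dominated by the (finite)
   energy density on Omega against |1_Omega'(x+z) - 1_Omega'(x)|, which tends to 0.

   For (iii), multiply u by the Lipschitz cutoff chi_m, equal to 1 on the ball of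
   radius m.  Then [chi_m u] <= [u] + J_m |u|_1 with
   J_m = int min(1, |h|/m) |h|^(-d-s) dh -> 0, and mollifying chi_m u by a smooth
   bump keeps that bound; lower semicontinuity gives the converse inequality. *)

(** * Borel sets and Lebesgue measure *)

Section boxes.
Context {R : realType} {n : nat}.
Local Notation V := 'rV[R]_n.+1.
Implicit Types (A B X : set V) (x y z : V) (I : V * V).

(** The obstacle that shapes the proof is joint measurability: Tonelli is applied to integrands
    containing u(x + z), which a merely Lebesgue measurable [u] does not allow. Each result
    therefore first trades [u] for a Borel function equal to it off a null set; energies,
    mollifications and local integrability do not see the exchange.

    The measure is given only as an outer measure built from half-open boxes, so its properties are
    read off from covers: measurability of half-spaces, behaviour under x -> c x + z, Borel hulls,
    outer regularity.

    In (i) the compact inclusion serves twice: it gives Omega' finite measure, so that its indicator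
    is L^1-continuous under translation, and it keeps small translates inside Omega, where the
    energy is finite. In (iii) no mollifier is given, so one is built from exp(-1/t). Lower
    semicontinuity is phrased with a radius and a tolerance instead of sequences, so that one lemma
    serves both the limit eps -> 0+ and the sequence u_k. *)

Definition set_coord x (i : 'I_n.+1) (c : R) : V :=
  \row_j (if j == i then c else x ord0 j).

Lemma hobox_volume_split I (i : 'I_n.+1) (c : R) :
  hobox_volume I =
  hobox_volume (I.1, set_coord I.2 i c) + hobox_volume (set_coord I.1 i c, I.2).
Proof.
rewrite /hobox_volume (bigD1 i)//= [in RHS](bigD1 i)//= [X in _ = _ + X](bigD1 i)//=.
rewrite !mxE eqxx.
under [X in _ = _ * X + _]eq_bigr => j ji do rewrite mxE (negbTE ji).
under [X in _ = _ + _ * X]eq_bigr => j ji do rewrite mxE (negbTE ji).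
by rewrite -mulrDl; congr (_ * _); ring.
Qed.

(** Cutting every box of a cover of [X] along the hyperplane yields covers of the two parts of [X],
    and by [hobox_volume_split] their volumes add up to the original total. This is the Caratheodory
    inequality before passing to the infimum. *)
Lemma measurable_halfspace (i : 'I_n.+1) (a : R) :
  measurable ([set x | x ord0 i <= a] : set (Rd R n)).
Proof.
apply: le_caratheodory_measurable => X.
set H := [set x | _].
apply: le_ereal_inf_tmp => _ [I [Ile XI] <-].
(* The level [a] is clamped to the i-th side of the k-th box, so that both pieces stay ordered,
   possibly degenerate, boxes even when the hyperplane misses the box. *)
pose c k := Num.max ((I k).1 ord0 i) (Num.min ((I k).2 ord0 i) a).
have cge k : (I k).1 ord0 i <= c k by rewrite le_max lexx.
have cle k : c k <= (I k).2 ord0 i by rewrite ge_max Ile ge_min lexx.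
pose J k := ((I k).1, set_coord (I k).2 i (c k)).
pose J' k := (set_coord (I k).1 i (c k), (I k).2).
have Jle k j : (J k).1 ord0 j <= (J k).2 ord0 j.
  by rewrite /J /= mxE; case: eqP => [->//|_]; exact: Ile.
have J'le k j : (J' k).1 ord0 j <= (J' k).2 ord0 j.
  by rewrite /J' /= mxE; case: eqP => [->//|_]; exact: Ile.
under eq_eseriesr => k _ do rewrite (hobox_volume_split _ i (c k)) EFinD.
rewrite nneseriesD; last 2 first.
- by move=> k _ _; rewrite lee_fin; exact: hobox_volume_ge0 (Jle k).
- by move=> k _ _; rewrite lee_fin; exact: hobox_volume_ge0 (J'le k).
apply: leeD; apply: ereal_inf_lbound.
- exists J => //; split=> // x [/XI [k _ Ikx]] Hx; exists k => // j.
  have := Ikx j; rewrite /J /= !mxE !in_itv/=; case: eqP => [->|//] /andP[-> x2].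
  by rewrite le_max le_min x2 Hx orbT.
- exists J' => //; split=> // x [/XI [k _ Ikx]] /negP Hx; exists k => // j.
  have := Ikx j; rewrite /J' /= !mxE !in_itv/=; case: eqP => [->|//] /andP[x1 ->].
  by rewrite andbT gt_max x1 gt_min (ltNge a) Hx orbT.
Qed.

Lemma measurable_coord (i : 'I_n.+1) :
  measurable_fun [set: Rd R n] (fun x : Rd R n => (x : V) ord0 i).
Proof.
apply: (measurability _ (RGenOInfty.measurableE R)) => _ [_ [a ->] <-].
rewrite setTI.
have -> : (fun x : Rd R n => (x : V) ord0 i) @^-1` `]a, +oo[%classic =
    ~` [set x | (x : V) ord0 i <= a].
  by apply/seteqP; split=> x /=; rewrite in_itv/= andbT ltNge => /negP.
exact/measurableC/measurable_halfspace.
Qed.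

Lemma coord_le_norm x i : `|x ord0 i| <= `|x|.
Proof. by rewrite [`|x|]mx_normrE; apply: (le_bigmax _ (fun p => `|x p.1 p.2|) (ord0, i)). Qed.

Lemma norm_rV_le x (r : R) : 0 <= r -> (forall i, `|x ord0 i| <= r) -> `|x| <= r.
Proof.
move=> r0 xr; rewrite [`|x|]mx_normrE; apply: bigmax_le => // -[i j] _ /=.
by rewrite (ord1 i).
Qed.

Lemma norm_rV_lt x (r : R) : 0 < r -> (forall i, `|x ord0 i| < r) -> `|x| < r.
Proof.
move=> r0 xr; rewrite [`|x|]mx_normrE; apply: bigmax_lt => // -[i j] _ /=.
by rewrite (ord1 i).
Qed.

(* Borel sets of R^d; Lebesgue measurability alone is not stable under
   precomposition with (x, z) |-> x + z on the product. *)
Definition borelRd : Type := g_sigma_algebraType (range (@hobox R n)).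
HB.instance Definition _ := Measurable.on borelRd.

Lemma measurable_hobox_preimage d (T : measurableType d) (f : T -> V) I :
  (forall i, measurable_fun setT (fun t => f t ord0 i)) ->
  measurable (f @^-1` hobox I).
Proof.
move=> mf.
have -> : f @^-1` hobox I = \bigcap_(i in [set: 'I_n.+1])
    ((fun t => f t ord0 i) @^-1` `](I.1 ord0 i), (I.2 ord0 i)]%classic).
  by apply/seteqP; split=> [t ft i _|t ft i]; [exact: ft|exact: ft i Logic.I].
apply: fin_bigcap_measurable => // i _.
by rewrite -[X in measurable X]setTI; exact: mf.
Qed.

Lemma measurable_borelRd d (T : measurableType d) (f : T -> borelRd) :
  (forall i, measurable_fun setT (fun t => (f t : V) ord0 i)) ->
  measurable_fun setT f.
Proof.
move=> mf; apply: (@measurability _ _ T borelRd setT f (range (@hobox R n)) erefl).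
by move=> _ [_ [I _ <-] <-]; rewrite setTI; exact: measurable_hobox_preimage.
Qed.

Lemma measurable_id_borel : measurable_fun [set: Rd R n] (id : Rd R n -> borelRd).
Proof. by apply: measurable_borelRd; exact: measurable_coord. Qed.

Lemma borel_measurable A : measurable (A : set borelRd) -> measurable (A : set (Rd R n)).
Proof. by move=> /(measurable_id_borel measurableT); rewrite setTI. Qed.

Lemma borel_measurable_fun d (T : measurableType d) (f : borelRd -> T) :
  measurable_fun setT f -> measurable_fun [set: Rd R n] f.
Proof. by move=> mf; apply: (measurableT_comp mf measurable_id_borel). Qed.

Lemma borel_hobox I : measurable (hobox I : set borelRd).
Proof. by apply: sub_sigma_algebra; exists I. Qed.

Lemma measurable_hobox I : measurable (hobox I : set (Rd R n)).
Proof. by apply: borel_measurable; exact: borel_hobox. Qed.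

Definition cube x (r : R) : V * V := (x - const_mx r, x + const_mx r).

Lemma cubeP x (r : R) y : hobox (cube x r) y <->
  forall i, x ord0 i - r < y ord0 i <= x ord0 i + r.
Proof. by split=> xr i; have := xr i; rewrite /cube/= !mxE in_itv. Qed.

(** Cubes with rational centre and half-side 1/(k+1) are countably many, and those contained in [U]
    already exhaust it. *)
Lemma borel_open U : open U -> measurable (U : set borelRd).
Proof.
move=> oU; pose c (p : 'rV[rat]_n.+1 * nat) := cube (map_mx ratr p.1) (p.2.+1%:R^-1).
have -> : U = \bigcup_p (if `[< hobox (c p) `<=` U >] then hobox (c p) else set0).
  apply/seteqP; split=> [x Ux|x [p _]]; last by case: asboolP => // + ?; apply.
  have /nbhs_ballP[e /= e0 eU] : nbhs x U by exact: open_nbhs_nbhs.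
  (* The centre will be within [d] of [x] and the points of the cube within [d] of the centre, hence
     the half. *)
  have [k ke] : exists k : nat, k.+1%:R^-1 < e / 2.
    have [k _ ke] := near_infty_natSinv_lt (PosNum (divr_gt0 e0 (ltr0n R 2))).
    by exists k; apply: ke => /=.
  set d := k.+1%:R^-1 : R.
  have d0 : 0 < d by rewrite invr_gt0.
  rewrite -/d in ke.
  have /choice[q qP] i : exists q : rat, x ord0 i - d < ratr q < x ord0 i + d.
    have [|q] := @rat_in_itvoo R (x ord0 i - d) (x ord0 i + d); first lra.
    by rewrite in_itv/=; exists q.
  exists (\row_i q i, k) => //.
  case: asboolP => [_|[]].
    by apply/cubeP => i; rewrite !mxE /= -/d; move: (qP i); lra.
  move=> y /cubeP cy; apply: eU; rewrite -ball_normE /=.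
  apply: norm_rV_lt => // i; have := cy i; rewrite !mxE/= -/d.
  by move: (qP i) => ? ?; rewrite ltr_norml; apply/andP; split; lra.
apply: countable_bigcupT_measurable; first exact: countableP.
by move=> p; case: ifP => // _; exact: borel_hobox.
Qed.

Lemma measurable_open U : open U -> measurable (U : set (Rd R n)).
Proof. by move=> /borel_open; exact: borel_measurable. Qed.

Lemma borel_closed (C : set V) : closed C -> measurable (C : set borelRd).
Proof.
move=> cC; rewrite -[C]setCK.
by have := borel_open (closed_openC cC); exact: measurableC.
Qed.

Lemma measurable_closed C : closed C -> measurable (C : set (Rd R n)).
Proof. by move=> /borel_closed; exact: borel_measurable. Qed.

Lemma borel_continuous (f : V -> R) : continuous f -> measurable_fun [set: borelRd] f.
Proof.
move=> /continuousP cf; apply: (measurability _ (RGenOpens.measurableE R)).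
move=> _ [_ [a [b ->] <-]]; rewrite setTI; apply: borel_open.
by apply: cf; exact: interval_open.
Qed.

End boxes.

(** * Scaling, translation and Borel regularity of Lebesgue measure *)

Section lebesgue_affine.
Context {R : realType} {n : nat}.
Local Notation V := 'rV[R]_n.+1.
Local Notation borelRd := (@borelRd R n).
Implicit Types (A B X : set V) (x y z : V) (I : V * V).
Local Open Scope ereal_scope.

Lemma leb_hobox I : (forall i, (I.1 ord0 i <= I.2 ord0 i)%R) ->
  leb (hobox I) <= (hobox_volume I)%:E.
Proof.
move=> Ile; apply: ereal_inf_lbound.
(* The cover is completed by degenerate boxes from 0 to 0; their volume is 0 because there is at
   least one coordinate. *)
exists (fun k : nat => if k is 0 return V * V then I else (0, 0)%R).
  by split=> [[|k] i|x Ix] //; exists 0%N.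
rewrite (@nneseries_split _ _ 0 1)//; last first.
  by move=> [|k] _; rewrite lee_fin; exact: hobox_volume_ge0.
rewrite big_nat1 eseries0 ?adde0// => -[|k]// _ _.
by rewrite /hobox_volume big_ord_recl subrr mul0r.
Qed.

Lemma leb_cube x (r : R) : (0 <= r)%R -> leb (hobox (cube x r)) <= ((2 * r) ^+ n.+1)%:E.
Proof.
move=> r0; apply: le_trans (leb_hobox _) _ => [i|].
  by rewrite !mxE; lra.
rewrite lee_fin /hobox_volume (eq_bigr (fun=> 2 * r)%R) => [|i _].
  by rewrite prodr_const card_ord.
by rewrite !mxE; ring.
Qed.

Lemma bigcup_cube : \bigcup_k hobox (cube (0 : V) k%:R) = setT.
Proof.
apply/seteqP; split=> // x _.
have [k xk] : exists k : nat, (`|x| < k%:R)%R.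
  by exists (Num.bound `|x|%R); rewrite archi_boundP.
exists k => //; apply/cubeP => i; rewrite mxE sub0r add0r.
have := le_lt_trans (coord_le_norm x i) xk.
by rewrite ltr_norml => /andP[-> /ltW ->].
Qed.

Lemma sigma_finite_leb : sigma_finite [set: Rd R n] (@leb R n).
Proof.
exists (fun k => hobox (cube 0 k%:R)); first by rewrite bigcup_cube.
move=> k; split; first exact: measurable_hobox.
by apply: le_lt_trans (leb_cube _ _) _ => //; rewrite ltry.
Qed.

HB.instance Definition _ := @Measure_isSigmaFinite.Build _ (Rd R n) R leb sigma_finite_leb.

Definition affine (c : R) z : V -> V := fun x => (c *: x + z)%R.

Lemma affineK c z : (c != 0)%R -> cancel (affine c z) (affine c^-1 (- (c^-1 *: z))).
Proof. by move=> c0 x; rewrite /affine scalerDr scalerA mulVf// scale1r addrK. Qed.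

Lemma affineVK c z : (c != 0)%R -> cancel (affine c^-1 (- (c^-1 *: z))) (affine c z).
Proof.
by move=> c0 x; rewrite /affine scalerBr !scalerA mulfV// !scale1r subrK.
Qed.

(** The inverse map carries a box cover of [A] to a box cover of the preimage and divides each of
    the d side lengths by [c]. *)
Lemma le_lebesgue_outer_affine c z A : (0 < c)%R ->
  lebesgue_outer (affine c z @^-1` A) <= (c ^- n.+1)%:E * lebesgue_outer A.
Proof.
move=> c0; have cN0 : (0 < c ^- n.+1)%R by rewrite invr_gt0 exprn_gt0.
rewrite -lee_pdivrMl//; apply: le_ereal_inf_tmp => _ [I [Ile AI] <-].
rewrite lee_pdivrMl// -nneseriesZl; last first.
  by move=> k _; rewrite lee_fin hobox_volume_ge0.
pose J k := (affine c^-1 (- (c^-1 *: z))%R (I k).1, affine c^-1 (- (c^-1 *: z))%R (I k).2).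
apply: ereal_inf_lbound; exists J.
  split=> [k i|x /AI [k _ Ik]].
    by rewrite !mxE lerD2r ler_pM2l ?invr_gt0.
  exists k => // i; have := Ik i; rewrite !mxE !in_itv/= => /andP[h1 h2].
  rewrite -(ler_pM2l c0) -(ltr_pM2l c0) !mulrBr !mulrA mulfV ?gt_eqF// !mul1r.
  by rewrite ltrBlDr lerBrDr h1 h2.
apply: eq_eseriesr => k _; rewrite /J /hobox_volume -EFinM; congr (_%:E).
rewrite -exprVn -[in (_ ^+ n.+1)%R](card_ord n.+1) -prodr_const -big_split/=.
by apply: eq_bigr => i _; rewrite !mxE; ring.
Qed.

(** The missing inequality is the previous one for the inverse map, applied to the preimage of
    [A]. *)
Lemma lebesgue_outer_affine c z A : (0 < c)%R ->
  lebesgue_outer (affine c z @^-1` A) = (c ^- n.+1)%:E * lebesgue_outer A.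
Proof.
move=> c0; apply/eqP; rewrite eq_le le_lebesgue_outer_affine//=.
have cN0 : (0 < c ^- n.+1)%R by rewrite invr_gt0 exprn_gt0.
rewrite -lee_pdivlMl// invrK.
have c'0 : (0 < c^-1)%R by rewrite invr_gt0.
have := @le_lebesgue_outer_affine c^-1%R (- (c^-1 *: z))%R (affine c z @^-1` A) c'0.
rewrite exprVn invrK; congr (lebesgue_outer _ <= _).
by apply/seteqP; split=> x /=; rewrite affineVK// gt_eqF.
Qed.

(** The scaling law holds for arbitrary sets. Every test set [X] is the preimage of some [Y], and
    the Caratheodory identity of [A] at [Y], multiplied by the scaling constant, is the one sought
    at [X]. *)
Lemma measurable_affine c z : (0 < c)%R ->
  measurable_fun [set: Rd R n] (affine c z : Rd R n -> Rd R n).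
Proof.
move=> c0 _ A mA; rewrite setTI.
have cn0 : (c != 0)%R by rewrite gt_eqF.
apply: le_caratheodory_measurable => X.
pose Y := affine c^-1 (- (c^-1 *: z))%R @^-1` X.
have -> : X = affine c z @^-1` Y.
  by apply/seteqP; split=> x; rewrite /Y /= affineK.
clearbody Y.
rewrite -[leLHS]/(lebesgue_outer (affine c z @^-1` (Y `&` A)) +
  lebesgue_outer (affine c z @^-1` (Y `&` ~` A))).
rewrite -[leRHS]/(lebesgue_outer (affine c z @^-1` Y)) !lebesgue_outer_affine//.
rewrite -muleDr// ?ge0_adde_def ?inE ?lebesgue_outer_ge0//.
have <- // : lebesgue_outer Y = lebesgue_outer (Y `&` A) + lebesgue_outer (Y `&` ~` A).
exact: (mA Y).
Qed.

Lemma ge0_integral_affine c z (f : Rd R n -> \bar R) : (0 < c)%R ->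
  measurable_fun [set: Rd R n] f -> (forall x, 0 <= f x) ->
  \int[leb]_x f (affine c z x) = (c ^- n.+1)%:E * \int[leb]_x f x.
Proof.
move=> c0 mf f0.
have mT := measurable_affine z c0.
have := @ge0_integral_pushforward _ _ _ _ R _ mT (@leb R n) setT f measurableT mf.
rewrite preimage_setT => <-//.
have k0 : (0 <= c ^- n.+1)%R by rewrite invr_ge0 exprn_ge0// ltW.
rewrite -(@ge0_integral_mscale _ _ _ (@leb R n) _ measurableT (NngNum k0) f)//.
apply: eq_measure_integral => A mA _ /=.
exact: (lebesgue_outer_affine z A c0).
Qed.

Lemma ge0_integral_shift z (f : Rd R n -> \bar R) :
  measurable_fun [set: Rd R n] f -> (forall x, 0 <= f x) ->
  \int[leb]_x f (x + z)%R = \int[leb]_x f x.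
Proof.
move=> mf f0; rewrite -[RHS]mul1e.
have := ge0_integral_affine z ltr01 mf f0; rewrite expr1n invr1 => <-.
by apply: eq_integral => x _; rewrite /affine scale1r.
Qed.

Lemma measurable_shift z :
  measurable_fun [set: Rd R n] ((fun x : V => x + z)%R : Rd R n -> Rd R n).
Proof.
have := measurable_affine z ltr01; apply: eq_measurable_fun => x _.
by rewrite /affine scale1r.
Qed.

Lemma lebesgue_outer_adherent A (e : R) : (0 < e)%R -> leb A < +oo ->
  exists2 I : nat -> V * V, hobox_cover A I &
    \sum_(0 <= k <oo) (hobox_volume (I k))%:E < leb A + e%:E.
Proof.
move=> e0 Afin; have Anum : leb A \is a fin_num.
  by rewrite ge0_fin_numE//; exact: lebesgue_outer_ge0.
by have [_ [I AI <-] ?] := lb_ereal_inf_adherent e0 Anum; exists I.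
Qed.

Lemma leb_bigcup_hobox (I : nat -> V * V) :
  (forall k i, ((I k).1 ord0 i <= (I k).2 ord0 i)%R) ->
  leb (\bigcup_k hobox (I k)) <= \sum_(0 <= k <oo) (hobox_volume (I k))%:E.
Proof.
move=> Ile; apply: (le_trans (lebesgue_outer_sigma_subadditive _)).
by apply: lee_nneseries => k *; [exact: lebesgue_outer_ge0|exact: leb_hobox].
Qed.

(** Box covers with excess 1/(m+1) have Borel unions; the intersection of these over [m] still
    contains [A] and has no excess left. *)
Lemma borel_hull_fin A : leb A < +oo ->
  exists B : set V, [/\ measurable (B : set borelRd), A `<=` B & leb B = leb A].
Proof.
move=> Afin.
have /choice[I IP] (m : nat) : exists I : nat -> V * V, hobox_cover A I /\
    \sum_(0 <= k <oo) (hobox_volume (I k))%:E < leb A + (m.+1%:R^-1)%:E.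
  have [|I ? ?] := @lebesgue_outer_adherent A (m.+1%:R^-1) _ Afin; first by [].
  by exists I.
exists (\bigcap_m \bigcup_k hobox (I m k)); split.
- apply: bigcapT_measurable => m; apply: bigcupT_measurable => k; exact: borel_hobox.
- by move=> x Ax m _; exact: (IP m).1.2.
- apply/eqP; rewrite eq_le; apply/andP; split; last first.
    by apply: le_lebesgue_outer => x Ax m _; exact: (IP m).1.2.
  apply/lee_addgt0Pr => e e0.
  have [m _ me] := near_infty_natSinv_lt (PosNum e0).
  have /= me' := ltW (me m (leqnn m)).
  apply: (@le_trans _ _ (leb A + (m.+1%:R^-1)%:E)); last by rewrite leeD2l// lee_fin.
  apply: le_trans (ltW (IP m).2).
  apply: le_trans (leb_bigcup_hobox (IP m).1.1).
  by apply: le_lebesgue_outer; exact: bigcap_inf.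
Qed.

Lemma borel_null_hull (N : set V) : leb N = 0 ->
  exists B : set V, [/\ measurable (B : set borelRd), N `<=` B & leb B = 0].
Proof. by move=> N0; rewrite -N0; apply: borel_hull_fin; rewrite N0. Qed.

Lemma leb_bigcup_null (F : nat -> set V) : (forall k, leb (F k) = 0) ->
  leb (\bigcup_k F k) = 0.
Proof.
move=> F0; apply/eqP; rewrite eq_le lebesgue_outer_ge0 andbT.
apply: (le_trans (lebesgue_outer_sigma_subadditive _)).
by rewrite eseries0// => k _ _; exact: F0.
Qed.

(** At finite measure the excess of a hull over [A] is null by subtraction, so [A] is first cut by
    growing cubes. The countably many excesses then fit into one Borel null set [N]. *)
Lemma borel_ae_set A : measurable (A : set (Rd R n)) ->
  exists B N : set V, [/\ measurable (B : set borelRd),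
    measurable (N : set borelRd), leb N = 0 & A `\` N = B `\` N].
Proof.
move=> mA.
have mAk k : measurable (A `&` hobox (cube 0 k%:R) : set (Rd R n)).
  by apply: measurableI => //; exact: measurable_hobox.
have Akfin k : leb (A `&` hobox (cube 0 k%:R)) < +oo.
  apply: (@le_lt_trans _ _ (leb (hobox (cube 0 k%:R)))).
    by apply: le_lebesgue_outer; exact: subIsetr.
  by apply: le_lt_trans (leb_cube _ _) _ => //; rewrite ltry.
have /choice[B BP] k := borel_hull_fin (Akfin k).
have N0 k : leb (B k `\` (A `&` hobox (cube 0 k%:R))) = 0.
  have [mB AB BA] := BP k.
  rewrite measureD//; last 2 first.
    exact: borel_measurable.
    by rewrite -[X in X < _]/(leb (B k)) BA.
  rewrite (_ : B k `&` _ = A `&` hobox (cube 0 k%:R)); last exact: setIidr.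
  rewrite -[LHS]/(leb (B k) - leb (A `&` hobox (cube 0 k%:R))) BA subee//.
  by rewrite ge0_fin_numE//; exact: lebesgue_outer_ge0.
have [N [mN BN N00]] := borel_null_hull (leb_bigcup_null N0).
exists (\bigcup_k B k), N; split=> //.
  by apply: bigcupT_measurable => k; have [] := BP k.
apply/seteqP; split=> x [].
  move=> Ax Nx; split=> //.
  have [k _ xk] : (\bigcup_k hobox (cube (0 : V) k%:R)) x by rewrite bigcup_cube.
  by exists k => //; have [_ AB _] := BP k; apply: AB.
move=> [k _ Bkx] Nx; split=> //; apply: contrapT => Ax; apply: Nx; apply: BN.
by exists k => //; split=> // -[].
Qed.

(** The sublevel sets at rational levels determine [u]. Each is Borel up to a Borel null set, and
    the countably many exceptional sets are discarded together. *)
Lemma borel_ae_fun (u : V -> R) : measurable_fun [set: Rd R n] u ->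
  exists v : V -> R, exists N : set V, [/\ measurable_fun [set: borelRd] v,
    measurable (N : set borelRd), leb N = 0 & forall x, ~ N x -> u x = v x].
Proof.
move=> mu.
have mq (q : rat) : measurable ([set x | (u x < ratr q)%R] : set (Rd R n)).
  by have := mu measurableT _ (measurable_itv `]-oo, (ratr q : R)[);
    rewrite setTI; congr measurable; apply/seteqP; split => x; rewrite /= in_itv.
have /choice[B /choice[N BN]] q := borel_ae_set (mq q).
pose M := \bigcup_k (if unpickle k is Some q then N q else set0).
have mM : measurable (M : set borelRd).
  apply: bigcupT_measurable => k; case: unpickle => [q|]; last exact: measurable0.
  by have [] := BN q.
have M0 : leb M = 0.
  apply: leb_bigcup_null => k; case: unpickle => [q|]; last exact: lebesgue_outer0.
  by have [] := BN q.
have NM q : N q `<=` M by move=> x Nx; exists (pickle q); [exact: Logic.I|rewrite pickleK; exact: Nx].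
(* With the constant value 0 on [M], a sublevel set contains [M] entirely or misses it. Off [M],
   being below [a] means being below some rational [q < a], which gives a countable union of Borel
   sets. *)
exists (fun x => if x \in M then 0%R else u x), M; split=> //; last first.
  by move=> x Mx; case: ifPn => //; rewrite inE => /Mx.
apply: (measurability _ (RGenInftyO.measurableE R)) => _ [_ [a ->] <-].
rewrite setTI.
have -> : (fun x => if x \in M then 0%R else u x) @^-1` `]-oo, a[%classic =
    (M `&` [set _ | (0 < a)%R]) `|`
    (\bigcup_k (if unpickle k is Some q then
       (if (ratr q < a)%R then B q else set0) else set0) `\` M).
  apply/seteqP; split=> x /=; rewrite in_itv/=.
    case: ifPn => [|Mx ua]; first by rewrite inE; left.
    move: Mx; rewrite notin_setE => Mx.
    right; split=> //.
    have [q] := rat_in_itvoo ua; rewrite in_itv/= => /andP[uq qa].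
    exists (pickle q); [exact: Logic.I|rewrite pickleK qa].
    have [_ _ _ /seteqP[+ _]] := BN q => /(_ x)[] //; split => //.
    by move=> /NM.
  case=> [[Mx a0]|[[k _]]]; first by rewrite ifT// inE.
  case: unpickle => // q; case: ifPn => // qa Bx Mx; rewrite ifF; last first.
    by apply/negbTE; rewrite notin_setE.
  have [_ _ _ /seteqP[_ +]] := BN q => /(_ x)[]; first by split => // /NM.
  by move=> /= uq _; exact: lt_trans uq qa.
apply: measurableU.
  apply: measurableI => //; case: (ltP 0%R a) => _.
    by rewrite (_ : [set _ | _] = setT)//; apply/seteqP.
  by rewrite (_ : [set _ | _] = set0)//; apply/seteqP; split=> x.
apply: measurableD => //; apply: bigcupT_measurable => k.
case: unpickle => // q; case: ifP => // _; by have [] := BN q.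
Qed.

End lebesgue_affine.

(** * Continuity of translations in L^1 *)

Section translation_continuity.
Context {R : realType} {n : nat}.
Local Notation V := 'rV[R]_n.+1.
Implicit Types (A B U : set V) (z : V) (f g : V -> R).
Local Open Scope ereal_scope.

Lemma measurable_norm d (T : measurableType d) (h : T -> R) :
  measurable_fun setT h -> measurable_fun setT (fun x => `|h x|%R).
Proof. by move=> mh; apply: measurableT_comp. Qed.

Lemma le_leb_integral (f g : Rd R n -> \bar R) : (forall x, 0 <= f x) ->
  measurable_fun [set: Rd R n] f -> measurable_fun [set: Rd R n] g ->
  (forall x, f x <= g x) -> \int[leb]_x f x <= \int[leb]_x g x.
Proof.
by move=> f0 mf mg fg; exact: ge0_le_integral.
Qed.

Lemma leb_integralD (f g : Rd R n -> \bar R) :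
  (forall x, 0 <= f x) -> (forall x, 0 <= g x) ->
  measurable_fun [set: Rd R n] f -> measurable_fun [set: Rd R n] g ->
  \int[leb]_x (f x + g x) = \int[leb]_x f x + \int[leb]_x g x.
Proof. by move=> f0 g0 mf mg; rewrite ge0_integralD. Qed.

Lemma leb_integralZl (a : \bar R) (f : Rd R n -> \bar R) : 0 <= a ->
  (forall x, 0 <= f x) -> measurable_fun [set: Rd R n] f ->
  \int[leb]_x (a * f x) = a * \int[leb]_x f x.
Proof. by move=> a0 f0 mf; rewrite ge0_integralZl. Qed.

Lemma cvge_lt_near {T : Type} {F : set_system T} {FF : Filter F} (f : T -> \bar R) (l a : \bar R) :
  f x @[x --> F] --> l -> l < a -> \forall x \near F, f x < a.
Proof.
move=> fl la; apply: (fl [set y | y < a]); apply: open_nbhs_nbhs; split=> //.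
exact: open_ereal_lt_ereal.
Qed.

(* The half-open boxes of an almost optimal cover are dilated about their centres by a factor
   c slightly larger than 1, so that the interiors still cover. *)
Lemma open_outer_regular A (e : R) : (0 < e)%R -> leb A < +oo ->
  exists U, [/\ open U, A `<=` U & leb U < leb A + e%:E].
Proof.
move=> e0 Afin; have e20 : (0 < e / 2)%R by rewrite divr_gt0.
have [I [Ile AI] Iv] := lebesgue_outer_adherent e20 Afin.
have vol0 k : 0 <= (hobox_volume (I k))%:E by rewrite lee_fin hobox_volume_ge0.
set S := \sum_(_ <= _ <oo) _ in Iv.
have S0 : 0 <= S by exact: nneseries_ge0.
have leb0 : 0 <= leb A by exact: lebesgue_outer_ge0.
(* The cover has excess below e/2, so slack remains for the factor c^d by which dilation increases
   the volumes: it tends to 1 as [c] decreases to 1. *)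
have [c c1 cS] : exists2 c : R, (1 < c)%R & (c ^+ n.+1)%:E * S < leb A + e%:E.
  case: (leb A) leb0 Afin Iv => // a a0 _; case: S S0 => //= s s0.
  rewrite -!EFinD !lte_fin => sa.
  have : (c ^+ n.+1 * s)%R @[c --> (1:R)^'+] --> (1 ^+ n.+1 * s)%R.
    apply: cvgM; last exact: cvg_cst.
    apply: cvg_at_right_filter; exact: exprn_continuous.
  rewrite expr1n mul1r => /cvgr_lt/(_ (a + e)%R) cs.
  have sae : (s < a + e)%R by lra.
  have [c [c1 ?]] : exists c : R, (1 < c)%R /\ (c ^+ n.+1 * s < a + e)%R.
    near (1:R)^'+ => c; exists c; split; first by [].
    by near: c; exact: cs.
  by exists c => //; rewrite -EFinM lte_fin.
pose m k : V := (2^-1 *: ((I k).1 + (I k).2))%R.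
pose h k : V := (2^-1 *: ((I k).2 - (I k).1))%R.
pose J k : V * V := (m k - c *: h k, m k + c *: h k)%R.
have c0 : (0 < c)%R by lra.
have Jle k i : ((J k).1 ord0 i <= (J k).2 ord0 i)%R.
  rewrite !mxE lerD2l; have := Ile k i; set a := (I k).1 ord0 i; set b := (I k).2 ord0 i.
  move=> ab; suff : (0 <= c * (2^-1 * (b - a)))%R by lra.
  by rewrite mulr_ge0 ?(ltW c0)//; lra.
have JE k : hobox_volume (J k) = (c ^+ n.+1 * hobox_volume (I k))%R.
  rewrite /hobox_volume -[in (c ^+ n.+1)%R](card_ord n.+1) -prodr_const -big_split/=.
  by apply: eq_bigr => i _; rewrite !mxE; field.
exists (\bigcup_k interior (hobox (J k))); split.
- by apply: bigcup_open => k _; exact: open_interior.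
- move=> x /AI[k _ Ikx]; exists k => //.
  have H i : \forall y \near x, ((J k).1 ord0 i < (y : V) ord0 i < (J k).2 ord0 i)%R.
    have := Ikx i; rewrite !mxE in_itv/=.
    set a := (I k).1 ord0 i; set b := (I k).2 ord0 i => /andP[ax xb].
    have cx := @coord_continuous R 1 n.+1 ord0 i x.
    (* The margin that dilation gains on each side. It is positive because the half-open side
       contains a coordinate of [x], which forces a < b. *)
    have hh : (0 < (c - 1) * (2^-1 * (b - a)))%R by rewrite mulr_gt0//; lra.
    near=> y; apply/andP; split.
      by near: y; apply: (cvgr_gt _ cx); lra.
    by near: y; apply: (cvgr_lt _ cx); lra.
  have H' : nbhs x (fun y : V => forall i, ((J k).1 ord0 i < y ord0 i < (J k).2 ord0 i)%R).
    exact: (@filter_forall V 'I_n.+1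
      (fun i (y : V) => ((J k).1 ord0 i < y ord0 i < (J k).2 ord0 i)%R)
      (nbhs x) (nbhs_filter x) H).
  apply: (@filterS V (nbhs x) (nbhs_filter x) _ _ _ H') => y yJ i.
  by have /andP[y1 y2] := yJ i; rewrite in_itv/= y1 ltW.
- apply: le_lt_trans cS; rewrite /S -nneseriesZl//.
  under eq_eseriesr do rewrite -EFinM -JE.
  apply: le_trans (leb_bigcup_hobox Jle).
  apply: le_lebesgue_outer => x [k _ /interior_subset] Jk; by exists k.
Unshelve. all: by end_near.
Qed.

Lemma measurable_comp_shift (f : V -> R) z : measurable_fun [set: Rd R n] f ->
  measurable_fun [set: Rd R n] (fun x => f (x + z)%R).
Proof. by move=> mf; exact: (measurableT_comp mf (measurable_shift z)). Qed.

Definition shift_dist f z : \bar R := \int[leb]_x `|f (x + z)%R - f x|%:E.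

Definition shift_cont f := forall e : R, (0 < e)%R -> exists2 r : R, (0 < r)%R &
  forall z, (`|z| < r)%R -> shift_dist f z <= e%:E.

Lemma measurable_normB f g : measurable_fun [set: Rd R n] f ->
  measurable_fun [set: Rd R n] g ->
  measurable_fun [set: Rd R n] (fun x => `|f x - g x|%:E).
Proof.
move=> mf mg; apply/measurable_EFinP; apply: measurable_norm.
by apply: measurable_funB; [exact: mf|exact: mg].
Qed.

Lemma measurable_normB_shift f z : measurable_fun [set: Rd R n] f ->
  measurable_fun [set: Rd R n] (fun x => `|f (x + z)%R - f x|%:E).
Proof. by move=> mf; apply: measurable_normB; [exact: measurable_comp_shift|exact: mf]. Qed.

(** Dominated convergence works along sequences, so a failure of continuity is turned into a
    sequence of shifts, the k-th of norm below 1/(k+1), whose distances stay above some [e]. *)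
Lemma shift_cont_seq f : measurable_fun [set: Rd R n] f ->
  (forall z_ : nat -> V, (forall k, `|z_ k| < k.+1%:R^-1)%R ->
    shift_dist f (z_ k) @[k --> \oo] --> 0) -> shift_cont f.
Proof.
move=> mf fz e e0; apply: contrapT => H.
have /choice[z_ zP] (k : nat) : exists z : V, (`|z| < k.+1%:R^-1)%R /\ e%:E < shift_dist f z.
  apply: contrapT => Hk; apply: H; exists (k.+1%:R^-1)%R => // z zk.
  by rewrite leNgt; apply/negP => ez; apply: Hk; exists z.
have e0' : 0 < e%:E by rewrite lte_fin.
have [k _ /(_ k (leqnn k))/=] := cvge_lt_near (fz z_ (fun k => (zP k).1)) e0'.
by move=> /lt_trans /(_ (zP k).2); rewrite ltxx.
Qed.

(* Dominated convergence: \1_U is lower semicontinuous. *)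
Lemma lsc_excess_cvg U (z_ : nat -> V) : open U -> leb U < +oo ->
  (forall k, `|z_ k| < k.+1%:R^-1)%R ->
  \int[leb]_x (\1_U x * (1 - \1_U (x + z_ k)))%R%:E @[k --> \oo] --> 0.
Proof.
move=> oU Ufin zP; have mU := measurable_open oU.
have m1U : measurable_fun [set: Rd R n] (\1_U : V -> R) by exact: measurable_indic.
have int1U : \int[leb]_x (\1_U x)%:E = leb U.
  by rewrite integral_indic// setIT.
pose F k (x : V) : \bar R := (\1_U x * (1 - \1_U (x + z_ k)))%R%:E.
have m1Us k : measurable_fun [set: Rd R n] (fun x => \1_U (x + z_ k)%R : R).
  exact: measurable_comp_shift.
have mF k : measurable_fun [set: Rd R n] (F k).
  apply/measurable_EFinP; apply: measurable_funM; first exact: m1U.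
  by apply: measurable_funB; [exact: measurable_cst|exact: m1Us].
have F0 k x : 0 <= F k x.
  by rewrite lee_fin mulr_ge0// subr_ge0 !indicE; case: (_ \in _).
have F1 k x : F k x <= (\1_U x)%:E.
  by rewrite lee_fin ler_piMr// lerBlDr lerDl.
have iU : leb.-integrable [set: Rd R n] (fun x => (\1_U x)%:E).
  apply/integrableP; split; first exact/measurable_EFinP.
  by under eq_integral => x _ do rewrite gee0_abs//; rewrite int1U.
have z0 : z_ k @[k --> \oo] --> (0%R : V).
  apply/cvgrPdist_lt => e e0.
  have [k _ ke] := near_infty_natSinv_lt (PosNum e0).
  exists k => // j kj; rewrite sub0r normrN.
  exact: lt_trans (zP j) (ke j kj).
have Fcvg x : F k x @[k --> \oo] --> 0.
  apply: cvg_near_cst.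
  have [Ux|Ux] := pselect (U x); last first.
    by near=> k; rewrite /F indicE memNset// mul0r.
  have : \forall k \near \oo, U (x + z_ k)%R.
    have : (x + z_ k)%R @[k --> \oo] --> (x + 0)%R.
      by apply: cvgD => //; exact: cvg_cst.
    by rewrite addr0; apply; apply: open_nbhs_nbhs.
  by apply: filterS => k Uxz; rewrite /F !indicE !mem_set// subrr mulr0.
have F2 x k : `|F k x| <= (\1_U x)%:E by rewrite gee0_abs.
have [_ _] := @dominated_convergence _ _ R (@leb R n) setT measurableT F (fun=> 0)
   (fun x => (\1_U x)%:E) mF (measurable_cst _) (aeW _ (fun (x : Rd R n) _ => Fcvg x)) iU
   (aeW _ (fun (x : Rd R n) k _ => F2 x k)).
by rewrite integral0.
Unshelve. all: by end_near.
Qed.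

(** The symmetric difference of [U] and its translate splits into two one-sided excesses. After a
    change of variable the second is the first for the opposite shift, so [lsc_excess_cvg] handles
    both. *)
Lemma shift_cont_open U : open U -> leb U < +oo -> shift_cont \1_U.
Proof.
move=> oU Ufin; have mU := measurable_open oU.
have m1U : measurable_fun [set: Rd R n] (\1_U : V -> R) by exact: measurable_indic.
have m1Us z : measurable_fun [set: Rd R n] (fun x => \1_U (x + z)%R : R).
  exact: measurable_comp_shift.
apply: shift_cont_seq => // z_ zP.
pose F z (x : V) : \bar R := (\1_U x * (1 - \1_U (x + z)))%R%:E.
have mF z : measurable_fun [set: Rd R n] (F z).
  apply/measurable_EFinP; apply: measurable_funM; first exact: m1U.
  by apply: measurable_funB; [exact: measurable_cst|exact: m1Us].
have F0 z x : 0 <= F z x.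
  by rewrite lee_fin mulr_ge0// subr_ge0 !indicE; case: (_ \in _).
have E z : shift_dist \1_U z = \int[leb]_x F z x + \int[leb]_x F (- z)%R x.
  rewrite -[X in _ + X](ge0_integral_shift z (mF _) (F0 _)).
  rewrite -leb_integralD; last first.
  - exact: (measurableT_comp (mF _) (measurable_shift z)).
  - exact: mF.
  - by move=> x; exact: F0.
  - by move=> x; exact: F0.
  apply: eq_integral => x _; rewrite /F -EFinD addrK; congr (_%:E).
  by rewrite !indicE; case: (x \in U); case: (_ \in U);
    rewrite ?subrr ?normr0 ?mulr0 ?mul0r ?subr0 ?sub0r ?normrN ?normr1 ?mulr1 ?addr0 ?add0r.
under eq_fun do rewrite E.
rewrite -[0]adde0; apply: cvgeD => //; first exact: lsc_excess_cvg.
by apply: lsc_excess_cvg => // k; rewrite normrN.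
Qed.

Lemma shift_cont_approx f : measurable_fun [set: Rd R n] f ->
  (forall e : R, (0 < e)%R -> exists g, [/\ measurable_fun [set: Rd R n] g,
     shift_cont g & \int[leb]_x `|f x - g x|%:E <= e%:E]) ->
  shift_cont f.
Proof.
move=> mf H e e0; have e30 : (0 < e / 3)%R by rewrite divr_gt0.
have [g [mg gc fg]] := H _ e30.
have [r r0 gr] := gc _ e30; exists r => // z zr.
have d0 x : 0 <= `|f x - g x|%:E by rewrite lee_fin.
have md := measurable_normB mf mg.
have mds := measurableT_comp md (measurable_shift z).
have mgz := measurable_normB_shift z mg.
have mgd : measurable_fun [set: Rd R n] (fun x => `|f x - g x|%:E + `|g (x + z)%R - g x|%:E).
  by apply: emeasurable_funD; [exact: md|exact: mgz].
have le : shift_dist f z <= \int[leb]_x (`|f (x + z)%R - g (x + z)%R|%:E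
      + (`|f x - g x|%:E + `|g (x + z)%R - g x|%:E)).
  apply: le_leb_integral.
  - by [].
  - exact: measurable_normB_shift.
  - by apply: emeasurable_funD; [exact: mds|exact: mgd].
  - move=> x; rewrite -!EFinD lee_fin.
    rewrite (_ : f (x + z) - f x = (f (x + z) - g (x + z)) -
      (f x - g x) + (g (x + z) - g x))%R; last ring.
    by apply: (le_trans (ler_normD _ _)); rewrite [leRHS]addrA lerD2r ler_normB.
apply: le_trans le _.
rewrite leb_integralD//; last by move=> x; rewrite adde_ge0.
rewrite (ge0_integral_shift z md d0) leb_integralD//.
rewrite (_ : e = e / 3 + (e / 3 + e / 3))%R; last by field.
by rewrite !EFinD leeD// leeD// gr.
Qed.

(** Outer regularity supplies an open [U] around [A]; the L^1 distance of the two indicators is the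
    measure of their difference, which is at most [e]. *)
Lemma shift_cont_indic A : measurable (A : set (Rd R n)) -> leb A < +oo ->
  shift_cont \1_A.
Proof.
move=> mA Afin; apply: shift_cont_approx => [|e e0].
  exact: measurable_indic.
have [U [oU AU Ue]] := open_outer_regular e0 Afin.
have mU := measurable_open oU.
have Afn : leb A \is a fin_num by rewrite ge0_fin_numE// lebesgue_outer_ge0.
have Ufin : leb U < +oo by rewrite (lt_trans Ue)// -ge0_fin_numE ?fin_numD ?Afn// adde_ge0 ?lebesgue_outer_ge0// lee_fin ltW.
exists \1_U; split; [exact: measurable_indic|exact: shift_cont_open|].
rewrite (eq_integral (fun x : Rd R n => (\1_(U `\` A) x)%:E)); last first.
  move=> x _; congr (_%:E); rewrite !indicE in_setD.
  have [xA|xA] := boolP (x \in A).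
    by rewrite mem_set ?subrr ?normr0//; apply: AU; move: xA; rewrite inE.
  by case: (x \in U); rewrite ?subrr ?normr0// sub0r normrN normr1.
rewrite integral_indic//; last exact: measurableD.
rewrite setIT measureD// (setIidr AU).
rewrite -[X in X - _]/(leb U) -[X in _ - X]/(leb A) leeBlDr//.
by rewrite addeC ltW.
Qed.

Lemma shift_cont0 : shift_cont (fun=> 0%R).
Proof.
move=> e e0; exists 1%R => // z _; rewrite /shift_dist.
under eq_integral => x _ do rewrite subrr normr0.
by rewrite integral0 lee_fin ltW.
Qed.

Lemma shift_contD f g : measurable_fun [set: Rd R n] f -> measurable_fun [set: Rd R n] g ->
  shift_cont f -> shift_cont g -> shift_cont (fun x => f x + g x)%R.
Proof.
move=> mf mg fc gc e e0; have e20 : (0 < e / 2)%R by rewrite divr_gt0.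
have [r r0 fr] := fc _ e20; have [r' r'0 gr] := gc _ e20.
exists (Num.min r r'); first by rewrite lt_min r0.
move=> z; rewrite lt_min => /andP[zr zr'].
have mfz := measurable_normB_shift z mf.
have mgz := measurable_normB_shift z mg.
apply: (@le_trans _ _ (\int[leb]_x (`|f (x + z)%R - f x|%:E + `|g (x + z)%R - g x|%:E))).
  apply: le_leb_integral.
  - by [].
  - apply: measurable_normB_shift.
    by apply: measurable_funD; [exact: mf|exact: mg].
  - by apply: emeasurable_funD; [exact: mfz|exact: mgz].
  - move=> x; rewrite -EFinD lee_fin opprD addrACA; exact: ler_normD.
rewrite leb_integralD//.
rewrite (_ : e = e / 2 + e / 2)%R; last by field.
by rewrite EFinD leeD//; [exact: fr|exact: gr].
Qed.

Lemma shift_contZ (a : R) f : measurable_fun [set: Rd R n] f ->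
  shift_cont f -> shift_cont (fun x => a * f x)%R.
Proof.
move=> mf fc e e0; have a0 : (0 < `|a| + 1)%R by rewrite ltr_wpDl.
have [r r0 fr] := fc _ (divr_gt0 e0 a0); exists r => // z zr.
have mfz := measurable_normB_shift z mf.
apply: (@le_trans _ _ (\int[leb]_x ((`|a| + 1)%:E * `|f (x + z)%R - f x|%:E))).
  apply: le_leb_integral.
  - by [].
  - apply: measurable_normB_shift.
    by apply: measurable_funM; [exact: measurable_cst|exact: mf].
  - by apply: emeasurable_funM; [exact: measurable_cst|exact: mfz].
  - by move=> x; rewrite -EFinM lee_fin -mulrBr normrM ler_wpM2r// lerDl.
rewrite leb_integralZl//.
by rewrite -lee_pdivlMl// muleC -EFinM fr.
Qed.

Import HBSimple.

Lemma shift_cont_integrable f : leb.-integrable [set: Rd R n] (EFin \o f) -> shift_cont f.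
Proof.
move=> fi; have mf : measurable_fun [set: Rd R n] f.
  by apply/measurable_EFinP; exact: measurable_int fi.
apply: shift_cont_approx => // e e0.
have [h [hi _ hf]] := approximation_sfun_integrable measurableT fi.
have e0' : 0 < e%:E by rewrite lte_fin.
have [k _ /(_ k (leqnn k))/= hk] := cvge_lt_near hf e0'.
exists (h k : Rd R n -> R); split; [exact: measurable_funPT| |exact: ltW hk].
move: (h k) (hi k) => {h hi hf hk k}g gi.
have mg1 r : measurable (g @^-1` [set r] : set (Rd R n)).
  by rewrite -[X in measurable X]setTI; exact: measurable_funPT.
have mr r : measurable_fun [set: Rd R n] (fun x => r * \1_(g @^-1` [set r]) x)%R.
  by apply: measurable_funM; [exact: measurable_cst|exact: measurable_indic].
have cr r : shift_cont (fun x => r * \1_(g @^-1` [set r]) x)%R.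
  (* The level set of 0 may have infinite measure, but its term vanishes. For any other [r] the
     measure is finite, since [|r|] times the indicator is at most the integrable [|g|]. *)
  have [->|r0] := eqVneq r 0%R.
    by under eq_fun do rewrite mul0r; exact: shift_cont0.
  apply: shift_contZ; [exact: measurable_indic|apply: shift_cont_indic => //].
  have r0' : (0 < `|r|)%R by rewrite normr_gt0.
  have /integrableP[mg gfin] := gi.
  have : `|r|%:E * leb (g @^-1` [set r]) < +oo.
    apply: le_lt_trans gfin.
    have -> : leb (g @^-1` [set r]) = \int[leb]_x (\1_(g @^-1` [set r]) x)%:E.
      by rewrite integral_indic// setIT.
    rewrite -leb_integralZl; last first.
    - by apply/measurable_EFinP; exact: measurable_indic.
    - by move=> x; rewrite lee_fin.
    - by rewrite lee_fin.
    apply: le_leb_integral.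
    - by move=> x; rewrite mule_ge0// lee_fin.
    - apply: emeasurable_funM; first exact: measurable_cst.
      by apply/measurable_EFinP; exact: measurable_indic.
    - by apply: measurableT_comp; [|exact: mg].
    - move=> x; rewrite -EFinM /= lee_fin indicE.
      have [|_] := boolP (x \in _); last by rewrite mulr0.
      by rewrite inE => -> ; rewrite mulr1.
  have := lebesgue_outer_ge0 (g @^-1` [set r]); rewrite -/(leb _).
  case: (leb _) => [a _ _| |]//; first by rewrite ltry.
  by move=> _; rewrite gt0_muley// lte_fin.
have fg : finite_set (range g) by [].
have [s sE] : exists s : seq R,
    forall x, g x = (\sum_(r <- s) r * \1_(g @^-1` [set r]) x)%R.
  by eexists => x; rewrite fimfunE fsbig_finite.
rewrite (_ : (g : Rd R n -> R) = (fun x => \sum_(r <- s) r * \1_(g @^-1` [set r]) x)%R); last first.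
  by apply/funext => x; exact: sE.
suff [] : measurable_fun [set: Rd R n]
    (fun x => \sum_(r <- s) r * \1_(g @^-1` [set r]) x)%R /\
  shift_cont (fun x => \sum_(r <- s) r * \1_(g @^-1` [set r]) x)%R by [].
elim: s {sE} => /= [|r s [IH1 IH2]].
  under eq_fun do rewrite big_nil.
  by split; [exact: measurable_cst|exact: shift_cont0].
under eq_fun do rewrite big_cons; split; last by apply: shift_contD.
by apply: measurable_funD; [exact: mr|exact: IH1].
Qed.

End translation_continuity.

(** * Weighted pair energies and mollification *)

Section pair_energy.
Context {R : realType} {n : nat}.
Local Notation V := 'rV[R]_n.+1.
Local Notation T := (Rd R n).
Local Notation borelRd := (@borelRd R n).
Implicit Types (u v f g : V -> R) (k : V -> V -> R) (z : V).

Definition measurable_coords d (X : measurableType d) (g : X -> V) :=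
  forall i, measurable_fun setT (fun t => g t ord0 i).

Lemma measurable_coordsD d (X : measurableType d) (g h : X -> V) :
  measurable_coords g -> measurable_coords h -> measurable_coords (fun t => g t + h t).
Proof.
move=> mg mh i; under eq_fun do rewrite mxE.
by apply: measurable_funD; [exact: mg|exact: mh].
Qed.

Lemma measurable_coordsB d (X : measurableType d) (g h : X -> V) :
  measurable_coords g -> measurable_coords h -> measurable_coords (fun t => g t - h t).
Proof.
move=> mg mh i; under eq_fun do rewrite !mxE.
by apply: measurable_funB; [exact: mg|exact: mh].
Qed.

Lemma measurable_coordsP d (X : measurableType d) (g : X -> T) :
  measurable_fun setT g -> measurable_coords (g : X -> V).
Proof. by move=> mg i; exact: (measurableT_comp (measurable_coord i) mg). Qed.

Lemma measurable_coords_cst d (X : measurableType d) z : measurable_coords (fun _ : X => z).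
Proof. by move=> i; exact: measurable_cst. Qed.

Lemma borel_comp d (X : measurableType d) (g : X -> V) d' (Y : measurableType d')
    (f : borelRd -> Y) : measurable_fun setT f -> measurable_coords g ->
  measurable_fun setT (fun t => f (g t)).
Proof. by move=> mf mg; exact: (measurableT_comp mf (measurable_borelRd mg)). Qed.

Definition measurable2 k := measurable_fun [set: T * T] (fun p => k p.1 p.2).

Lemma measurable2_comp k d (X : measurableType d) (g h : X -> T) :
  measurable2 k -> measurable_fun setT g -> measurable_fun setT h ->
  measurable_fun setT (fun t => k (g t) (h t)).
Proof. by move=> mk mg mh; exact: (measurableT_comp mk (measurable_fun_pair mg mh)). Qed.

Definition pair_energy k u : \bar R :=
  (\int[leb]_y \int[leb]_x (k x y * `|u x - u y|)%:E)%E.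

Lemma measurable_pair_energy_integrand k u : measurable2 k ->
  measurable_fun [set: T] u ->
  measurable_fun [set: T * T] (fun p => (k p.1 p.2 * `|u p.1 - u p.2|)%:E).
Proof.
move=> mk mu; apply/measurable_EFinP; apply: measurable_funM; first exact: mk.
apply: measurable_norm; apply: measurable_funB.
  exact: (measurableT_comp mu measurable_fst).
exact: (measurableT_comp mu measurable_snd).
Qed.

Lemma measurable_slice1 d d' d'' (X : measurableType d) (Y : measurableType d')
    (Z : measurableType d'') (F : X * Y -> Z) y :
  measurable_fun setT F -> measurable_fun setT (fun x => F (x, y)).
Proof. by move=> mF; exact: (measurableT_comp mF (measurable_pair2 y)). Qed.

Lemma measurable_slice2 d d' d'' (X : measurableType d) (Y : measurableType d')
    (Z : measurableType d'') (F : X * Y -> Z) x :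
  measurable_fun setT F -> measurable_fun setT (fun y => F (x, y)).
Proof. by move=> mF; exact: (measurableT_comp mF (measurable_pair1 x)). Qed.

Lemma measurable_integral1 d (Y : measurableType d) (F : T -> Y -> \bar R) :
  (forall x y, 0 <= F x y)%E -> measurable_fun [set: T * Y] (fun p => F p.1 p.2) ->
  measurable_fun setT (fun y => \int[leb]_x F x y)%E.
Proof.
move=> F0 mF.
exact: (@measurable_fun_fubini_tonelli_G _ _ T Y R leb _ mF (fun p => F0 p.1 p.2)).
Qed.

Lemma le_pair_energy k k' u u' : measurable2 k -> measurable2 k' ->
  measurable_fun [set: T] u -> measurable_fun [set: T] u' ->
  (forall x y, 0 <= k x y) ->
  (forall x y, k x y * `|u x - u y| <= k' x y * `|u' x - u' y|) ->
  (pair_energy k u <= pair_energy k' u')%E.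
Proof.
move=> mk mk' mu mu' k0 kk.
have m1 := measurable_pair_energy_integrand mk mu.
have m2 := measurable_pair_energy_integrand mk' mu'.
have p0 x y : (0 <= (k x y * `|u x - u y|)%:E)%E by rewrite lee_fin mulr_ge0.
have p0' x y : (0 <= (k' x y * `|u' x - u' y|)%:E)%E.
  by rewrite lee_fin (le_trans _ (kk x y))// mulr_ge0.
apply: le_leb_integral.
- by move=> y; apply: integral_ge0 => x _; exact: p0.
- by apply: measurable_integral1 => [x y|]; [exact: p0|exact: m1].
- by apply: measurable_integral1 => [x y|]; [exact: p0'|exact: m2].
- move=> y; apply: le_leb_integral.
  + by move=> x; exact: p0.
  + exact: (measurable_slice1 (y : T) m1).
  + exact: (measurable_slice1 (y : T) m2).
  + by move=> x; rewrite lee_fin; exact: kk.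
Qed.

Lemma pair_energy_ge0 k u : (forall x y, 0 <= k x y) -> (0 <= pair_energy k u)%E.
Proof.
move=> k0; apply: integral_ge0 => y _; apply: integral_ge0 => x _.
by rewrite lee_fin mulr_ge0.
Qed.

Lemma ae_leb (N : set V) (P : V -> Prop) : measurable (N : set T) -> leb N = 0%E ->
  (forall x, ~ N x -> P x) -> {ae (@leb R n), forall x, P x}.
Proof.
move=> mN N0 NP; exists N; split=> // x /= Px.
by apply: contrapT => /NP.
Qed.

Lemma leb_integral_ae (N : set V) (f g : T -> \bar R) :
  measurable (N : set T) -> leb N = 0%E ->
  (forall x, 0 <= f x)%E -> (forall x, 0 <= g x)%E ->
  measurable_fun [set: T] f -> measurable_fun [set: T] g ->
  (forall x, ~ N x -> f x = g x) -> (\int[leb]_x f x = \int[leb]_x g x)%E.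
Proof.
move=> mN N0 f0 g0 mf mg fg; apply: ge0_ae_eq_integral => //.
by apply: (ae_leb mN N0) => x Nx _; exact: fg.
Qed.

Lemma pair_energy_ae k u v (N : set V) : measurable2 k -> (forall x y, 0 <= k x y) ->
  measurable_fun [set: T] u -> measurable_fun [set: T] v ->
  measurable (N : set T) -> leb N = 0%E -> (forall x, ~ N x -> u x = v x) ->
  pair_energy k u = pair_energy k v.
Proof.
move=> mk k0 mu mv mN N0 uv.
have m1 := measurable_pair_energy_integrand mk mu.
have m2 := measurable_pair_energy_integrand mk mv.
have p0 (w : V -> R) x y : (0 <= (k x y * `|w x - w y|)%:E)%E by rewrite lee_fin mulr_ge0.
apply: (leb_integral_ae mN N0).
- by move=> y; apply: integral_ge0 => x _; exact: p0.
- by move=> y; apply: integral_ge0 => x _; exact: p0.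
- by apply: measurable_integral1 => [x y|]; [exact: p0|exact: m1].
- by apply: measurable_integral1 => [x y|]; [exact: p0|exact: m2].
- move=> y Ny; apply: (leb_integral_ae mN N0).
  + by move=> x; exact: p0.
  + by move=> x; exact: p0.
  + exact: (measurable_slice1 (y : T) m1).
  + exact: (measurable_slice1 (y : T) m2).
  + by move=> x Nx; rewrite !uv.
Qed.

Lemma integral_shift z (f : T -> \bar R) : measurable_fun [set: T] f ->
  (\int[leb]_x f (x + z)%R = \int[leb]_x f x)%E.
Proof.
move=> mf; rewrite integralE [RHS]integralE; congr (_ - _)%E.
- have mp : measurable_fun [set: T] f^\+%E by exact: measurable_funepos.
  rewrite -(ge0_integral_shift z mp (funepos_ge0 f)).
  by apply: eq_integral => x _; rewrite !funeposE.
- have mp : measurable_fun [set: T] f^\-%E by exact: measurable_funeneg.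
  rewrite -(ge0_integral_shift z mp (funeneg_ge0 f)).
  by apply: eq_integral => x _; rewrite !funenegE.
Qed.

(* The properties of a mollifier of radius r that the energy estimates use; smoothness is not
   among them. *)
Record averaging (r : R) (phi : V -> R) : Prop := Averaging {
  averaging_borel : measurable_fun [set: borelRd] phi ;
  averaging_ge0 : forall x, 0 <= phi x ;
  averaging_even : forall x, phi (- x) = phi x ;
  averaging_supp : forall x, r <= `|x| -> phi x = 0 ;
  averaging_bounded : exists M, forall x, phi x <= M ;
  averaging_integral : (\int[leb]_x (phi x)%:E = 1)%E }.

(** [mollify eta eps u] is convertible to [convol (rescale eta eps) u], so that results on general
    averaging kernels apply to it as well as to the kernels built later from [bump]. *)
Definition convol phi u (x : V) : R := \int[leb]_y (u y * phi (x - y)).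

Definition cball (r : R) : set V := [set x | `|x| <= r].

Lemma closed_cball r : closed (cball r).
Proof.
have := @closed_comp V R (fun x => `|x|) [set y | y <= r].
by apply=> [x _|]; [exact: norm_continuous|exact: closed_le].
Qed.

Lemma compact_cball r : compact (cball r).
Proof.
apply: bounded_closed_compact; last exact: closed_cball.
by exists r; split; [exact: num_real|move=> M rM x /le_trans; apply; exact: ltW].
Qed.

Lemma measurable_cball r : measurable (cball r : set T).
Proof. by apply: measurable_closed; exact: closed_cball. Qed.

Lemma leb_cball_fin r : (leb (cball r) < +oo)%E.
Proof.
have [r0|r0] := ltP r 0.
  rewrite (_ : cball r = set0); first by rewrite /leb lebesgue_outer0.
  by apply/seteqP; split=> // x /= /(le_trans (normr_ge0 x)); rewrite leNgt r0.
have r10 : 0 <= r + 1 by lra.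
apply: (@le_lt_trans _ _ (leb (hobox (cube (0 : V) (r + 1))))).
  apply: le_lebesgue_outer => x xr; apply/cubeP => i; rewrite !mxE.
  have := le_trans (coord_le_norm x i) xr; rewrite ler_norml => /andP[? ?].
  by apply/andP; split; lra.
by apply: le_lt_trans (leb_cube _ _) _ => //; rewrite ltry.
Qed.

Lemma integral_indic_mul (D : set V) (f : V -> R) :
  (\int[leb]_(x in (D : set T)) (f x)%:E = \int[leb]_x (\1_D x * f x)%:E)%E.
Proof.
rewrite integral_mkcond; apply: eq_integral => x _.
by rewrite /patch indicE; case: ifPn => _; rewrite ?mul1r ?mul0r.
Qed.

Lemma L1loc_cball u r : L1loc u -> (\int[leb]_x (\1_(cball r) x * `|u x|)%:E < +oo)%E.
Proof. by case=> _ /(_ _ (@compact_cball r)); rewrite integral_indic_mul. Qed.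

Lemma measurable_addl (f : V -> R) x : measurable_fun [set: T] f ->
  measurable_fun [set: T] (fun z => f (x + z)).
Proof. by move=> mf; under eq_fun do rewrite addrC; exact: measurable_comp_shift. Qed.

(** Only [|z| < r] contributes, where [x + z] stays in the compact ball of radius [|x| + r] and
    [phi] is bounded; local integrability of [u] is then enough. *)
Lemma convol_integrand_integrable r phi u x : averaging r phi -> L1loc u ->
  leb.-integrable [set: T] (fun z => (u (x + z) * phi z)%:E).
Proof.
move=> [bphi phi0 _ supp [M phiM] _] uL; have [mu _] := uL.
have mphi := borel_measurable_fun bphi.
have m1 : measurable_fun [set: T] (fun z : T => (u (x + z) * phi z)%:E).
  apply/measurable_EFinP; apply: measurable_funM; last exact: mphi.
  exact: measurable_addl.
apply/integrableP; split; first exact: m1.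
have m2 : measurable_fun [set: T] (fun y : T => (\1_(cball (`|x| + r)) y * `|u y|)%:E).
  apply/measurable_EFinP; apply: measurable_funM.
    by apply: measurable_indic; exact: measurable_cball.
  by apply: measurable_norm; exact: mu.
have p2 (y : T) : (0 <= (\1_(cball (`|x| + r)) y * `|u y|)%:E)%E.
  by rewrite lee_fin mulr_ge0.
have M0 : 0 <= M by exact: le_trans (phi0 0) (phiM 0).
apply: (@le_lt_trans _ _ (\int[leb]_z (M%:E * (\1_(cball (`|x| + r)) (z + x)%R * `|u (z + x)|)%:E))%E).
  apply: le_leb_integral.
  - by move=> z; exact: abse_ge0.
  - by apply: measurableT_comp; [|exact: m1].
  - apply: emeasurable_funM; first exact: measurable_cst.
    exact: (measurableT_comp m2 (measurable_shift x)).
  - move=> z; rewrite -EFinM lee_fin normrM (ger0_norm (phi0 z)) (addrC x).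
    have [zr|zr] := ltP `|z| r; last by rewrite supp// mulr0 !mulr_ge0.
    rewrite indicE mem_set ?mul1r; last first.
      by rewrite /cball /= addrC (le_trans (ler_normD _ _))// lerD2l ltW.
    by rewrite mulrC ler_wpM2r.
rewrite leb_integralZl; last 3 first.
- by rewrite lee_fin.
- by move=> z; exact: p2.
- exact: (measurableT_comp m2 (measurable_shift x)).
rewrite (ge0_integral_shift x m2 p2).
by rewrite lte_mul_pinfty// ?lee_fin// ?L1loc_cball.
Qed.

(** Substituting y = x + z and using that [phi] is even moves the shift onto [u]. Integrability
    ensures that [fine], hidden in the real-valued integral, loses nothing. *)
Lemma convolE r phi u x : averaging r phi -> L1loc u ->
  ((convol phi u x)%:E = \int[leb]_z (u (x + z) * phi z)%:E)%E.
Proof.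
move=> aphi uL; have [mu _] := uL.
have mphi := borel_measurable_fun (averaging_borel aphi).
have ui := convol_integrand_integrable x aphi uL.
have m1 : measurable_fun [set: T] (fun y : T => (u y * phi (x - y))%:E).
  apply/measurable_EFinP; apply: measurable_funM; first exact: mu.
  apply: (borel_comp (averaging_borel aphi)).
  by apply: measurable_coordsB; [exact: measurable_coords_cst|exact: measurable_coord].
have E : (\int[leb]_y (u y * phi (x - y))%:E = \int[leb]_z (u (x + z) * phi z)%:E)%E.
  rewrite -(integral_shift x m1); apply: eq_integral => z _.
  by rewrite (addrC z) opprD addrA subrr sub0r (averaging_even aphi).
rewrite /convol /Rintegral E fineK//.
exact: integrable_fin_num.
Qed.

Lemma norm_integralB_le (F G : V -> R) :
  leb.-integrable [set: T] (EFin \o F) -> leb.-integrable [set: T] (EFin \o G) ->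
  forall a b : R, (a%:E = \int[leb]_x (F x)%:E)%E -> (b%:E = \int[leb]_x (G x)%:E)%E ->
  (`|a - b|%:E <= \int[leb]_x `|F x - G x|%:E)%E.
Proof.
move=> Fi Gi a b aF bG.
rewrite -[leLHS]/(`|(a%:E - b%:E)|)%E aF bG -integralB_EFin//.
by apply: le_abse_integral; [exact: measurableT|exact: measurable_int (integrableB measurableT Fi Gi)].
Qed.

Lemma convol_diff_le r phi u x y : averaging r phi -> L1loc u ->
  (`|convol phi u x - convol phi u y|%:E <=
   \int[leb]_z (phi z * `|u (x + z) - u (y + z)|)%:E)%E.
Proof.
move=> aphi uL.
have := norm_integralB_le (convol_integrand_integrable x aphi uL)
  (convol_integrand_integrable y aphi uL) (convolE x aphi uL) (convolE y aphi uL).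
move=> /le_trans; apply; rewrite le_eqVlt; apply/orP; left; apply/eqP.
apply: eq_integral => z _; rewrite -mulrBl normrM mulrC.
by rewrite (ger0_norm (averaging_ge0 aphi z)).
Qed.

(** As [phi] has integral 1, the number [u x] is the average of the constant [u x], so both terms
    sit under one integral. *)
Lemma convol_sub_le r phi u x : averaging r phi -> L1loc u ->
  (`|convol phi u x - u x|%:E <=
   \int[leb]_z (phi z * `|u (x + z) - u x|)%:E)%E.
Proof.
move=> aphi uL.
have mphi := borel_measurable_fun (averaging_borel aphi).
have phi0 := averaging_ge0 aphi.
have phii : leb.-integrable [set: T] (EFin \o phi).
  apply/integrableP; split; first exact/measurable_EFinP.
  under eq_integral => z _ do rewrite gee0_abs ?lee_fin//.
  by rewrite (averaging_integral aphi) ltry.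
have ui : leb.-integrable [set: T] (EFin \o (fun z => u x * phi z)).
  exact: (integrableZl measurableT (u x) phii).
have uE : ((u x)%:E = \int[leb]_z (u x * phi z)%:E)%E.
  under eq_integral => z _ do rewrite EFinM.
  by rewrite integralZl// (averaging_integral aphi) mule1.
have := norm_integralB_le (convol_integrand_integrable x aphi uL) ui (convolE x aphi uL) uE.
move=> /le_trans; apply; rewrite le_eqVlt; apply/orP; left; apply/eqP.
apply: eq_integral => z _; rewrite -mulrBl normrM mulrC.
by rewrite (ger0_norm (averaging_ge0 aphi z)).
Qed.

Lemma measurable_convol r phi u : averaging r phi -> measurable_fun [set: T] u ->
  measurable_fun [set: T] (convol phi u).
Proof.
move=> aphi mu.
have m1 : measurable_fun [set: T * T] (fun p => (u p.1 * phi (p.2 - p.1))%:E).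
  apply/measurable_EFinP; apply: measurable_funM.
    exact: (measurableT_comp mu measurable_fst).
  apply: (borel_comp (averaging_borel aphi)).
  by apply: measurable_coordsB; apply: measurable_coordsP; [exact: measurable_snd|exact: measurable_fst].
apply: (@measurableT_comp _ _ _ _ _ _ fine); first exact: fine_measurable.
pose g y x := (u y * phi (x - y))%:E.
(* Measurability of a parameter integral comes from Tonelli, which wants nonnegative integrands;
   hence the split into positive and negative parts. *)
have E x : (\int[leb]_y g y x = \int[leb]_y maxe (g y x) 0 - \int[leb]_y maxe (- g y x) 0)%E.
  rewrite integralE; congr (_ - _)%E; apply: eq_integral => y _.
    by rewrite funeposE.
  by rewrite funenegE.
suff H : measurable_fun [set: T] (fun x => \int[leb]_y g y x)%E by exact: H.
under eq_fun do rewrite E; apply: emeasurable_funB.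
- apply: (@measurable_integral1 _ T (fun y x => maxe (g y x) 0%E)) => [x y|].
    by rewrite le_max lexx orbT.
  by apply: measurable_maxe; [exact: m1|exact: measurable_cst].
- apply: (@measurable_integral1 _ T (fun y x => maxe (- g y x)%E 0%E)) => [x y|].
    by rewrite le_max lexx orbT.
  apply: measurable_maxe; last exact: measurable_cst.
  by apply: measurableT_comp; [|exact: m1].
Qed.

(** A form of Jensen's inequality. By [convol_diff_le] an increment of [convol phi v] is at most the
    [phi]-average of increments of translates of [v]. Two exchanges of integrals bring [z] outside,
    and what remains inside is the energy of [v] for the kernel shifted by [z]. Since [v] is Borel,
    all these integrands are jointly measurable. *)
Lemma pair_energy_convol_le r phi k v C : 0 < r -> averaging r phi ->
  measurable_fun [set: borelRd] v -> L1loc v -> measurable2 k -> (forall x y, 0 <= k x y) ->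
  (forall z, `|z| < r -> (pair_energy (fun x y => k (x - z)%R (y - z)%R) v <= C)%E) ->
  (pair_energy k (convol phi v) <= C)%E.
Proof.
move=> r0 aphi bv vL mk k0 kC.
have mv := borel_measurable_fun bv.
have mphi := borel_measurable_fun (averaging_borel aphi).
have phi0 := averaging_ge0 aphi.
have mc := measurable_convol aphi mv.
pose F (y z x : V) : \bar R := (k x y * (phi z * `|v (x + z) - v (y + z)|))%:E.
have F0 y z x : (0 <= F y z x)%E by rewrite lee_fin !mulr_ge0.
have mF d (X : measurableType d) (a b c : X -> T) : measurable_fun setT a ->
    measurable_fun setT b -> measurable_fun setT c ->
    measurable_fun setT (fun t => F (a t) (b t) (c t)).
  move=> ma mb mc'; apply/measurable_EFinP; apply: measurable_funM.
    exact: measurable2_comp.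
  apply: measurable_funM; first exact: (measurableT_comp mphi mb).
  apply: measurable_norm; apply: measurable_funB; apply: (borel_comp bv);
    by apply: measurable_coordsD; exact: measurable_coordsP.
have mG : measurable_fun [set: T * T] (fun p => \int[leb]_x F p.1 p.2 x)%E.
  apply: (@measurable_integral1 _ (T * T)%type (fun x p => F p.1 p.2 x)) => [x p|].
    exact: F0.
  apply: mF; [exact: (measurableT_comp measurable_fst measurable_snd)|
    exact: (measurableT_comp measurable_snd measurable_snd)|exact: measurable_fst].
have G0 y z : (0 <= \int[leb]_x F y z x)%E by exact: integral_ge0.
have C0 : (0 <= C)%E.
  by apply: le_trans (kC 0 _); [exact: pair_energy_ge0|rewrite normr0].
have m1 := measurable_pair_energy_integrand mk mc.
have p1 x y : (0 <= (k x y * `|convol phi v x - convol phi v y|)%:E)%E.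
  by rewrite lee_fin mulr_ge0.
have inner y : (\int[leb]_x (k x y * `|convol phi v x - convol phi v y|)%:E <=
    \int[leb]_z \int[leb]_x F y z x)%E.
  have mxz : measurable_fun [set: T * T] (fun p => F y p.2 p.1).
    by apply: mF; [exact: measurable_cst|exact: measurable_snd|exact: measurable_fst].
  have mzx : measurable_fun [set: T * T] (fun p => F y p.1 p.2).
    by apply: mF; [exact: measurable_cst|exact: measurable_fst|exact: measurable_snd].
  have := @fubini_tonelli _ _ T T R leb leb (fun p => F y p.2 p.1) mxz (fun p => F0 y p.2 p.1).
  move=> /= <-; apply: le_leb_integral.
  - by move=> x; exact: p1.
  - exact: (measurable_slice1 (y : T) m1).
  - by apply: (@measurable_integral1 _ T (fun z x => F y z x)) => [z x|]; [exact: F0|exact: mzx].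
  - move=> x; rewrite EFinM.
    rewrite (_ : (\int[leb]_z F y z x)%E = ((k x y)%:E *
       \int[leb]_z (phi z * `|v (x + z) - v (y + z)|)%:E)%E).
      by apply: lee_wpmul2l; [rewrite lee_fin|exact: convol_diff_le aphi vL].
    rewrite -leb_integralZl.
    + by [].
    + by rewrite lee_fin.
    + by move=> z; rewrite lee_fin mulr_ge0.
    + apply/measurable_EFinP; apply: measurable_funM; first exact: mphi.
      by apply: measurable_norm; apply: measurable_funB; exact: measurable_addl.
(* Changing both [x] and [y] by [z] takes the translation off [v] and puts it, with the opposite
   sign, on the kernel. *)
have PE z : (\int[leb]_y \int[leb]_x F y z x =
    (phi z)%:E * pair_energy (fun x y => k (x - z)%R (y - z)%R) v)%E.
  have mkz : measurable2 (fun x y => k (x - z) (y - z)).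
    apply: (@measurable2_comp k _ (T * T)%type (fun p => p.1 - z) (fun p => p.2 - z)) => //.
      exact: (measurableT_comp (measurable_shift (- z)) measurable_fst).
    exact: (measurableT_comp (measurable_shift (- z)) measurable_snd).
  have m2 := measurable_pair_energy_integrand mkz mv.
  have p2 x y : (0 <= (k (x - z) (y - z) * `|v x - v y|)%:E)%E by rewrite lee_fin mulr_ge0.
  have q2 y : (0 <= \int[leb]_x (k (x - z) (y - z) * `|v x - v y|)%:E)%E by exact: integral_ge0.
  have n2 : measurable_fun [set: T] (fun y => \int[leb]_x (k (x - z)%R (y - z)%R * `|v x - v y|)%:E)%E.
    by apply: (@measurable_integral1 _ T) => [x y|]; [exact: p2|exact: m2].
  rewrite /pair_energy -(ge0_integral_shift z n2 q2) -leb_integralZl; last first.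
  - exact: (measurableT_comp n2 (measurable_shift z)).
  - by move=> y; exact: q2.
  - by rewrite lee_fin.
  apply: eq_integral => y _.
  have n1 := measurable_slice1 (y + z : T) m2.
  rewrite -(ge0_integral_shift z n1 (fun x => p2 x (y + z))) -leb_integralZl; last first.
  - exact: (measurableT_comp n1 (measurable_shift z)).
  - by move=> x; exact: p2.
  - by rewrite lee_fin.
  by apply: eq_integral => x _; rewrite /F !addrK -EFinM; congr (_%:E); ring.
apply: (@le_trans _ _ (\int[leb]_y \int[leb]_z \int[leb]_x F y z x)%E).
  apply: le_leb_integral.
  - by move=> y; apply: integral_ge0 => x _; exact: p1.
  - by apply: (@measurable_integral1 _ T) => [x y|]; [exact: p1|exact: m1].
  - apply: (@measurable_integral1 _ T (fun z y => \int[leb]_x F y z x)%E) => [z y|].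
      exact: G0.
    apply: (@measurable_integral1 _ (T * T)%type (fun x p => F p.2 p.1 x)) => [x p|].
      exact: F0.
    apply: mF; [exact: (measurableT_comp measurable_snd measurable_snd)|
      exact: (measurableT_comp measurable_fst measurable_snd)|exact: measurable_fst].
  - by move=> y; exact: inner.
have := @fubini_tonelli _ _ T T R leb leb _ mG (fun p => G0 p.1 p.2).
move=> /= ->.
apply: (@le_trans _ _ (\int[leb]_z (C * (phi z)%:E))%E).
  apply: le_leb_integral.
  - by move=> z; apply: integral_ge0 => y _; exact: G0.
  - by apply: (@measurable_integral1 _ T) => [y z|]; [exact: G0|exact: mG].
  - by apply: emeasurable_funM; [exact: measurable_cst|exact/measurable_EFinP].
  - move=> z; rewrite PE muleC.
    (* Shifts of norm at least [r] escape the hypothesis [kC], but [phi] vanishes there. *)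
    have [zr|zr] := ltP `|z| r.
      by apply: lee_wpmul2r; [rewrite lee_fin|exact: kC].
    by rewrite (averaging_supp aphi zr) !mule0.
rewrite leb_integralZl; first by rewrite (averaging_integral aphi) mule1.
- exact: C0.
- by move=> z; rewrite lee_fin.
- exact/measurable_EFinP.
Qed.

End pair_energy.

(** * Convergence of averages in L^1 and truncation of kernels *)

Section approximation.
Context {R : realType} {n : nat}.
Local Notation V := 'rV[R]_n.+1.
Local Notation T := (Rd R n).
Local Notation borelRd := (@borelRd R n).
Implicit Types (u v f g phi : V -> R) (k : V -> V -> R) (z : V).

Lemma measurable_indicM (A : set V) f : measurable (A : set T) ->
  measurable_fun [set: T] f -> measurable_fun [set: T] (fun x => \1_A x * f x).
Proof. by move=> mA mf; apply: measurable_funM; [exact: measurable_indic|exact: mf]. Qed.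

Lemma integrable_L1loc f : leb.-integrable [set: T] (EFin \o f) -> L1loc f.
Proof.
move=> fi; have mf : measurable_fun [set: T] f.
  by apply/measurable_EFinP; exact: measurable_int fi.
split=> // K cK; have mK : measurable (K : set T).
  by apply: measurable_closed; apply: compact_closed => //; exact: norm_hausdorff.
have /integrableP[_] := fi; apply: le_lt_trans.
rewrite integral_indic_mul; apply: le_leb_integral.
- by move=> x; rewrite lee_fin mulr_ge0.
- apply/measurable_EFinP; apply: measurable_indicM; first exact: mK.
  by apply: measurable_norm; exact: mf.
- by apply: measurableT_comp; [|exact/measurable_EFinP].
- move=> x /=; rewrite lee_fin ler_piMl// indicE; by case: (_ \in _).
Qed.

Lemma convol_L1_le r phi f (e : R) : 0 < r -> averaging r phi ->
  measurable_fun [set: borelRd] f -> L1loc f ->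
  (forall z, `|z| < r -> (shift_dist f z <= e%:E)%E) ->
  (\int[leb]_x `|convol phi f x - f x|%:E <= e%:E)%E.
Proof.
move=> r0 aphi bf fL fe.
have mf := borel_measurable_fun bf.
have mphi := borel_measurable_fun (averaging_borel aphi).
have phi0 := averaging_ge0 aphi.
pose F z x : \bar R := (phi z * `|f (x + z) - f x|)%:E.
have F0 z x : (0 <= F z x)%E by rewrite lee_fin mulr_ge0.
have mF d (X : measurableType d) (a b : X -> T) : measurable_fun setT a ->
    measurable_fun setT b -> measurable_fun setT (fun t => F (a t) (b t)).
  move=> ma mb; apply/measurable_EFinP; apply: measurable_funM.
    exact: (measurableT_comp mphi ma).
  apply: measurable_norm; apply: measurable_funB; apply: (borel_comp bf).
    by apply: measurable_coordsD; exact: measurable_coordsP.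
  exact: measurable_coordsP.
have m12 : measurable_fun [set: T * T] (fun p => F p.1 p.2).
  by apply: mF; [exact: measurable_fst|exact: measurable_snd].
have m21 : measurable_fun [set: T * T] (fun p => F p.2 p.1).
  by apply: mF; [exact: measurable_snd|exact: measurable_fst].
apply: (@le_trans _ _ (\int[leb]_x \int[leb]_z F z x)%E).
  apply: le_leb_integral.
  - by [].
  - by apply: measurable_normB; [exact: measurable_convol aphi mf|exact: mf].
  - by apply: (@measurable_integral1 _ _ _ T) => [x z|]; [exact: F0|exact: m12].
  - by move=> x; exact: convol_sub_le aphi fL.
have := @fubini_tonelli _ _ T T R leb leb _ m21 (fun p => F0 p.2 p.1).
move=> /= ->.
apply: (@le_trans _ _ (\int[leb]_z (e%:E * (phi z)%:E))%E).
  apply: le_leb_integral.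
  - by move=> z; exact: integral_ge0.
  - by apply: (@measurable_integral1 _ _ _ T) => [x z|]; [exact: F0|exact: m21].
  - by apply: emeasurable_funM; [exact: measurable_cst|exact/measurable_EFinP].
  - move=> z.
    rewrite (_ : (\int[leb]_x F z x = (phi z)%:E * shift_dist f z)%E); last first.
      rewrite /shift_dist -leb_integralZl; first by [].
      - by rewrite lee_fin.
      - by move=> x; rewrite lee_fin.
      - exact: measurable_normB_shift.
    have [zr|zr] := ltP `|z| r.
      by rewrite muleC; apply: lee_wpmul2r; [rewrite lee_fin|exact: fe].
    by rewrite (averaging_supp aphi zr) mul0e mule0.
rewrite leb_integralZl.
- by rewrite (averaging_integral aphi) mule1.
- by apply: le_trans (fe 0 _); [exact: integral_ge0|rewrite normr0].
- by move=> z; rewrite lee_fin.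
- exact/measurable_EFinP.
Qed.

Lemma convol_L1_cvg f (e : R) : 0 < e ->
  measurable_fun [set: borelRd] f -> leb.-integrable [set: T] (EFin \o f) ->
  exists2 r0 : R, 0 < r0 & forall r phi, 0 < r <= r0 -> averaging r phi ->
    (\int[leb]_x `|convol phi f x - f x|%:E <= e%:E)%E.
Proof.
move=> e0 bf fi; have [r0 r00 fr] := shift_cont_integrable fi e0.
exists r0 => // r phi /andP[r_gt0 rr0] aphi.
apply: (convol_L1_le r_gt0 aphi bf (integrable_L1loc fi)) => z zr.
exact: fr (lt_le_trans zr rr0).
Qed.

Lemma borel_indic (A : set V) : measurable (A : set borelRd) ->
  measurable_fun [set: borelRd] (\1_A : V -> R).
Proof. by move=> mA; exact: measurable_indic. Qed.

(** For radii at most 1 the averages on the ball of radius [M] only see [u] on the ball of radius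
    [M + 1]. There [u] may be replaced by its restriction, which is integrable and falls under
    [convol_L1_cvg]. *)
Lemma convol_L1loc_cvg u M (e : R) : 0 < e ->
  measurable_fun [set: borelRd] u -> L1loc u ->
  exists2 r0 : R, 0 < r0 & forall r phi, 0 < r <= r0 -> averaging r phi ->
    (\int[leb]_x (\1_(cball M) x * `|convol phi u x - u x|)%:E <= e%:E)%E.
Proof.
move=> e0 bu uL; have mu := borel_measurable_fun bu.
pose f (x : V) : R := \1_(cball (M + 1)) x * u x.
have bf : measurable_fun [set: borelRd] f.
  apply: measurable_funM; last exact: bu.
  by apply: borel_indic; apply: borel_closed; exact: closed_cball.
have fi : leb.-integrable [set: T] (EFin \o f).
  apply/integrableP; split; first by apply/measurable_EFinP; exact: borel_measurable_fun.
  have := L1loc_cball (M + 1) uL; apply: le_lt_trans.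
  rewrite le_eqVlt; apply/orP; left; apply/eqP; apply: eq_integral => x _ /=.
  by rewrite normrM (ger0_norm (_ : 0 <= \1_(cball (M + 1)) x)).
have [r0 r00 H] := convol_L1_cvg e0 bf fi.
exists (Num.min r0 1) => [|r phi]; first by rewrite lt_min r00 ltr01.
rewrite le_min => /and3P[r_gt0 rr0 r1] aphi.
have rr0' : 0 < r <= r0 by rewrite r_gt0.
apply: le_trans (H r phi rr0' aphi).
have mf := borel_measurable_fun bf.
apply: le_leb_integral.
- by move=> x; rewrite lee_fin mulr_ge0.
- apply/measurable_EFinP/measurable_indicM; first exact: measurable_cball.
  by apply/measurable_EFinP/measurable_normB; [exact: measurable_convol aphi mu|exact: mu].
- by apply: measurable_normB; [exact: measurable_convol aphi mf|exact: mf].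
- move=> x; rewrite lee_fin indicE.
  have [|_] := boolP (x \in _); last by rewrite mul0r.
  rewrite inE => xM; rewrite mul1r le_eqVlt; apply/orP; left; apply/eqP.
  have xM1 : `|x| <= M + 1 by rewrite (le_trans xM)// lerDl.
  rewrite {2}/f indicE mem_set// mul1r; congr (`|_ - _|).
  apply: eq_Rintegral => y _; rewrite /f indicE.
  have [|yM] := boolP (y \in _); first by rewrite mul1r.
  rewrite (averaging_supp aphi) ?mulr0//.
  rewrite leNgt; apply/negP => xyr; move: yM; rewrite notin_setE; apply.
  rewrite /cball /= -(subrK x y) addrC (le_trans (ler_normD _ _))// lerD//.
  by rewrite -normrN opprB ltW// (lt_le_trans xyr).
Qed.

Definition trunc_kernel (N : nat) k (x y : V) : R :=
  Num.min N%:R (k x y) * (\1_(cball N%:R) x * \1_(cball N%:R) y).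

Lemma measurable2_indic (A B : set V) : measurable (A : set T) -> measurable (B : set T) ->
  measurable2 (fun x y => \1_A x * \1_B y : R).
Proof.
move=> mA mB; apply: measurable_funM.
  exact: (measurableT_comp (measurable_indic mA) measurable_fst).
exact: (measurableT_comp (measurable_indic mB) measurable_snd).
Qed.

Lemma measurable_trunc_kernel N k : measurable2 k -> measurable2 (trunc_kernel N k).
Proof.
move=> mk; apply: measurable_funM; last first.
  by apply: measurable2_indic; exact: measurable_cball.
by apply: measurable_minr; [exact: measurable_cst|exact: mk].
Qed.

Lemma trunc_kernel_ge0 N k x y : (forall x y, 0 <= k x y) -> 0 <= trunc_kernel N k x y.
Proof. by move=> k0; rewrite !mulr_ge0// le_min ler0n k0. Qed.

Lemma le_indic_cball (a b : R) (x : V) : a <= b -> \1_(cball a) x <= \1_(cball b) x :> R.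
Proof.
move=> ab; rewrite !indicE; have [|_] := boolP (x \in cball a); last by rewrite ler0n.
by rewrite inE => xa; rewrite mem_set//; exact: le_trans xa ab.
Qed.

Lemma trunc_kernel_homo N M k x y : (forall x y, 0 <= k x y) -> (N <= M)%N ->
  trunc_kernel N k x y <= trunc_kernel M k x y.
Proof.
move=> k0 NM; have NM' : N%:R <= M%:R :> R by rewrite ler_nat.
rewrite ler_pM// ?mulr_ge0 ?le_min ?ler0n ?k0//.
- by rewrite !ge_min NM' lexx orbT.
- by rewrite ler_pM// le_indic_cball.
Qed.

Lemma trunc_kernel_cvg k x y : (forall x y, 0 <= k x y) ->
  \forall N \near \oo, trunc_kernel N k x y = k x y.
Proof.
move=> k0; near=> N.
have NP c : c <= (Num.bound c)%:R :> R.
  have [c0|c0] := leP 0 c; first exact/ltW/archi_boundP.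
  exact: le_trans (ltW c0) (ler0n _ _).
have NB c : (Num.bound c <= N)%N -> c <= N%:R :> R.
  by move=> cN; rewrite (le_trans (NP c))// ler_nat.
rewrite /trunc_kernel !indicE !mem_set ?mulr1.
- apply/min_idPr; apply: NB; near: N; exact: nbhs_infty_ge.
- apply: NB; near: N; exact: nbhs_infty_ge.
- apply: NB; near: N; exact: nbhs_infty_ge.
Unshelve. all: by end_near.
Qed.

(** Monotone convergence twice, for the inner and then for the outer integral; pointwise the
    truncated kernel increases with [N] and is eventually equal to [k]. *)
Lemma pair_energy_trunc_cvg k u : measurable2 k -> (forall x y, 0 <= k x y) ->
  measurable_fun [set: T] u ->
  pair_energy (trunc_kernel N k) u @[N --> \oo] --> pair_energy k u.
Proof.
move=> mk k0 mu.
pose h N (x y : V) : \bar R := (trunc_kernel N k x y * `|u x - u y|)%:E.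
have h0 N x y : (0 <= h N x y)%E by rewrite lee_fin mulr_ge0// trunc_kernel_ge0.
have hh x y : {homo (fun N => h N x y) : N M / (N <= M)%N >-> (N <= M)%E}.
  by move=> N M NM; rewrite lee_fin ler_wpM2r// trunc_kernel_homo.
have mh N := measurable_pair_energy_integrand (measurable_trunc_kernel N mk) mu.
have lim1 x y : limn (fun N => h N x y) = (k x y * `|u x - u y|)%:E.
  apply: cvg_lim => //; apply: cvg_near_cst.
  by apply: filterS (trunc_kernel_cvg x y k0) => N; rewrite /h => ->.
have lim2 y : limn (fun N => \int[leb]_x h N x y)%E =
    (\int[leb]_x (k x y * `|u x - u y|)%:E)%E.
  apply: cvg_lim => //.
  have := @cvg_monotone_convergence _ T R leb setT measurableT (fun N x => h N x y)
    (fun N => measurable_slice1 (y : T) (mh N)) (fun N x _ => h0 N x y) (fun x _ => hh x y).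
  by under [X in _ --> X -> _]eq_integral => x _ do rewrite lim1.
rewrite (_ : pair_energy k u = \int[leb]_y limn (fun N => \int[leb]_x h N x y))%E; last first.
  by apply: eq_integral => y _; rewrite lim2.
apply: (@cvg_monotone_convergence _ T R leb setT measurableT
    (fun N y => \int[leb]_x h N x y)%E).
- by move=> N; apply: (@measurable_integral1 _ _ _ T) => [x y|]; [exact: h0|exact: mh].
- by move=> N y _; exact: integral_ge0.
- move=> y _ N M NM; apply: le_leb_integral.
  + by move=> x; exact: h0.
  + exact: (measurable_slice1 (y : T) (mh N)).
  + exact: (measurable_slice1 (y : T) (mh M)).
  + by move=> x; exact: hh.
Qed.

Lemma pair_energyD k1 k2 u : measurable2 k1 -> measurable2 k2 ->
  (forall x y, 0 <= k1 x y) -> (forall x y, 0 <= k2 x y) -> measurable_fun [set: T] u ->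
  (pair_energy (fun x y => (k1 x y + k2 x y)%R) u = pair_energy k1 u + pair_energy k2 u)%E.
Proof.
move=> m1 m2 k10 k20 mu.
have mh1 := measurable_pair_energy_integrand m1 mu.
have mh2 := measurable_pair_energy_integrand m2 mu.
have p1 x y : (0 <= (k1 x y * `|u x - u y|)%:E)%E by rewrite lee_fin mulr_ge0.
have p2 x y : (0 <= (k2 x y * `|u x - u y|)%:E)%E by rewrite lee_fin mulr_ge0.
rewrite /pair_energy -leb_integralD; last 4 first.
- by move=> y; exact: integral_ge0.
- by move=> y; exact: integral_ge0.
- by apply: (@measurable_integral1 _ _ _ T) => [x y|]; [exact: p1|exact: mh1].
- by apply: (@measurable_integral1 _ _ _ T) => [x y|]; [exact: p2|exact: mh2].
apply: eq_integral => y _; rewrite -leb_integralD; last 4 first.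
- by move=> x; exact: p1.
- by move=> x; exact: p2.
- exact: (measurable_slice1 (y : T) mh1).
- exact: (measurable_slice1 (y : T) mh2).
by apply: eq_integral => x _; rewrite -EFinD mulrDl.
Qed.

End approximation.

(** * Lower semicontinuity *)

Section lower_semicontinuity.
Context {R : realType} {n : nat}.
Local Notation V := 'rV[R]_n.+1.
Local Notation T := (Rd R n).
Local Notation borelRd := (@borelRd R n).
Implicit Types (u v f g phi : V -> R) (k : V -> V -> R) (z : V).

Lemma cvge_gt_near {S : Type} {F : set_system S} {FF : Filter F} (f : S -> \bar R) (l a : \bar R) :
  f x @[x --> F] --> l -> (a < l)%E -> \forall x \near F, (a < f x)%E.
Proof.
move=> fl la; apply: (fl [set y | (a < y)%E]); apply: open_nbhs_nbhs; split=> //.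
exact: open_ereal_gt_ereal.
Qed.

Lemma lte_add_gap (a b : \bar R) : (a < b)%E -> exists2 c : R, 0 < c & (a + c%:E < b)%E.
Proof.
case: a b => [a| |] [b| |]//= ab.
- exists ((b - a) / 2); first by rewrite divr_gt0// subr_gt0 -lte_fin.
  by rewrite -EFinD lte_fin; rewrite lte_fin in ab; lra.
- by exists 1 => //; rewrite ltry.
- by exists 1 => //; rewrite ltNyr.
- by exists 1.
Qed.

(** An increment of [u] exceeds that of [u'] by at most |u'(x) - u(x)| + |u'(y) - u(y)|, and the
    truncated kernel is at most [N] on the product of two balls. Integrating either error over the
    other variable produces the factor [leb (cball N)]; the two errors give the factor 2. *)
Lemma pair_energy_trunc_dist N k u u' : measurable2 k -> (forall x y, 0 <= k x y) ->
  measurable_fun [set: T] u -> measurable_fun [set: T] u' ->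
  (pair_energy (trunc_kernel N k) u <= pair_energy (trunc_kernel N k) u' +
    (2 * N%:R)%:E * (leb (cball N%:R : set V) *
    \int[leb]_x (\1_(cball N%:R) x * `|u' x - u x|)%:E))%E.
Proof.
move=> mk k0 mu mu'.
set B : set V := cball N%:R; set L := leb B.
have mB : measurable (B : set T) by exact: measurable_cball.
have mt := measurable_trunc_kernel N mk.
have t0 x y : 0 <= trunc_kernel N k x y by exact: trunc_kernel_ge0.
have mh := measurable_pair_energy_integrand mt mu.
have mh' := measurable_pair_energy_integrand mt mu'.
pose w x := \1_B x * `|u' x - u x|.
have mw : measurable_fun [set: T] w.
  apply: measurable_indicM; first exact: mB.
  by apply: measurable_norm; apply: measurable_funB; [exact: mu'|exact: mu].
have w0 x : 0 <= w x by rewrite mulr_ge0.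
set W := (\int[leb]_x (w x)%:E)%E.
have W0 : (0 <= W)%E by apply: integral_ge0 => x _; rewrite lee_fin.
have L0 : (0 <= L)%E by exact: lebesgue_outer_ge0.
have intB : (\int[leb]_x (\1_B x)%:E = L)%E by rewrite integral_indic// setIT.
have m1B : measurable_fun [set: T] (\1_B : V -> R) by exact: measurable_indic.
have i1B (x : V) : 0 <= \1_B x :> R by [].
pose q x y : \bar R := (N%:R * (\1_B y * w x + w y * \1_B x))%:E.
have q0 x y : (0 <= q x y)%E.
  by rewrite lee_fin mulr_ge0// addr_ge0 ?mulr_ge0.
have mq : measurable_fun [set: T * T] (fun p => q p.1 p.2).
  apply/measurable_EFinP; apply: measurable_funM; first exact: measurable_cst.
  apply: measurable_funD; apply: measurable_funM.
  - exact: (measurableT_comp m1B measurable_snd).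
  - exact: (measurableT_comp mw measurable_fst).
  - exact: (measurableT_comp mw measurable_snd).
  - exact: (measurableT_comp m1B measurable_fst).
have mfZl (c : \bar R) (f : V -> R) : measurable_fun [set: T] f -> (forall x, 0 <= f x) ->
    (0 <= c)%E -> (\int[leb]_x (c * (f x)%:E) = c * \int[leb]_x (f x)%:E)%E.
  move=> mf f0 c0; apply: leb_integralZl => [|x|]; [exact: c0|by rewrite lee_fin|].
  exact/measurable_EFinP.
have qE y : (\int[leb]_x q x y = N%:R%:E * (W * (\1_B y)%:E + L * (w y)%:E))%E.
  rewrite /q; under eq_integral => x _ do rewrite EFinM EFinD (EFinM (\1_B y)) (EFinM (w y)).
  rewrite leb_integralZl; last 3 first.
  - by rewrite lee_fin.
  - by move=> x; rewrite adde_ge0// mule_ge0// lee_fin.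
  - apply: emeasurable_funD.
      by apply: emeasurable_funM; [exact: measurable_cst|exact/measurable_EFinP].
    by apply: emeasurable_funM; [exact: measurable_cst|exact/measurable_EFinP].
  rewrite leb_integralD; last 4 first.
  - by move=> x; rewrite mule_ge0// lee_fin.
  - by move=> x; rewrite mule_ge0// lee_fin.
  - by apply: emeasurable_funM; [exact: measurable_cst|exact/measurable_EFinP].
  - by apply: emeasurable_funM; [exact: measurable_cst|exact/measurable_EFinP].
  rewrite (mfZl (\1_B y)%:E _ mw w0) ?lee_fin// (mfZl (w y)%:E _ m1B i1B) ?lee_fin//.
  by rewrite intB (muleC W) (muleC L).
have qq : (\int[leb]_y \int[leb]_x q x y = (2 * N%:R)%:E * (L * W))%E.
  under eq_integral => y _ do rewrite qE.
  rewrite leb_integralZl; last 3 first.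
  - by rewrite lee_fin.
  - by move=> x; rewrite adde_ge0// mule_ge0// lee_fin.
  - apply: emeasurable_funD.
      by apply: emeasurable_funM; [exact: measurable_cst|exact/measurable_EFinP].
    by apply: emeasurable_funM; [exact: measurable_cst|exact/measurable_EFinP].
  rewrite leb_integralD; last 4 first.
  - by move=> x; rewrite mule_ge0// lee_fin.
  - by move=> x; rewrite mule_ge0// lee_fin.
  - by apply: emeasurable_funM; [exact: measurable_cst|exact/measurable_EFinP].
  - by apply: emeasurable_funM; [exact: measurable_cst|exact/measurable_EFinP].
  rewrite (mfZl _ _ m1B i1B W0) (mfZl _ _ mw w0 L0).
  rewrite intB (muleC W) ge0_muleDr ?mule_ge0//.
  rewrite (_ : 2 * N%:R = N%:R + N%:R :> R)%R; last by ring.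
  by rewrite EFinD ge0_muleDl ?lee_fin.
rewrite -qq /pair_energy -leb_integralD; last 4 first.
- by move=> y; apply: integral_ge0 => x _; rewrite lee_fin mulr_ge0.
- by move=> y; exact: integral_ge0.
- apply: (@measurable_integral1 _ _ _ T) => [x y|]; last exact: mh'.
  by rewrite lee_fin mulr_ge0.
- by apply: (@measurable_integral1 _ _ _ T) => [x y|]; [exact: q0|exact: mq].
apply: le_leb_integral.
- by move=> y; apply: integral_ge0 => x _; rewrite lee_fin mulr_ge0.
- apply: (@measurable_integral1 _ _ _ T) => [x y|]; last exact: mh.
  by rewrite lee_fin mulr_ge0.
- apply: emeasurable_funD.
    apply: (@measurable_integral1 _ _ _ T) => [x y|]; last exact: mh'.
    by rewrite lee_fin mulr_ge0.
  by apply: (@measurable_integral1 _ _ _ T) => [x y|]; [exact: q0|exact: mq].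
move=> y; rewrite -leb_integralD; last 4 first.
- by move=> x; rewrite lee_fin mulr_ge0.
- by move=> x; exact: q0.
- exact: (measurable_slice1 (y : T) mh').
- exact: (measurable_slice1 (y : T) mq).
apply: le_leb_integral.
- by move=> x; rewrite lee_fin mulr_ge0.
- exact: (measurable_slice1 (y : T) mh).
- apply: emeasurable_funD; first exact: (measurable_slice1 (y : T) mh').
  exact: (measurable_slice1 (y : T) mq).
move=> x; rewrite -EFinD lee_fin.
apply: (@le_trans _ _ (trunc_kernel N k x y * (`|u' x - u' y| + (`|u' x - u x| + `|u' y - u y|)))).
  apply: ler_wpM2l => //.
  rewrite (_ : u x - u y = (u' x - u' y) - ((u' x - u x) - (u' y - u y))); last by ring.
  apply: le_trans (ler_normB _ _) _; rewrite lerD2l; exact: ler_normB.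
rewrite mulrDr lerD2l.
apply: (@le_trans _ _ (N%:R * (\1_B x * \1_B y) * (`|u' x - u x| + `|u' y - u y|))).
  by rewrite ler_wpM2r ?addr_ge0// ler_wpM2r ?mulr_ge0// ge_min lexx.
rewrite le_eqVlt; apply/orP; left; apply/eqP; rewrite /w; ring.
Qed.

(** Some truncated energy of [u] already exceeds [a] by more than a gap [c]. If [u'] is close enough
    to [u] on the ball of radius [N], its truncated energy is lower by at most [c], and its full
    energy is no smaller than the truncated one. *)
Lemma pair_energy_lsc k u (a : \bar R) : measurable2 k -> (forall x y, 0 <= k x y) ->
  measurable_fun [set: T] u -> (a < pair_energy k u)%E ->
  exists M : R, exists2 d : R, 0 < d & forall u', measurable_fun [set: T] u' ->
    (\int[leb]_x (\1_(cball M) x * `|u' x - u x|)%:E <= d%:E)%E -> (a < pair_energy k u')%E.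
Proof.
move=> mk k0 mu au.
have [N _ /(_ N (leqnn N))/= aN] := cvge_gt_near (pair_energy_trunc_cvg mk k0 mu) au.
have [c c0 ac] := lte_add_gap aN.
have Lfin : leb (cball (N%:R : R) : set V) \is a fin_num.
  by rewrite ge0_fin_numE ?leb_cball_fin// lebesgue_outer_ge0.
set L := fine (leb (cball (N%:R : R) : set V)).
have L0 : 0 <= L by rewrite fine_ge0// lebesgue_outer_ge0.
(* The loss 2 N L d must not exceed [c]; the added 1 keeps the denominator positive when [N] or [L]
   is 0. *)
exists N%:R, (c / (2 * N%:R * L + 1)); first by rewrite divr_gt0// ltr_wpDl// !mulr_ge0.
move=> u' mu' uu'.
apply: (@lt_le_trans _ _ (pair_energy (trunc_kernel N k) u')); last first.
  apply: le_pair_energy => //; first exact: measurable_trunc_kernel.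
  - by move=> x y; exact: trunc_kernel_ge0.
  - move=> x y; rewrite ler_wpM2r//.
    apply: (@le_trans _ _ (k x y * 1)); last by rewrite mulr1.
    rewrite /trunc_kernel; apply: ler_pM.
    + by rewrite le_min ler0n k0.
    + by rewrite mulr_ge0.
    + by rewrite ge_min lexx orbT.
    + by rewrite !indicE; case: (_ \in _); case: (_ \in _); rewrite ?mulr1 ?mulr0.
rewrite -(@lteD2rE _ c%:E)//; apply: lt_le_trans ac _.
apply: le_trans (pair_energy_trunc_dist N mk k0 mu mu') _.
rewrite leeD2l// -(fineK Lfin) -/L.
apply: (@le_trans _ _ ((2 * N%:R)%:E * (L%:E * (c / (2 * N%:R * L + 1))%:E))%E).
  rewrite lee_wpmul2l ?lee_fin ?mulr_ge0// lee_wpmul2l ?lee_fin//.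
rewrite -!EFinM lee_fin.
have p : 0 < 2 * N%:R * L + 1 by rewrite ltr_wpDl// !mulr_ge0.
rewrite mulrA mulrA ler_pdivrMr// (mulrC c) ler_wpM2r ?(ltW c0)// lerDl//.
Qed.

End lower_semicontinuity.

(** * The fractional energies *)

Section fractional_kernels.
Context {R : realType} {n : nat}.
Local Notation V := 'rV[R]_n.+1.
Local Notation T := (Rd R n).
Local Notation borelRd := (@borelRd R n).
Implicit Types (u v f g phi : V -> R) (k : V -> V -> R) (z : V) (s : R).

Lemma measurable_enorm : measurable_fun [set: borelRd] (enorm : V -> R).
Proof.
apply: (@measurableT_comp _ _ _ _ _ _ (@Num.sqrt R) _ (fun x : borelRd => \sum_(i < n.+1) (x : V) ord0 i ^+ 2)).
  by apply: continuous_measurable_fun; exact: sqrt_continuous.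
apply: measurable_sum => i; apply: measurable_funX.
by apply: borel_continuous; exact: coord_continuous.
Qed.

(** Balls and shifts are measured in the sup norm, the kernel and the support of [eta] in the
    Euclidean one. This inequality is the bridge between them, both for supports and for upper
    bounds of the kernel. *)
Lemma le_norm_enorm (x : V) : `|x| <= enorm x.
Proof.
apply: norm_rV_le => [|i]; first exact: sqrtr_ge0.
rewrite -sqrtr_sqr ler_wsqrtr// (bigD1 i)//= lerDl.
by apply: sumr_ge0 => j _; exact: sqr_ge0.
Qed.

Definition riesz s (x y : V) : R := (enorm (x - y) `^ (n.+1%:R + s))^-1.

Lemma riesz_ge0 s x y : 0 <= riesz s x y.
Proof. by rewrite invr_ge0 powR_ge0. Qed.

Lemma riesz_shift s z x y : riesz s (x - z) (y - z) = riesz s x y.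
Proof. by rewrite /riesz opprB addrA subrK. Qed.

Lemma measurable_riesz s : measurable2 (riesz s : V -> V -> R).
Proof.
rewrite /measurable2; under eq_fun do rewrite /riesz -powRN.
apply: (measurableT_comp (measurable_powR _)).
apply: (borel_comp measurable_enorm).
by apply: measurable_coordsB; apply: measurable_coordsP; [exact: measurable_fst|exact: measurable_snd].
Qed.

Lemma gagliardo_pair_energy s u : gagliardo_seminorm s u = pair_energy (riesz s) u.
Proof.
apply: eq_integral => y _; apply: eq_integral => x _.
by rewrite /fractional_kernel mulrC.
Qed.

Lemma integral2_indic s u (A B : set V) :
  (\int[leb]_(y in (A : set T)) \int[leb]_(x in (B : set T)) (fractional_kernel s u x y)%:E =
   pair_energy (fun x y => (\1_A y * \1_B x * riesz s x y)%R) u)%E.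
Proof.
rewrite integral_mkcond; apply: eq_integral => y _; rewrite /patch indicE.
case: ifPn => _; last by rewrite integral0_eq// => x _; rewrite !mul0r.
rewrite integral_indic_mul; apply: eq_integral => x _.
by rewrite /fractional_kernel/= mul1r -mulrA (mulrC `|_|).
Qed.

Lemma pair_energyZ (c : R) k u : 0 <= c -> measurable2 k -> (forall x y, 0 <= k x y) ->
  measurable_fun [set: T] u ->
  (pair_energy (fun x y => (c * k x y)%R) u = c%:E * pair_energy k u)%E.
Proof.
move=> c0 mk k0 mu; have m1 := measurable_pair_energy_integrand mk mu.
have p1 x y : (0 <= (k x y * `|u x - u y|)%:E)%E by rewrite lee_fin mulr_ge0.
rewrite /pair_energy -leb_integralZl; last 3 first.
- by rewrite lee_fin.
- by move=> y; exact: integral_ge0.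
- by apply: (@measurable_integral1 _ _ _ T) => [x y|]; [exact: p1|exact: m1].
apply: eq_integral => y _; rewrite -leb_integralZl; last 3 first.
- by rewrite lee_fin.
- by move=> x; exact: p1.
- exact: (measurable_slice1 (y : T) m1).
by apply: eq_integral => x _; rewrite -EFinM mulrA.
Qed.

Definition riesz_in s (O : set V) (x y : V) : R :=
  \1_O y * (1 - 2^-1 * \1_O x) * riesz s x y.

Lemma riesz_in_ge0 s O x y : 0 <= riesz_in s O x y.
Proof.
rewrite mulr_ge0 ?riesz_ge0// mulr_ge0// !indicE.
by case: (_ \in _) => /=; lra.
Qed.

Lemma measurable_riesz_in s (O : set V) : measurable (O : set T) -> measurable2 (riesz_in s O).
Proof.
move=> mO; apply: measurable_funM; last exact: measurable_riesz.
apply: measurable_funM.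
  exact: (measurableT_comp (measurable_indic mO) measurable_snd).
apply: measurable_funB; first exact: measurable_cst.
apply: measurable_funM; first exact: measurable_cst.
exact: (measurableT_comp (measurable_indic mO) measurable_fst).
Qed.

Lemma fractional_pair_energy s u (O : set V) : measurable (O : set T) ->
  measurable_fun [set: T] u -> fractional_energy s u O = pair_energy (riesz_in s O) u.
Proof.
move=> mO mu; have mOc : measurable (~` O : set T) by exact: measurableC.
have m1 (A B : set V) : measurable (A : set T) -> measurable (B : set T) ->
    measurable2 (fun x y => \1_A y * \1_B x * riesz s x y).
  move=> mA mB; apply: measurable_funM; last exact: measurable_riesz.
  apply: measurable_funM.
    exact: (measurableT_comp (measurable_indic mA) measurable_snd).
  exact: (measurableT_comp (measurable_indic mB) measurable_fst).
have p1 (A B : set V) x y : 0 <= \1_A y * \1_B x * riesz s x y.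
  by rewrite !mulr_ge0// riesz_ge0.
rewrite /fractional_energy !integral2_indic -pair_energyZ//; last exact: m1.
have m2 : measurable2 (fun x y => 2^-1 * (\1_O y * \1_O x * riesz s x y)).
  by apply: measurable_funM; [exact: measurable_cst|exact: m1].
have p2 x y : 0 <= 2^-1 * (\1_O y * \1_O x * riesz s x y) by rewrite mulr_ge0.
rewrite -(pair_energyD m2 (m1 _ _ mO mOc) p2 (p1 _ _) mu).
apply: eq_integral => y _; apply: eq_integral => x _; congr (_ * _)%:E.
rewrite /riesz_in (_ : \1_(~` O) x = 1 - \1_O x :> R); last first.
  by rewrite !indicE in_setC; case: (_ \in _); rewrite ?subrr ?subr0.
by field.
Qed.

Lemma bounded_test_function f : test_function f -> exists M, forall x, `|f x| <= M.
Proof.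
move=> [/(_ 0%N) [cf _] suppf].
have /compact_bounded[M [_ HM]] : compact (f @` fsupport f).
  by apply: continuous_compact => //; exact: continuous_subspaceT.
exists (Num.max (M + 1) 0) => x.
have [fx0|fx0] := eqVneq (f x) 0; first by rewrite fx0 normr0 le_max lexx orbT.
rewrite le_max; apply/orP; left; apply: HM; first by rewrite ltrDl.
by exists x => //; exact: subset_closure.
Qed.

Lemma measurable_coordsZ d (X : measurableType d) (g : X -> V) (c : R) :
  measurable_coords g -> measurable_coords (fun t => c *: g t).
Proof.
move=> mg i; under eq_fun do rewrite mxE.
by apply: measurable_funM; [exact: measurable_cst|exact: mg].
Qed.

Lemma measurable_coords_borel : measurable_coords (id : borelRd -> V).
Proof. by move=> i; apply: borel_continuous; exact: coord_continuous. Qed.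

Lemma averaging_rescale (eta : V -> R) (eps : R) : symmetric_mollifier eta -> 0 < eps ->
  averaging eps (rescale eta eps).
Proof.
move=> [teta suppeta eta0 etaN eta1] eps0; have epsV0 : 0 < eps^-1 by rewrite invr_gt0.
have [/(_ 0%N) [ceta _] _] := teta.
have beta : measurable_fun [set: borelRd] eta by exact: borel_continuous.
have ceps : 0 <= eps ^- n.+1 by rewrite invr_ge0 exprn_ge0// ltW.
split.
- apply: measurable_funM; first exact: measurable_cst.
  by apply: (borel_comp beta); apply: measurable_coordsZ; exact: measurable_coords_borel.
- by move=> x; rewrite mulr_ge0.
- by move=> x; rewrite /rescale scalerN etaN.
- move=> x epsx; rewrite /rescale; have [->|etax] := eqVneq (eta (eps^-1 *: x)) 0.
    by rewrite mulr0.
  have : enorm (eps^-1 *: x) < 1 by apply: suppeta; exact: subset_closure.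
  move=> /(le_lt_trans (le_norm_enorm _)).
  by rewrite normrZ gtr0_norm// mulrC ltr_pdivrMr// mul1r ltNge epsx.
- have [M HM] := bounded_test_function teta; exists (eps ^- n.+1 * M) => x.
  by rewrite ler_wpM2l// (le_trans (ler_norm _)).
- under eq_integral => x _ do rewrite /rescale EFinM.
  have meta := borel_measurable_fun beta.
  have := @ge0_integral_affine R n eps^-1 0 (fun x => (eta x)%:E) epsV0
    ((measurable_EFinP _ _).2 meta) (fun x => eta0 x).
  rewrite eta1 mule1 -exprVn invrK => E.
  have mc : measurable_fun [set: T] (fun x => (eta (eps^-1 *: x))%:E).
    apply/measurable_EFinP; apply: (borel_comp beta); apply: measurable_coordsZ.
    exact: measurable_coord.
  rewrite leb_integralZl//; last by move=> x; rewrite lee_fin.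
  rewrite (_ : (\int[leb]_x (eta (eps^-1 *: x))%:E = (eps ^+ n.+1)%:E)%E).
    by rewrite -EFinM mulVf// gt_eqF// exprn_gt0.
  by rewrite -E; apply: eq_integral => x _; rewrite /affine addr0.
Qed.

Import HBSimple.

(** The weight [g] is only integrable, so it is replaced by a simple, hence bounded, function [h].
    On [g - h] the indicator increment is at most 1 and the L^1 error counts; on [h] the bound times
    the plain modulus of continuity of the indicator counts. *)
Lemma weighted_shift_cont (g : T -> \bar R) (A : set V) (e : R) : 0 < e ->
  measurable_fun [set: T] g -> (forall x, 0 <= g x)%E -> (\int[leb]_x g x < +oo)%E ->
  measurable (A : set T) -> (leb A < +oo)%E ->
  exists2 r : R, 0 < r & forall z, `|z| < r ->
    (\int[leb]_x (g x * `|\1_A (x + z)%R - \1_A x|%:E) <= e%:E)%E.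
Proof.
move=> e0 mg g0 gfin mA Afin.
have gi : leb.-integrable [set: T] g.
  apply/integrableP; split=> //.
  by under eq_integral => x _ do rewrite gee0_abs//.
have [h [hi _ hg]] := approximation_sfun_integrable measurableT gi.
have e20 : 0 < e / 2 by rewrite divr_gt0.
have e20' : (0 < (e / 2)%:E)%E by rewrite lte_fin.
have [j _ /(_ j (leqnn j))/= {}hg] := cvge_lt_near hg e20'.
move: (h j) hg => {h hi j}h hg.
have [C [_ HC]] := simple_bounded h.
pose C1 := Num.max (C + 1) 0.
have hC x : `|h x| <= C1.
  by rewrite le_max HC ?ltrDl//.
have C10 : 0 <= C1 by rewrite le_max lexx orbT.
have C11 : 0 < C1 + 1 by rewrite ltr_wpDl.
have [r r0 Ar] := shift_cont_indic mA Afin (divr_gt0 e20 C11).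
exists r => // z zr.
pose q (x : V) : R := `|\1_A (x + z) - \1_A x|.
have q0 x : 0 <= q x by rewrite /q normr_ge0.
have q1 x : q x <= 1.
  rewrite /q !indicE; case: (_ \in A); case: (_ \in A);
    by rewrite ?subrr ?subr0 ?sub0r ?normrN ?normr1 ?normr0.
have m1A : measurable_fun [set: T] (\1_A : V -> R) by exact: measurable_indic.
have mq : measurable_fun [set: T] (fun x => (q x)%:E) by exact: measurable_normB_shift.
have mgh' : measurable_fun [set: T] (fun x => g x - (h x)%:E)%E.
  apply: emeasurable_funB; first exact: mg.
  by apply/measurable_EFinP; exact: measurable_funPT.
have mgh : measurable_fun [set: T] (fun x => `|g x - (h x)%:E|)%E.
  by apply: measurableT_comp; [|exact: mgh'].
have mCq : measurable_fun [set: T] (fun x => (C1 + 1)%:E * (q x)%:E)%E.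
  by apply: emeasurable_funM; [exact: measurable_cst|exact: mq].
apply: (@le_trans _ _ (\int[leb]_x (`|g x - (h x)%:E| + (C1 + 1)%:E * (q x)%:E))%E).
  apply: le_leb_integral.
  - by move=> x; rewrite mule_ge0// lee_fin.
  - by apply: emeasurable_funM; [exact: mg|exact: mq].
  - by apply: emeasurable_funD; [exact: mgh|exact: mCq].
  (* The weight may be infinite at some points; there the majorant is infinite too. *)
  - move=> x; case: (g x) (g0 x) => [gx|_|]//; last first.
      by rewrite /= addye// leey.
    rewrite !lee_fin => gx0; rewrite -/(q x).
    have : gx <= `|gx - h x| + C1.
      have := ler_norm (gx - h x); have := ler_norm (h x); have := hC x; lra.
    move=> /(fun H => ler_wpM2r (q0 x) H) /le_trans; apply.
    rewrite mulrDl; apply: lerD; first by rewrite ler_piMr.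
    by rewrite ler_wpM2r// lerDl.
rewrite leb_integralD//; last first.
  by move=> x; rewrite mule_ge0 ?lee_fin//; exact: ltW.
rewrite leb_integralZl//; last by rewrite lee_fin ltW.
rewrite (_ : e = e / 2 + e / 2); last by field.
rewrite [in leRHS]EFinD; apply: leeD; first exact: ltW.
by rewrite -lee_pdivlMl// muleC -EFinM; exact: Ar.
Qed.

End fractional_kernels.

(** * Convergence of the energies under mollification *)

Section mollification_energy.
Context {R : realType} {n : nat}.
Local Notation V := 'rV[R]_n.+1.
Local Notation T := (Rd R n).
Local Notation borelRd := (@borelRd R n).
Implicit Types (u v f g phi : V -> R) (k : V -> V -> R) (z : V) (s : R).

Lemma compactly_contained_shift (O' O : set V) : open O -> compactly_contained O' O ->
  exists2 r : R, 0 < r & forall x z, `|z| < r -> O' x -> O (x + z).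
Proof.
move=> oO [cO' O'O].
have : nbhs (0 : V) (fun z => closure O' `<=` (fun x => O (x + z))).
  apply: ((compact_near_coveringP _).1 cO' V (nbhs (0 : V)) (fun z x => O (x + z))) => x cx.
  have Ox : nbhs (x + 0) O by rewrite addr0; apply: open_nbhs_nbhs; split=> //; exact: O'O.
  exact: (@add_continuous V (x, 0) O Ox).
move=> /nbhs_ballP[e /= e0 He].
exists e => // x z ze O'x; apply: (He z); last exact: subset_closure.
by rewrite -ball_normE /= sub0r normrN.
Qed.

Lemma compactly_contained_fin (O' O : set V) : compactly_contained O' O -> (leb O' < +oo)%E.
Proof.
move=> [/compact_bounded[M [_ HM]] _].
apply: (le_lt_trans _ (leb_cball_fin (M + 1))); apply: le_lebesgue_outer => x O'x.
by apply: (HM (M + 1)); [rewrite ltrDl|exact: subset_closure].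
Qed.

(* a, b indicate that y, x lie in Omega' after a shift, a', b' before it, and c that x lies in
   Omega: 1 - c/2 is the weight in riesz_in for Omega. *)
Lemma weight_shift_le (a a' b b' c : bool) :
  a%:R * (1 - 2^-1 * b%:R) <= a'%:R * (1 - 2^-1 * b'%:R) +
    2 * (1 - 2^-1 * c%:R) * (`|a%:R - a'%:R| + `|b%:R - b'%:R|) :> R.
Proof.
by case: a; case: a'; case: b; case: b'; case: c;
  rewrite /= ?subrr ?subr0 ?sub0r ?normrN ?normr1 ?normr0; lra.
Qed.

(** By [weight_shift_le] the shifted and unshifted weights differ by at most the dominating kernel
    [k] times [d x + d y], where [d] is the increment of the indicator of [O']. Each error term,
    integrated first in the variable that [d] does not involve, becomes a weighted modulus of
    continuity covered by [weighted_shift_cont]. *)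
Lemma riesz_in_shift_le s u (O' O : set V) (r : R) (e : R) :
  0 < e -> 0 < r -> measurable_fun [set: T] u ->
  measurable (O' : set T) -> measurable (O : set T) -> (leb O' < +oo)%E ->
  (forall x z, `|z| < r -> O' x -> O (x + z)) ->
  (pair_energy (riesz_in s O) u < +oo)%E ->
  exists2 r0 : R, 0 < r0 & forall z, `|z| < r0 ->
    (pair_energy (fun x y => riesz_in s O' (x - z)%R (y - z)%R) u <=
     pair_energy (riesz_in s O') u + e%:E)%E.
Proof.
move=> e0 r_gt0 mu mO' mO O'fin O'O Ofin.
(* The weight 1 - 1_O(x)/2 can be as small as 1/2; the factor 2 brings it up to at least 1. *)
pose k x y : R := 2 * riesz_in s O x y.
have mk : measurable2 k.
  by apply: measurable_funM; [exact: measurable_cst|exact: measurable_riesz_in].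
have k0 x y : 0 <= k x y by rewrite mulr_ge0// riesz_in_ge0.
have kfin : (pair_energy k u < +oo)%E.
  rewrite pair_energyZ//; [by rewrite lte_mul_pinfty| exact: measurable_riesz_in|].
  by move=> x y; exact: riesz_in_ge0.
have mh := measurable_pair_energy_integrand mk mu.
pose h x y : \bar R := (k x y * `|u x - u y|)%:E.
have h0 x y : (0 <= h x y)%E by rewrite lee_fin mulr_ge0.
have mhs : measurable_fun [set: T * T] (fun p => h p.2 p.1).
  exact: (measurableT_comp mh (measurable_fun_pair measurable_snd measurable_fst)).
(* The two marginals of the energy density on [O]: one weights the increment in [y], the other that
   in [x]. Tonelli gives them the same finite integral. *)
pose g y := (\int[leb]_x h x y)%E; pose g' x := (\int[leb]_y h x y)%E.
have mg : measurable_fun [set: T] g.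
  by apply: (@measurable_integral1 _ _ _ T) => [x y|]; [exact: h0|exact: mh].
have mg' : measurable_fun [set: T] g'.
  by apply: (@measurable_integral1 _ _ _ T (fun y x => h x y)) => [x y|]; [exact: h0|exact: mhs].
have g0 x : (0 <= g x)%E by exact: integral_ge0.
have g'0 x : (0 <= g' x)%E by exact: integral_ge0.
have gg' : (\int[leb]_x g' x = \int[leb]_y g y)%E.
  exact: (@fubini_tonelli _ _ T T R leb leb _ mh (fun p => h0 p.1 p.2)).
have g'fin : (\int[leb]_x g' x < +oo)%E by rewrite gg'.
have e20 : 0 < e / 2 by rewrite divr_gt0.
have [r1 r10 Hr1] := weighted_shift_cont e20 mg g0 kfin mO' O'fin.
have [r2 r20 Hr2] := weighted_shift_cont e20 mg' g'0 g'fin mO' O'fin.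
exists (Num.min r (Num.min r1 r2)); first by rewrite !lt_min r_gt0 r10.
move=> z; rewrite !lt_min => /and3P[zr zr1 zr2].
have mO's := measurable_riesz_in s mO'.
pose d (x : V) : R := `|\1_O' (x - z) - \1_O' x|.
have d0 x : 0 <= d x by rewrite normr_ge0.
have md : measurable_fun [set: T] d.
  apply: measurable_norm; apply: measurable_funB; last exact: measurable_indic.
  by apply: measurable_comp_shift; exact: measurable_indic.
have mde : measurable_fun [set: T] (fun x => (d x)%:E) by exact/measurable_EFinP.
pose k1 x y := k x y * d y; pose k2 x y := k x y * d x.
have k10 x y : 0 <= k1 x y by rewrite mulr_ge0.
have k20 x y : 0 <= k2 x y by rewrite mulr_ge0.
have mk1 : measurable2 k1.
  by apply: measurable_funM; [exact: mk|exact: (measurableT_comp md measurable_snd)].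
have mk2 : measurable2 k2.
  by apply: measurable_funM; [exact: mk|exact: (measurableT_comp md measurable_fst)].
have mk12 : measurable2 (fun x y => k1 x y + k2 x y).
  by apply: measurable_funD; [exact: mk1|exact: mk2].
have k120 x y : 0 <= k1 x y + k2 x y by rewrite addr_ge0.
have ri0 (O1 : set V) x y : 0 <= riesz_in s O1 x y by exact: riesz_in_ge0.
have E1 : (pair_energy k1 u <= (e / 2)%:E)%E.
  have := Hr1 (- z); rewrite normrN => /(_ zr1); apply: le_trans.
  rewrite le_eqVlt; apply/orP; left; apply/eqP; apply: eq_integral => y _.
  rewrite -/(d y) muleC -leb_integralZl; last 3 first.
  - by rewrite lee_fin.
  - by move=> x; exact: h0.
  - exact: (measurable_slice1 (y : T) mh).
  by apply: eq_integral => x _; rewrite /h -EFinM /k1 mulrA (mulrC (d y)).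
have E2 : (pair_energy k2 u <= (e / 2)%:E)%E.
  have mh2 := measurable_pair_energy_integrand mk2 mu.
  have p2 (p : T * T) : (0 <= (k2 p.1 p.2 * `|u p.1 - u p.2|)%:E)%E.
    by rewrite lee_fin mulr_ge0.
  have := Hr2 (- z); rewrite normrN => /(_ zr2); apply: le_trans.
  rewrite /pair_energy.
  have := @fubini_tonelli _ _ T T R leb leb _ mh2 p2 => /= <-.
  rewrite le_eqVlt; apply/orP; left; apply/eqP; apply: eq_integral => x _.
  rewrite -/(d x) muleC -leb_integralZl; last 3 first.
  - by rewrite lee_fin.
  - by move=> y; exact: h0.
  - exact: (measurable_slice2 (x : T) mh).
  by apply: eq_integral => y _; rewrite /h -EFinM /k2 mulrA (mulrC (d x)).
rewrite (_ : e = e / 2 + e / 2); last by field.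
rewrite EFinD; apply: (@le_trans _ _ (pair_energy (riesz_in s O') u +
    (pair_energy k1 u + pair_energy k2 u))%E); last first.
  by apply: leeD; [exact: lexx|apply: leeD; [exact: E1|exact: E2]].
have E12 := pair_energyD mk1 mk2 k10 k20 mu.
have E3 := pair_energyD mO's mk12 (ri0 O') k120 mu.
rewrite [leRHS](esym (etrans E3 (congr1 (fun t => pair_energy (riesz_in s O') u + t)%E E12))).
apply: le_pair_energy.
- apply: (@measurable2_comp _ _ _ _ (T * T)%type (fun p => p.1 - z) (fun p => p.2 - z) mO's).
    exact: (measurableT_comp (measurable_shift (- z)) measurable_fst).
  exact: (measurableT_comp (measurable_shift (- z)) measurable_snd).
- by apply: measurable_funD; [exact: mO's|exact: mk12].
- exact: mu.
- exact: mu.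
- by move=> x y; exact: ri0.
- move=> x y; apply: ler_wpM2r => //.
  rewrite /k1 /k2 /k /riesz_in riesz_shift.
  have K0 := riesz_ge0 s x y; set K := riesz s x y in K0 *.
  suff H : \1_O' (y - z) * (1 - 2^-1 * \1_O' (x - z)) <=
      \1_O' y * (1 - 2^-1 * \1_O' x) +
      2 * (\1_O y * (1 - 2^-1 * \1_O x)) * (d y + d x).
    have := ler_wpM2r K0 H; congr (_ <= _); ring.
  rewrite /d !indicE.
  (* If [y] is outside [O], then [y - z] is outside [O'], because its shift by [z] would lie in [O];
     so the left side is 0. *)
  have [Oy|Oy] := boolP (y \in O); last first.
    rewrite (memNset (_ : ~ O' (y - z))); last first.
      move=> /(O'O _ _ zr); rewrite subrK => Oy'.
      by move: Oy; rewrite notin_setE.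
    case: (y \in O'); case: (x \in O');
      by rewrite ?mul0r ?mulr0 ?mul1r ?mulr1 ?addr0 ?add0r//; lra.
  by rewrite mul1r; exact: weight_shift_le.
Qed.

Lemma cvge_squeeze {S : Type} {F : set_system S} {FF : Filter F} (f : S -> \bar R) (l : \bar R) :
  l \is a fin_num ->
  (forall a, (a < l)%E -> \forall x \near F, (a < f x)%E) ->
  (forall e : R, 0 < e -> \forall x \near F, (f x <= l + e%:E)%E) -> f x @[x --> F] --> l.
Proof.
case: l => [l| |]// _ fl lf; apply/fine_cvgP; split.
  have l1 : ((l - 1)%:E < l%:E)%E by rewrite lte_fin ltrBlDr ltrDl.
  near=> x; rewrite fin_real//; apply/andP; split.
    by apply: (@lt_trans _ _ (l - 1)%:E); [exact: ltNyr|near: x; exact: fl].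
  apply: (@le_lt_trans _ _ (l%:E + 1%:E)%E); first by near: x; exact: lf.
  by rewrite -EFinD ltry.
apply/cvgrPdist_le => e e0.
have le : ((l - e)%:E < l%:E)%E by rewrite lte_fin ltrBlDr ltrDl.
near=> x => /=; have : ((l - e)%:E < f x)%E by near: x; exact: fl.
have : (f x <= l%:E + e%:E)%E by near: x; exact: lf.
case: (f x) => [y| |]//=; rewrite -EFinD !lee_fin lte_fin => h1 h2.
by rewrite ler_norml; apply/andP; split; lra.
Unshelve. all: by end_near.
Qed.

(** The common core of (i) and (ii). They differ only in how the last hypothesis is met: by
    translation invariance for the Riesz kernel, by [riesz_in_shift_le] for the energy on a set. *)
Lemma mollify_energy_cvg k v (eta : V -> R) : symmetric_mollifier eta ->
  measurable_fun [set: borelRd] v -> L1loc v -> measurable2 k -> (forall x y, 0 <= k x y) ->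
  (pair_energy k v < +oo)%E ->
  (forall e : R, 0 < e -> exists2 r : R, 0 < r & forall z, `|z| < r ->
     (pair_energy (fun x y => k (x - z)%R (y - z)%R) v <= pair_energy k v + e%:E)%E) ->
  pair_energy k (mollify eta eps v) @[eps --> 0^'+] --> pair_energy k v.
Proof.
move=> heta bv vL mk k0 kfin kshift; have mv := borel_measurable_fun bv.
have k_ge0 : (0 <= pair_energy k v)%E by exact: pair_energy_ge0.
apply: cvge_squeeze; first by rewrite ge0_fin_numE.
- move=> a av; have [M [d d0 Hd]] := pair_energy_lsc mk k0 mv av.
  have [r0 r00 Hr] := convol_L1loc_cvg M d0 bv vL.
  near=> eps.
  have eps0 : 0 < eps by near: eps; exact: nbhs_right_gt.
  have epsr : 0 < eps <= r0.
    by rewrite eps0 /=; near: eps; exact: nbhs_right_le.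
  have aeps := averaging_rescale heta eps0.
  by apply: Hd; [exact: measurable_convol aeps mv|exact: Hr epsr aeps].
- move=> e e0; have [r r0 Hr] := kshift e e0.
  near=> eps.
  have eps0 : 0 < eps by near: eps; exact: nbhs_right_gt.
  have epsr : eps <= r by near: eps; exact: nbhs_right_le.
  apply: (pair_energy_convol_le eps0 (averaging_rescale heta eps0) bv vL mk k0) => z zeps.
  exact: Hr (lt_le_trans zeps epsr).
Unshelve. all: by end_near.
Qed.

(** The two averages agree at every point, not merely almost everywhere, since for fixed [x] the
    integrand changes only on [N]. *)
Lemma convol_ae r phi u v (N : set V) : averaging r phi ->
  measurable_fun [set: T] u -> measurable_fun [set: T] v ->
  measurable (N : set T) -> leb N = 0%E -> (forall x, ~ N x -> u x = v x) ->
  convol phi u = convol phi v.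
Proof.
move=> aphi mu mv mN N0 uv; apply/funext => x.
have mphi : measurable_fun [set: T] (fun y => phi (x - y)).
  apply: (borel_comp (averaging_borel aphi)).
  by apply: measurable_coordsB; [exact: measurable_coords_cst|exact: measurable_coord].
congr fine; apply: ae_eq_integral.
- exact: measurableT.
- by apply/measurable_EFinP; apply: measurable_funM; [exact: mu|exact: mphi].
- by apply/measurable_EFinP; apply: measurable_funM; [exact: mv|exact: mphi].
- by apply: (ae_leb mN N0) => y Ny _; rewrite uv.
Qed.

Lemma mollify_ae (eta : V -> R) (eps : R) u v (N : set V) : symmetric_mollifier eta -> 0 < eps ->
  measurable_fun [set: T] u -> measurable_fun [set: T] v ->
  measurable (N : set T) -> leb N = 0%E -> (forall x, ~ N x -> u x = v x) ->
  mollify eta eps u = mollify eta eps v.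
Proof. by move=> heta eps0; exact: (convol_ae (averaging_rescale heta eps0)). Qed.

Lemma L1loc_ae u v (N : set V) : L1loc u -> measurable_fun [set: T] v ->
  measurable (N : set T) -> leb N = 0%E -> (forall x, ~ N x -> u x = v x) -> L1loc v.
Proof.
move=> [mu uL] mv mN N0 uv; split=> // K cK.
have mK : measurable (K : set T).
  by apply: measurable_closed; apply: compact_closed => //; exact: norm_hausdorff.
have := uL K cK; rewrite integral_indic_mul => uK.
rewrite integral_indic_mul; apply: le_lt_trans uK.
rewrite le_eqVlt; apply/orP; left; apply/eqP; apply: (leb_integral_ae mN N0).
- by move=> x; rewrite lee_fin mulr_ge0.
- by move=> x; rewrite lee_fin mulr_ge0.
- by apply/measurable_EFinP; apply: measurable_indicM; [exact: mK|exact: measurable_norm].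
- by apply/measurable_EFinP; apply: measurable_indicM; [exact: mK|exact: measurable_norm].
- by move=> x Nx; rewrite uv.
Qed.

Lemma fractional_energy_mollify_cvg s (eta : V -> R) u (O O' : set V) :
  symmetric_mollifier eta -> L1loc u -> open O -> (fractional_energy s u O < +oo)%E ->
  open O' -> compactly_contained O' O ->
  fractional_energy s (mollify eta eps u) O' @[eps --> 0^'+] --> fractional_energy s u O'.
Proof.
move=> heta uL oO; have [mu _] := uL.
have mO := measurable_open oO.
rewrite fractional_pair_energy// => Ofin oO' O'O; have mO' := measurable_open oO'.
have [v [N [bv bN N0 uv]]] := borel_ae_fun mu.
have mv := borel_measurable_fun bv; have mN := borel_measurable bN.
have vL := L1loc_ae uL mv mN N0 uv.
have ri0 (O1 : set V) x y : 0 <= riesz_in s O1 x y by exact: riesz_in_ge0.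
have uvE (O1 : set V) : measurable (O1 : set T) ->
    pair_energy (riesz_in s O1) u = pair_energy (riesz_in s O1) v.
  move=> mO1; apply: (pair_energy_ae _ (ri0 O1) mu mv mN N0 uv).
  exact: measurable_riesz_in.
have [r r0 HO'] := compactly_contained_shift oO O'O.
have O'fin := compactly_contained_fin O'O.
rewrite uvE// in Ofin; rewrite fractional_pair_energy// uvE//.
have O'sub : O' `<=` O by move=> x O'x; apply: O'O.2; exact: subset_closure.
have O'E : (pair_energy (riesz_in s O') v < +oo)%E.
  (* The weights are not pointwise monotone in the set: for [y] in [O'] and [x] in [O] but not in
     [O'] they are 1 and 1/2. The factor 2 makes up for this. *)
  have le2 : (pair_energy (riesz_in s O') v <= 2%:E * pair_energy (riesz_in s O) v)%E.
    rewrite -pair_energyZ//; last exact: measurable_riesz_in.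
    apply: le_pair_energy.
    - exact: measurable_riesz_in.
    - by apply: measurable_funM; [exact: measurable_cst|exact: measurable_riesz_in].
    - exact: mv.
    - exact: mv.
    - by move=> x y; exact: ri0.
    - move=> x y; apply: ler_wpM2r => //; rewrite /riesz_in mulrA.
      apply: ler_wpM2r; first exact: riesz_ge0.
      rewrite !indicE; have [yO|_] := boolP (y \in O').
        rewrite (mem_set (_ : O y)); last by apply: O'sub; move: yO; rewrite inE.
        by case: (x \in O); case: (x \in O') => /=; lra.
      by rewrite mul0r; case: (y \in O); case: (x \in O) => /=; lra.
  by apply: le_lt_trans le2 _; rewrite lte_mul_pinfty.
have key := mollify_energy_cvg heta bv vL (measurable_riesz_in s mO') (ri0 O') O'E
  (fun e e0 => riesz_in_shift_le e0 r0 mv mO' mO O'fin HO' Ofin).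
apply: cvg_trans key; apply: near_eq_cvg; near=> eps.
have eps0 : 0 < eps by near: eps; exact: nbhs_right_gt.
rewrite (mollify_ae heta eps0 mu mv mN N0 uv) fractional_pair_energy; first by [].
- exact: mO'.
- exact: measurable_convol (averaging_rescale heta eps0) mv.
Unshelve. all: by end_near.
Qed.

Lemma gagliardo_mollify_cvg s (eta : V -> R) u : symmetric_mollifier eta -> sobolev_Ws1 s u ->
  gagliardo_seminorm s (mollify eta eps u) @[eps --> 0^'+] --> gagliardo_seminorm s u.
Proof.
move=> heta [ui]; have uL := integrable_L1loc ui; have [mu _] := uL.
rewrite gagliardo_pair_energy => ufin.
have [v [N [bv bN N0 uv]]] := borel_ae_fun mu.
have mv := borel_measurable_fun bv; have mN := borel_measurable bN.
have vL := L1loc_ae uL mv mN N0 uv.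
have r0 (x y : V) : 0 <= riesz s x y by exact: riesz_ge0.
have mr : measurable2 (riesz s : V -> V -> R) by exact: measurable_riesz.
have uvE : pair_energy (riesz s) u = pair_energy (riesz s) v.
  exact: (pair_energy_ae mr r0 mu mv mN N0 uv).
rewrite uvE in ufin *.
have key : pair_energy (riesz s) (mollify eta eps v) @[eps --> 0^'+] --> pair_energy (riesz s) v.
  apply: (mollify_energy_cvg heta bv vL mr r0 ufin) => e e0; exists 1 => // z _.
  rewrite (_ : (fun x y : V => riesz s (x - z)%R (y - z)%R) = riesz s).
    by rewrite leeDl// lee_fin ltW.
  by apply/funext => x; apply/funext => y; exact: riesz_shift.
apply: cvg_trans key; apply: near_eq_cvg; near=> eps.
have eps0 : 0 < eps by near: eps; exact: nbhs_right_gt.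
by rewrite (mollify_ae heta eps0 mu mv mN N0 uv) gagliardo_pair_energy.
Unshelve. all: by end_near.
Qed.

End mollification_energy.

(** * Cutoff *)

Section cutoff.
Context {R : realType} {n : nat}.
Local Notation V := 'rV[R]_n.+1.
Local Notation T := (Rd R n).
Local Notation borelRd := (@borelRd R n).
Implicit Types (u v f g phi : V -> R) (k : V -> V -> R) (z : V) (s : R).

(** The half-open cube of half-side [r] would miss faces of the closed ball, so half-side 2r is
    used, that is, side 4r. *)
Lemma leb_cball_le (r : R) : 0 < r -> (leb (cball r : set V) <= ((4 * r) ^+ n.+1)%:E)%E.
Proof.
move=> r0; have r20 : 0 <= 2 * r by lra.
apply: (@le_trans _ _ (leb (hobox (cube (0 : V) (2 * r))))).
  apply: le_lebesgue_outer => x xr; apply/cubeP => i; rewrite !mxE.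
  have := le_trans (coord_le_norm x i) xr; rewrite ler_norml => /andP[? ?].
  by apply/andP; split; lra.
apply: le_trans (leb_cube _ r20) _; rewrite lee_fin (_ : 4 * r = 2 * (2 * r))//.
by rewrite mulrA -natrM.
Qed.

(** Here [f] is at most the sum over [j] of [c j] times the indicator of the ball of radius [r j],
    and the last hypothesis compares the integrals of these terms with a geometric series. *)
Lemma integral_shells_fin f (r c : nat -> R) (C q : R) :
  measurable_fun [set: T] f -> (forall x, 0 <= f x) ->
  (forall x, f x = 0 \/ exists j, `|x| <= r j /\ f x <= c j) ->
  (forall j, 0 < r j) -> (forall j, 0 <= c j) -> 0 <= q < 1 ->
  (forall j, c j * (4 * r j) ^+ n.+1 <= C * q ^+ j) ->
  (\int[leb]_x (f x)%:E < +oo)%E.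
Proof.
move=> mf f0 fc r0 c0 /andP[q0 q1] cq.
pose h j (x : V) : \bar R := (c j * \1_(cball (r j)) x)%:E.
have h0 j x : (0 <= h j x)%E by rewrite lee_fin mulr_ge0.
have mh j : measurable_fun [set: T] (h j).
  apply/measurable_EFinP; apply: measurable_funM; first exact: measurable_cst.
  by apply: measurable_indic; exact: measurable_cball.
apply: (@le_lt_trans _ _ (\int[leb]_x \sum_(j <oo) h j x)%E).
  apply: le_leb_integral.
  - by move=> x; rewrite lee_fin.
  - exact/measurable_EFinP.
  - by apply: ge0_emeasurable_sum => [j x _ _|j _]; [exact: h0|exact: mh].
  - move=> x; have [->|[j [xr fj]]] := fc x; first exact: nneseries_ge0.
    apply: (@le_trans _ _ (h j x)).
      by rewrite lee_fin indicE mem_set// mulr1.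
    rewrite (@nneseriesD1 _ _ j)//.
    by rewrite leeDl//; exact: nneseries_ge0.
rewrite integral_nneseries//.
apply: (@le_lt_trans _ _ (\sum_(j <oo) (C * q ^+ j)%:E)%E).
  apply: lee_nneseries => [j _ _|j _]; first by apply: integral_ge0 => x _; exact: h0.
  rewrite /h; under eq_integral => x _ do rewrite EFinM.
  rewrite leb_integralZl; last 3 first.
  - by rewrite lee_fin.
  - by move=> x; rewrite lee_fin.
  - by apply/measurable_EFinP; apply: measurable_indic; exact: measurable_cball.
  rewrite integral_indic ?setIT//; last exact: measurable_cball.
  apply: (@le_trans _ _ ((c j)%:E * ((4 * r j) ^+ n.+1)%:E)%E); last by rewrite -EFinM lee_fin.
  by apply: lee_wpmul2l; [rewrite lee_fin|exact: leb_cball_le].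
have nq : `|q| < 1 by rewrite ger0_norm.
have := @cvg_geometric_series R C q nq.
move=> /cvgP cs.
have -> : (\sum_(j <oo) (C * q ^+ j)%:E = (limn (series (geometric C q)))%:E)%E.
  rewrite -EFin_lim//; apply/congr_lim/funext => N /=.
  by rewrite /series /geometric /= sumEFin.
by rewrite ltry.
Qed.

Lemma dyadic_bracket (y : R) : 1 <= y -> exists j : nat, 2 ^+ j <= y < 2 ^+ j.+1.
Proof.
move=> y1; have ex : exists j : nat, y < 2 ^+ j.+1.
  exists (Num.bound y); apply: lt_trans (archi_boundP _) _; first exact: le_trans y1.
  rewrite -natrX ltr_nat; apply: leq_trans (@ltn_expl 2 _ isT) _.
  by rewrite leq_exp2l.
exists (ex_minn ex); case: ex_minnP => j yj jmin; rewrite yj andbT.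
case: j yj jmin => [|j] yj jmin; first by rewrite expr0.
by rewrite leNgt; apply/negP => /jmin; rewrite ltnn.
Qed.

Lemma powR_exp2 s (j : nat) : (2 ^+ j) `^ s = (2 `^ s) ^+ j :> R.
Proof. by rewrite -powR_mulrn// -powRrM mulrC powRrM powR_mulrn ?powR_ge0. Qed.

Lemma powR_dim s (x : R) : 0 < x -> x `^ (n.+1%:R + s) = x ^+ n.+1 * x `^ s.
Proof. by move=> x0; rewrite powRD ?powR_mulrn ?(ltW x0)//; apply/implyP => _; rewrite gt_eqF. Qed.

Lemma riesz0_le s (x : V) (b : R) : 0 < s -> 0 < b -> b <= `|x| ->
  riesz s x 0 <= (b ^+ n.+1 * b `^ s)^-1.
Proof.
move=> s0 b0 bx; rewrite -powR_dim// /riesz subr0.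
have e0 : 0 < enorm x by apply: lt_le_trans b0 (le_trans bx (le_norm_enorm x)).
rewrite lef_pV2 ?posrE ?powR_gt0//; apply: ge0_ler_powR.
- by rewrite addr_ge0// ltW.
- exact: ltW.
- exact: ltW.
- exact: le_trans bx (le_norm_enorm x).
Qed.

Lemma measurable_riesz0 s : measurable_fun [set: T] (fun x : V => riesz s x 0).
Proof. exact: (measurable_slice1 (0 : T) (measurable_riesz s)). Qed.

Lemma measurable_normV : measurable_fun [set: T] (fun x : V => `|x|).
Proof. by apply: borel_measurable_fun; apply: borel_continuous; exact: norm_continuous. Qed.

Definition cutoff_kernel s (m : R) (x : V) : R := Num.min 1 (`|x| / m) * riesz s x 0.

Lemma borel_cutoff_kernel s m : measurable_fun [set: borelRd] (cutoff_kernel s m : V -> R).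
Proof.
have mn : measurable_fun [set: borelRd] (fun x : V => `|x|).
  by apply: borel_continuous; exact: norm_continuous.
apply: measurable_funM.
  apply: measurable_minr; first exact: measurable_cst.
  by apply: measurable_funM; [exact: mn|exact: measurable_cst].
rewrite (_ : (riesz s)^~ 0 = (fun x : V => enorm (x - 0) `^ (- (n.+1%:R + s)))); last first.
  by apply/funext => x; rewrite /riesz powRN.
apply: (measurableT_comp (measurable_powR _)).
apply: (borel_comp measurable_enorm).
by apply: measurable_coordsB; [exact: measurable_coords_borel|exact: measurable_coords_cst].
Qed.

Lemma measurable_cutoff_kernel s m : measurable_fun [set: T] (cutoff_kernel s m).
Proof. exact: (borel_measurable_fun (borel_cutoff_kernel s m)). Qed.

Lemma cutoff_kernel_ge0 s m x : 0 < m -> 0 <= cutoff_kernel s m x.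
Proof.
move=> m0; rewrite mulr_ge0 ?riesz_ge0// le_min ler01 divr_ge0//; exact: ltW.
Qed.

(** Dyadic shells, treated separately outside and inside the unit ball. At infinity the kernel
    |x|^(-d-s) gives the ratio 2^(-s), which needs s > 0; near 0 the extra factor |x| gives the
    ratio 2^(s-1), which needs s < 1. *)
Lemma cutoff_kernel_fin s : 0 < s < 1 -> (\int[leb]_x (cutoff_kernel s 1 x)%:E < +oo)%E.
Proof.
move=> /andP[s0 s1].
have p1 t : 0 < t -> 1 < 2 `^ t :> R.
  move=> t0; have e1 : 1 = 1 `^ t :> R by rewrite powR1.
  rewrite [ltLHS]e1.
  by apply: gt0_ltr_powR; rewrite ?nnegrE//; lra.
have q1 := p1 s s0.
have q2 : 2 `^ s < 2 :> R.
  rewrite [ltRHS](_ : 2 = 2 `^ s * 2 `^ (1 - s)); last first.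
    rewrite -powRD; last by apply/implyP; rewrite pnatr_eq0.
    by rewrite addrC subrK powRr1.
  by rewrite ltr_pMr ?powR_gt0// p1// subr_gt0.
have q0 : 0 < 2 `^ s :> R by exact: lt_trans q1.
pose f1 (x : V) := \1_(~` cball 1) x * riesz s x 0.
pose f2 (x : V) := \1_(cball 1) x * (`|x| * riesz s x 0).
have mc : measurable (cball 1 : set T) by exact: measurable_cball.
have mf1 : measurable_fun [set: T] f1.
  by apply: measurable_indicM; [exact: measurableC|exact: measurable_riesz0].
have mf2 : measurable_fun [set: T] f2.
  apply: measurable_indicM; first exact: mc.
  by apply: measurable_funM; [exact: measurable_normV|exact: measurable_riesz0].
have f10 x : 0 <= f1 x by rewrite mulr_ge0// riesz_ge0.
have f20 x : 0 <= f2 x by rewrite !mulr_ge0// riesz_ge0.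
have p2 j : 0 < 2 ^+ j :> R by rewrite exprn_gt0.
have I1 : (\int[leb]_x (f1 x)%:E < +oo)%E.
  (* On 2^j <= |x| < 2^(j+1) the lower radius bounds the kernel and the upper one the measure: (4 *
     2^(j+1))^d = 8^d 2^(jd), and 2^(jd) cancels. *)
  apply: (@integral_shells_fin f1 (fun j => 2 ^+ j.+1)
    (fun j => ((2 ^+ j) ^+ n.+1 * (2 ^+ j) `^ s)^-1) (8 ^+ n.+1) (2 `^ s)^-1) => //.
  - move=> x; rewrite /f1 indicE in_setC; case: (boolP (x \in cball 1)) => [|x1].
      by left; rewrite mul0r.
    right; rewrite mul1r.
    have {}x1 : 1 <= `|x|.
      by move: x1; rewrite notin_setE /cball /= => /negP; rewrite -ltNge => /ltW.
    have [j /andP[jx xj]] := dyadic_bracket x1.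
    by exists j; split; [exact: ltW|exact: riesz0_le].
  - by rewrite invr_ge0 (ltW q0)/= invf_lt1.
  - move=> j; rewrite powR_exp2 invfM exprVn le_eqVlt; apply/orP; left; apply/eqP.
    rewrite (_ : 4 * 2 ^+ j.+1 = 8 * 2 ^+ j :> R); last by rewrite exprS; ring.
    rewrite exprMn mulrAC mulrCA mulVf ?mulr1//.
have I2 : (\int[leb]_x (f2 x)%:E < +oo)%E.
  (* Now 2^(-j-1) < |x| <= 2^(-j): the factor |x| is at most 2^(-j), the kernel at most
     2^((j+1)(d+s)). Writing 4 * 2^(-j) = 8 * 2^(-j-1), the powers with exponent [d] cancel and 8^d
     2^s (2^s / 2)^j is left. *)
  apply: (@integral_shells_fin f2 (fun j => (2 ^+ j)^-1)
    (fun j => (2 ^+ j)^-1 * (((2 ^+ j.+1)^-1) ^+ n.+1 * ((2 ^+ j.+1)^-1) `^ s)^-1)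
    (8 ^+ n.+1 * 2 `^ s) (2 `^ s / 2)) => //.
  - move=> x; rewrite /f2 indicE; case: (boolP (x \in cball 1)) => [|_]; last first.
      by left; rewrite mul0r.
    rewrite inE /cball /= => x1; rewrite mul1r.
    have [->|x0] := eqVneq x 0; first by left; rewrite normr0 mul0r.
    right; have nx0 : 0 < `|x| by rewrite normr_gt0.
    have x1' : 1 <= `|x|^-1 by rewrite invf_ge1.
    have [j /andP[jx xj]] := dyadic_bracket x1'; exists j.
    have xj1 : `|x| <= (2 ^+ j)^-1 by rewrite -[leLHS]invrK lef_pV2 ?posrE ?invr_gt0.
    split=> //; apply: ler_pM => //; first exact: riesz_ge0.
    apply: riesz0_le => //.
    by rewrite -[leRHS]invrK lef_pV2 ?posrE ?invr_gt0// ltW.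
  - by rewrite divr_ge0 ?(ltW q0)//= ltr_pdivrMr// mul1r.
  - move=> j; rewrite le_eqVlt; apply/orP; left; apply/eqP.
    have -> : (2 ^+ j.+1)^-1 `^ s = ((2 `^ s) ^+ j.+1)^-1 :> R.
      rewrite -powR_exp2 -powRN -[_^-1]powR_inv1 ?exprn_ge0// -powRrM mulN1r //.
    rewrite invfM invrK exprVn invrK (_ : 4 / 2 ^+ j = 8 / 2 ^+ j.+1 :> R); last first.
      by rewrite exprS; field; rewrite gt_eqF.
    rewrite !exprMn exprVn [(2 `^ s) ^+ j.+1]exprS exprVn.
    field; apply/andP; split; by rewrite ?expf_eq0 ?pnatr_eq0 ?andbF.
have : (\int[leb]_x (f1 x)%:E + \int[leb]_x (f2 x)%:E < +oo)%E by rewrite lte_add_pinfty.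
apply: le_lt_trans; rewrite -leb_integralD; last 4 first.
- by move=> x; rewrite lee_fin.
- by move=> x; rewrite lee_fin.
- exact/measurable_EFinP.
- exact/measurable_EFinP.
apply: le_leb_integral.
- by move=> x; rewrite lee_fin cutoff_kernel_ge0.
- by apply/measurable_EFinP; exact: measurable_cutoff_kernel.
- by apply: emeasurable_funD; exact/measurable_EFinP.
- move=> x; rewrite -EFinD lee_fin /cutoff_kernel /f1 /f2 divr1 !indicE in_setC.
  have K0 := riesz_ge0 s x 0; case: (x \in cball 1) => /=.
    by rewrite mul0r add0r mul1r ler_wpM2r// ge_min lexx orbT.
  by rewrite mul0r addr0 mul1r ler_piMl// ge_min lexx.
Qed.

(** Dominated convergence: the kernel with m = 1 is an integrable majorant, and at a fixed point the
    kernel is at most a constant divided by the cutoff radius. *)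
Lemma cutoff_kernel_cvg s : 0 < s < 1 ->
  (\int[leb]_x (cutoff_kernel s m.+1%:R x)%:E)%E @[m --> \oo] --> 0%E.
Proof.
move=> s01; pose F (m : nat) (x : T) := (cutoff_kernel s m.+1%:R x)%:E.
have mF m : measurable_fun [set: T] (F m).
  by apply/measurable_EFinP; exact: measurable_cutoff_kernel.
have iG : leb.-integrable [set: T] (fun x => (cutoff_kernel s 1 x)%:E).
  apply/integrableP; split; first by apply/measurable_EFinP; exact: measurable_cutoff_kernel.
  under eq_integral => x _ do rewrite gee0_abs ?lee_fin ?cutoff_kernel_ge0//.
  exact: cutoff_kernel_fin.
have FG x m : (`|F m x| <= (cutoff_kernel s 1 x)%:E)%E.
  rewrite gee0_abs ?lee_fin ?cutoff_kernel_ge0// ler_wpM2r ?riesz_ge0//.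
  rewrite le_min ge_min lexx /= ge_min; apply/orP; right.
  by rewrite ler_wpM2l// lef_pV2 ?posrE// ler1n.
have Fcvg x : F m x @[m --> \oo] --> 0%E.
  apply: cvg_EFin; first by near=> m.
  have c0 : `|x| / m.+1%:R * riesz s x 0 @[m --> \oo] --> (`|x| * 0 * riesz s x 0 : R).
    apply: cvgMl; apply: cvgMr; exact: cvg_harmonic.
  rewrite mulr0 mul0r in c0.
  apply: squeeze_cvgr (cvg_cst 0) c0; near=> m => /=; apply/andP; split.
    exact: cutoff_kernel_ge0.
  by rewrite ler_wpM2r ?riesz_ge0// ge_min lexx orbT.
have [_ _] := @dominated_convergence _ T R leb setT measurableT F (fun=> 0%E) _ mF
  (measurable_cst _) (aeW _ (fun x _ => Fcvg x)) iG (aeW _ (fun x m _ => FG x m)).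
by rewrite integral0.
Unshelve. all: by end_near.
Qed.

Definition cutoff (m : R) (x : V) : R := Num.max 0 (Num.min 1 (2 - `|x| / m)).

Lemma cutoff_ge0 m x : 0 <= cutoff m x.
Proof. by rewrite le_max lexx. Qed.

Lemma cutoff_le1 m x : cutoff m x <= 1.
Proof. by rewrite ge_max ler01 ge_min lexx. Qed.

Lemma cutoff1 m x : 0 < m -> `|x| <= m -> cutoff m x = 1.
Proof.
move=> m0 xm; have xm1 : `|x| / m <= 1 by rewrite ler_pdivrMr// mul1r.
rewrite /cutoff; have -> : Num.min 1 (2 - `|x| / m) = 1 by apply/min_idPl; lra.
by apply/max_idPr.
Qed.

Lemma cutoff0 m x : 0 < m -> 2 * m <= `|x| -> cutoff m x = 0.
Proof.
move=> m0 xm; have xm2 : 2 <= `|x| / m by rewrite ler_pdivlMr.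
by apply/max_idPl; rewrite ge_min; apply/orP; right; lra.
Qed.

Lemma clamp_lip (a b : R) :
  `|Num.max 0 (Num.min 1 a) - Num.max 0 (Num.min 1 b)| <= Num.min 1 `|a - b|.
Proof.
have cE (c : R) : Num.max 0 (Num.min 1 c) =
    if c <= 0 then 0 else if c <= 1 then c else 1.
  case: (lerP c 0) => c0.
    by rewrite (min_idPr _) ?max_l//; lra.
  by case: (lerP c 1) => c1; rewrite ?(min_idPr c1) ?(min_idPl (ltW c1)) max_r//; lra.
have h1 := ler_norm (a - b); have h2 := ler_norm (b - a); rewrite (distrC b a) in h2.
rewrite le_min !cE !ler_norml; move: `|a - b| h1 h2 => d h1 h2.
by case: (lerP a 0) => ?; case: (lerP b 0) => ?; case: (lerP a 1) => ?;
  case: (lerP b 1) => ?; apply/andP; split; apply/andP; split; lra.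
Qed.

Lemma cutoff_lip m x y : 0 < m -> `|cutoff m x - cutoff m y| <= Num.min 1 (`|x - y| / m).
Proof.
move=> m0; apply: le_trans (clamp_lip _ _) _.
rewrite le_min ge_min lexx /= ge_min; apply/orP; right.
rewrite opprB addrC addrA subrK -mulrBl normrM (gtr0_norm (_ : 0 < m^-1)) ?invr_gt0//.
rewrite ler_wpM2r ?invr_ge0 ?(ltW m0)// distrC; exact: ler_dist_dist.
Qed.

Lemma borel_cutoff m : measurable_fun [set: borelRd] (cutoff m : V -> R).
Proof.
have mn : measurable_fun [set: borelRd] (fun x : V => `|x|).
  by apply: borel_continuous; exact: norm_continuous.
apply: measurable_maxr; first exact: measurable_cst.
apply: measurable_minr; first exact: measurable_cst.
apply: measurable_funB; first exact: measurable_cst.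
by apply: measurable_funM; [exact: mn|exact: measurable_cst].
Qed.

(** The increment of the product splits as cutoff times increment of [u] plus [u y] times increment
    of the cutoff. The first part is bounded by the energy of [u]. For the second, the Lipschitz
    bound and translation invariance make the integral over [x] equal to [J * |u y|]. *)
Lemma pair_energy_cutoff_le s m u : 0 < m -> measurable_fun [set: T] u ->
  (pair_energy (riesz s) (fun x => cutoff m x * u x)%R <=
   pair_energy (riesz s) u +
   (\int[leb]_x (cutoff_kernel s m x)%:E) * \int[leb]_x `|u x|%:E)%E.
Proof.
move=> m0 mu; set J := (\int[leb]_x (cutoff_kernel s m x)%:E)%E.
have r0 (x y : V) : 0 <= riesz s x y by exact: riesz_ge0.
have mr : measurable2 (riesz s : V -> V -> R) by exact: measurable_riesz.
have mcu : measurable_fun [set: T] (fun x : V => cutoff m x * u x).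
  by apply: measurable_funM; [exact: (borel_measurable_fun (borel_cutoff m))|exact: mu].
have mh := measurable_pair_energy_integrand mr mcu.
have mh' := measurable_pair_energy_integrand mr mu.
have mnu : measurable_fun [set: T] (fun x => `|u x|%:E).
  by apply/measurable_EFinP; exact: measurable_norm.
pose q (x y : V) : \bar R := (`|u y| * cutoff_kernel s m (x - y))%:E.
have q0 x y : (0 <= q x y)%E by rewrite lee_fin mulr_ge0// cutoff_kernel_ge0.
have mq : measurable_fun [set: T * T] (fun p => q p.1 p.2).
  apply/measurable_EFinP; apply: measurable_funM.
    exact: (measurableT_comp (measurable_norm mu) measurable_snd).
  apply: (borel_comp (borel_cutoff_kernel s m)).
  by apply: measurable_coordsB; apply: measurable_coordsP; [exact: measurable_fst|exact: measurable_snd].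
have mck : measurable_fun [set: T] (fun x => (cutoff_kernel s m x)%:E).
  by apply/measurable_EFinP; exact: measurable_cutoff_kernel.
have ck0 x : (0 <= (cutoff_kernel s m x)%:E)%E by rewrite lee_fin cutoff_kernel_ge0.
have J0 : (0 <= J)%E by exact: integral_ge0.
have qE y : (\int[leb]_x q x y = J * `|u y|%:E)%E.
  rewrite muleC /J -(ge0_integral_shift (- y) mck ck0) -leb_integralZl.
  - by [].
  - by rewrite lee_fin.
  - by move=> x; exact: ck0.
  - exact: (measurableT_comp mck (measurable_shift (- y))).
have -> : (J * \int[leb]_x `|u x|%:E = \int[leb]_y \int[leb]_x q x y)%E.
  rewrite -leb_integralZl//.
  by apply: eq_integral => y _; rewrite qE.
rewrite /pair_energy -leb_integralD; last 4 first.
- by move=> y; apply: integral_ge0 => x _; rewrite lee_fin mulr_ge0.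
- by move=> y; exact: integral_ge0.
- apply: (@measurable_integral1 _ _ _ T) => [x y|]; last exact: mh'.
  by rewrite lee_fin mulr_ge0.
- by apply: (@measurable_integral1 _ _ _ T) => [x y|]; [exact: q0|exact: mq].
apply: le_leb_integral.
- by move=> y; apply: integral_ge0 => x _; rewrite lee_fin mulr_ge0.
- apply: (@measurable_integral1 _ _ _ T) => [x y|]; last exact: mh.
  by rewrite lee_fin mulr_ge0.
- apply: emeasurable_funD.
    apply: (@measurable_integral1 _ _ _ T) => [x y|]; last exact: mh'.
    by rewrite lee_fin mulr_ge0.
  by apply: (@measurable_integral1 _ _ _ T) => [x y|]; [exact: q0|exact: mq].
move=> y; rewrite -leb_integralD; last 4 first.
- by move=> x; rewrite lee_fin mulr_ge0.
- by move=> x; exact: q0.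
- exact: (measurable_slice1 (y : T) mh').
- exact: (measurable_slice1 (y : T) mq).
apply: le_leb_integral.
- by move=> x; rewrite lee_fin mulr_ge0.
- exact: (measurable_slice1 (y : T) mh).
- apply: emeasurable_funD; first exact: (measurable_slice1 (y : T) mh').
  exact: (measurable_slice1 (y : T) mq).
move=> x; rewrite -EFinD lee_fin /cutoff_kernel.
have -> : riesz s (x - y) 0 = riesz s x y by rewrite /riesz subr0.
rewrite mulrA (mulrC _ (riesz s x y)) -mulrDr; apply: ler_wpM2l => //.
rewrite (_ : cutoff m x * u x - cutoff m y * u y =
  cutoff m x * (u x - u y) + u y * (cutoff m x - cutoff m y)); last by ring.
apply: le_trans (ler_normD _ _) _; rewrite !normrM; apply: lerD.
  by rewrite ler_piMl// ger0_norm ?cutoff_ge0// cutoff_le1.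
by rewrite ler_wpM2l//; exact: cutoff_lip.
Qed.

Lemma cutoff_L1_cvg u : leb.-integrable [set: T] (EFin \o u) ->
  (\int[leb]_x `|cutoff m.+1%:R x * u x - u x|%:E)%E @[m --> \oo] --> 0%E.
Proof.
move=> ui; have mu : measurable_fun [set: T] u.
  by apply/measurable_EFinP; exact: measurable_int ui.
pose F (m : nat) (x : T) := (cutoff m.+1%:R x * u x)%:E.
have mF m : measurable_fun [set: T] (F m).
  apply/measurable_EFinP; apply: measurable_funM; last exact: mu.
  exact: (borel_measurable_fun (borel_cutoff _)).
have FG x m : (`|F m x| <= `|(u x)%:E|)%E.
  by rewrite lee_fin normrM ler_piMl// ger0_norm ?cutoff_ge0// cutoff_le1.
have iG : leb.-integrable [set: T] (fun x => `|(u x)%:E|)%E by exact: integrable_abse.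
have Fcvg x : F m x @[m --> \oo] --> (u x)%:E.
  apply: cvg_near_cst; near=> m; rewrite /F cutoff1 ?mul1r//.
  apply: (@le_trans _ _ (Num.bound `|x|)%:R); first exact/ltW/archi_boundP.
  by rewrite ler_nat; apply: leqW; near: m; exact: nbhs_infty_ge.
have [_ + _] := @dominated_convergence _ T R leb setT measurableT F (EFin \o u) _ mF
  ((measurable_EFinP _ _).2 mu) (aeW _ (fun x _ => Fcvg x)) iG (aeW _ (fun x m _ => FG x m)).
by [].
Unshelve. all: by end_near.
Qed.

End cutoff.

(** * Smooth mollifiers *)

Section smooth.
Context {R : realType} {n : nat}.
Local Notation V := 'rV[R]_n.+1.
Local Notation T := (Rd R n).
Local Notation borelRd := (@borelRd R n).
Implicit Types (u v f g phi : V -> R).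

Lemma class_C_continuous k f : class_C k f -> continuous f.
Proof. by case: k => [|k] []. Qed.

Lemma class_CW k f : class_C k.+1 f -> class_C k f.
Proof.
elim: k f => [|k IH] f [cf df]; first by split.
by split=> // i; have [dfi Cfi] := df i; split=> //; exact: IH.
Qed.

Lemma class_CS k f (df : 'I_n.+1 -> V -> R) : continuous f ->
  (forall i x, is_derive x (delta_mx ord0 i : V) f (df i x)) ->
  (forall i, class_C k (df i)) -> class_C k.+1 f.
Proof.
move=> cf fdf Cdf; split=> // i; split=> [x|]; first by have [] := fdf i x.
rewrite (_ : (fun x => _) = df i)//; apply/funext => x.
by have [_] := fdf i x.
Qed.

Lemma class_C_derive k f i x : class_C k.+1 f ->
  is_derive x (delta_mx ord0 i : V) f ('D_(delta_mx ord0 i) f x).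
Proof. by move=> [_ /(_ i)[+ _]] => /(_ x)/derivableP. Qed.

Lemma class_C_cst k (a : R) : class_C k (fun _ : V => a).
Proof.
elim: k a => [|k IH] a; first by split=> //; exact: cst_continuous.
have d0 (i : 'I_n.+1) x : is_derive x (delta_mx ord0 i : V) (fun=> a) 0 by exact: is_derive_cst.
by apply: (class_CS _ d0) => [|i]; [exact: cst_continuous|exact: IH].
Qed.

Lemma continuous_add f g : continuous f -> continuous g -> continuous (fun x => f x + g x).
Proof. by move=> cf cg x; exact: (continuousD (cf x) (cg x)). Qed.

Lemma class_CD k f g : class_C k f -> class_C k g -> class_C k (fun x => f x + g x).
Proof.
elim: k f g => [|k IH] f g Cf Cg.
  by split=> //; apply: continuous_add; [exact: Cf.1|exact: Cg.1].
apply: (@class_CS _ _ (fun i x => 'D_(delta_mx ord0 i) f x + 'D_(delta_mx ord0 i) g x)).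
- by apply: continuous_add; [exact: Cf.1|exact: Cg.1].
- by move=> i x; exact: (is_deriveD (class_C_derive i x Cf) (class_C_derive i x Cg)).
- by move=> i; apply: IH; [exact: (Cf.2 i).2|exact: (Cg.2 i).2].
Qed.

Lemma continuous_mul f g : continuous f -> continuous g -> continuous (fun x => f x * g x).
Proof. by move=> cf cg x; exact: (continuousM (cf x) (cg x)). Qed.

Lemma class_CM k f g : class_C k f -> class_C k g -> class_C k (fun x => f x * g x).
Proof.
elim: k f g => [|k IH] f g Cf Cg.
  by split=> //; apply: continuous_mul; [exact: Cf.1|exact: Cg.1].
apply: (@class_CS _ _ (fun i x => f x * 'D_(delta_mx ord0 i) g x +
                                  g x * 'D_(delta_mx ord0 i) f x)).
- by apply: continuous_mul; [exact: Cf.1|exact: Cg.1].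
- by move=> i x; exact: (is_deriveM (class_C_derive i x Cf) (class_C_derive i x Cg)).
- move=> i; apply: class_CD; apply: IH.
  + exact: class_CW.
  + exact: (Cg.2 i).2.
  + exact: class_CW.
  + exact: (Cf.2 i).2.
Qed.

Lemma class_C_prod k (I : Type) (r : seq I) (F : I -> V -> R) :
  (forall i, class_C k (F i)) -> class_C k (fun x => \prod_(i <- r) F i x).
Proof.
move=> CF; elim: r => [|i r IH].
  by under eq_fun do rewrite big_nil; exact: class_C_cst.
by under eq_fun do rewrite big_cons; exact: class_CM.
Qed.

(* The family t^-k exp(-1/t), extended by 0 to t <= 0, is closed under differentiation up to
   linear combinations, which makes its members smooth. *)
Definition flat_exp (k : nat) (t : R) : R :=
  if t <= 0 then 0 else t^-1 ^+ k * expR (- t^-1).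

(** With y = 1/t the bound reads y^(k+2) exp(-y) <= (k+2)^(k+2), which is y/(k+2) <= exp(y/(k+2))
    raised to the power k+2. The square of [t] is there to control the difference quotient at 0. *)
Lemma flat_exp_bound k : exists C : R, forall t, `|flat_exp k t| <= C * t ^+ 2.
Proof.
exists (k.+2%:R ^+ k.+2) => t; rewrite /flat_exp; case: (lerP t 0) => t0.
  by rewrite normr0; apply: mulr_ge0; [exact: exprn_ge0|exact: sqr_ge0].
have y0 : 0 < t^-1 by rewrite invr_gt0.
rewrite ger0_norm ?mulr_ge0 ?exprn_ge0 ?expR_ge0 ?(ltW y0)//.
rewrite -ler_pdivrMr ?exprn_gt0// -exprVn mulrAC -exprD addn2.
rewrite expRN ler_pdivrMr ?expR_gt0//.
have /(_ t^-1) h : forall y : R, 0 < y -> y ^+ k.+2 <= k.+2%:R ^+ k.+2 * expR y.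
  move=> y yp; have -> : y = k.+2%:R * (y / k.+2%:R) by rewrite mulrC divfK.
  rewrite expRM_natl -exprMn lerXn2r ?nnegrE ?mulr_ge0 ?expR_ge0 ?divr_ge0 ?(ltW yp)//.
  by rewrite ler_wpM2l// (le_trans _ (expR_ge1Dx _))// lerDr.
exact: h.
Qed.

(** Away from 0 these are the usual rules. At 0 the difference quotient is at most [C * |h|] by
    [flat_exp_bound], so the derivative is 0, which is also the value of the formula there. *)
Lemma is_derive_flat_exp k (t : R) :
  is_derive t 1 (flat_exp k) (flat_exp k.+2 t - k%:R * flat_exp k.+1 t).
Proof.
have [t0|t0|->] := ltgtP t 0.
- apply: (@near_eq_is_derive _ _ _ (cst 0)).
    by near=> x; rewrite /flat_exp ifT//; apply: ltW; near: x; exact: lt_nbhsl.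
  by rewrite /flat_exp !ifT ?ltW// mulr0 subr0; exact: is_derive_cst.
- apply: (@near_eq_is_derive R R R (fun x : R => x^-1 ^+ k * expR (- x^-1))).
    by near=> x; rewrite /flat_exp ifF//; apply/negbTE; rewrite -ltNge; near: x; exact: lt_nbhsr.
  have dV : is_derive t 1 (fun x : R => x^-1) (- t ^- 2 *: 1).
    by apply: (is_deriveV (lt0r_neq0 t0)); exact: is_derive_id.
  have dE := @is_derive1_comp R expR (fun x => - x^-1) t _ _ (is_derive_expR _) (is_deriveN dV).
  have dX := is_deriveX k dV.
  have eX : (fun x : R => x^-1) ^+ k = (fun x : R => x^-1 ^+ k).
    by apply/funext => x; rewrite exprfctE.
  rewrite eX in dX; apply: (is_derive_eq (is_deriveM dX dE)).
  rewrite /flat_exp !ifF; [|by apply/negbTE; rewrite -ltNge..].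
  rewrite -exprVn -[_ *: 1]/(_ * 1) mulr1 opprK -![_ *: _]/(_ * _).
  case: k {dX eX} => [|k]; rewrite /= !exprS.
    by ring.
  by ring.
- have [C HC] := flat_exp_bound k.
  suff h : (fun h : R => h^-1 *: ((flat_exp k \o shift 0) (h *: 1) - flat_exp k 0)) @ 0^' --> (0 : R).
    rewrite (_ : flat_exp k.+2 0 - _ = 0); last by rewrite /flat_exp lexx mulr0 subr0.
    by apply: DeriveDef; [apply/cvg_ex; exists 0|apply: cvg_lim => //; exact: h].
  apply/norm_cvg0P; apply: (@squeeze_cvgr _ _ _ _ (cst 0) (fun h : R => C * `|h|)).
  + near=> h; have h0 : h != 0 by near: h; exact: nbhs_dnbhs_neq.
    rewrite normr_ge0/= [_ *: 1]mulr1 addr0 {2}/flat_exp lexx subr0 -[_ *: _]/(_ * _) normrM normfV.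
    rewrite mulrC ler_pdivrMr ?normr_gt0// -mulrA -expr2 real_normK ?num_real//.
  + exact: cvg_cst.
  + suff : C * `|h| @[h --> (0 : R)^'] --> C * `|0 : R| by rewrite normr0 mulr0; apply.
    by apply: cvgM; [exact: cvg_cst|apply: cvg_norm; exact: nbhs_dnbhs].
Unshelve. all: by end_near.
Qed.

Lemma continuous_flat_exp k : continuous (flat_exp k).
Proof.
move=> t; apply/differentiable_continuous/derivable1_diffP.
by have [] := is_derive_flat_exp k t.
Qed.

(** Directional derivatives are read as ordinary derivatives along a line, which gives access to the
    one-variable chain rule and mean value theorem. *)
Lemma derive_line (W : normedModType R) (f : W -> R) (x v : W) : 'D_1 (fun h : R => f (h *: v + x)) 0 = 'D_v f x.
Proof.
rewrite /derive (_ : (fun h : R => h^-1 *: (_ - f (0 *: v + x))) =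
  (fun h => h^-1 *: ((f \o shift x) (h *: v) - f x)))//.
by apply/funext => h /=; rewrite addr0 scale0r add0r [_%:A]mulr1.
Qed.

Lemma is_derive_line (W : normedModType R) (f : W -> R) (x v : W) (d : R) :
  is_derive (0 : R) 1 (fun h : R => f (h *: v + x)) d -> is_derive x v f d.
Proof. by move=> [fd]; rewrite derive_line => <-; apply: DeriveDef => //; exact/derivable1P. Qed.

Lemma line_is_derive (W : normedModType R) (f : W -> R) (x v : W) (d : R) :
  is_derive x v f d -> is_derive (0 : R) 1 (fun h : R => f (h *: v + x)) d.
Proof.
by move=> [fd <-]; apply: DeriveDef; [exact: (derivable1P _ _ _).1|exact: derive_line].
Qed.

Lemma is_derive_affine (a c t : R) : is_derive t 1 (fun h : R => a + h * c) c.
Proof.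
have h := is_deriveD (@is_derive_cst R R R a t 1)
  (is_deriveM (@is_derive_id R R t 1) (@is_derive_cst R R R c t 1)).
by apply: (is_derive_eq h); rewrite scaler0 !add0r [_ *: _]mulr1.
Qed.

(** The induction on [m] keeps [k] free, because differentiating leads to the members k+1 and k+2 of
    the family. *)
Lemma class_C_flat_exp m k (a c : R) (i : 'I_n.+1) :
  class_C m (fun x : V => flat_exp k (a + c * x ord0 i)).
Proof.
have cont k' : continuous (fun x : V => flat_exp k' (a + c * x ord0 i)).
  move=> x; apply: (@continuous_comp V R R (fun x : V => a + c * x ord0 i)); last first.
    exact: continuous_flat_exp.
  have cc : continuous (fun x : V => x ord0 i) by exact: coord_continuous.
  exact: (continuous_add (@cst_continuous _ _ a) (continuous_mul (@cst_continuous _ _ c) cc)).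
elim: m k => [|m IH] k; first by split.
have der (j : 'I_n.+1) (x : V) :
    is_derive x (delta_mx ord0 j : V) (fun x : V => flat_exp k (a + c * x ord0 i))
      ((c * (j == i)%:R) * flat_exp k.+2 (a + c * x ord0 i) +
       (- (c * (j == i)%:R * k%:R)) * flat_exp k.+1 (a + c * x ord0 i)).
  apply: is_derive_line.
  rewrite (_ : (fun h => _) = flat_exp k \o (fun h => (a + c * x ord0 i) + h * (c * (j == i)%:R))).
    have h0 := is_derive_affine (a + c * x ord0 i) (c * (j == i)%:R) 0.
    apply: (is_derive_eq (is_derive1_comp (is_derive_flat_exp k _) h0)).
    by rewrite mul0r addr0; ring.
  by apply/funext => h /=; rewrite !mxE eqxx /= eq_sym; congr flat_exp; ring.
apply: (class_CS (cont k) der) => j.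
by apply: class_CD; (apply: class_CM; first exact: class_C_cst); exact: IH.
Qed.

(** The sup norm is not smooth, so a product over coordinates is used; it is positive exactly when
    -r < x_i < r for all [i]. The factors are written as a + c x_i to match [class_C_flat_exp]. *)
Definition bump (r : R) (x : V) : R :=
  \prod_(i < n.+1) (flat_exp 0 (r + (- 1) * x ord0 i) * flat_exp 0 (r + 1 * x ord0 i)).

Lemma flat_exp_gt0 k t : 0 < t -> 0 < flat_exp k t.
Proof.
move=> t0; rewrite /flat_exp leNgt t0 /=.
by rewrite mulr_gt0 ?exprn_gt0 ?invr_gt0 ?expR_gt0.
Qed.

Lemma flat_exp_eq0 k t : t <= 0 -> flat_exp k t = 0.
Proof. by rewrite /flat_exp => ->. Qed.

Lemma flat_exp_ge0 k t : 0 <= flat_exp k t.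
Proof. by have [/flat_exp_eq0->|/(flat_exp_gt0 k)/ltW] := leP t 0. Qed.

Lemma class_C_bump m r : class_C m (bump r).
Proof. by apply: class_C_prod => i; apply: class_CM; exact: class_C_flat_exp. Qed.

Lemma bump_ge0 r x : 0 <= bump r x.
Proof. by apply: prodr_ge0 => i _; rewrite mulr_ge0 ?flat_exp_ge0. Qed.

Lemma bump_even r x : bump r (- x) = bump r x.
Proof. by apply: eq_bigr => i _; rewrite !mxE mulN1r opprK mul1r mulN1r mul1r mulrC. Qed.

Lemma bump_supp r x : 0 < r -> r <= `|x| -> bump r x = 0.
Proof.
move=> r0 rx; apply/eqP; apply: contraTT rx => bx; rewrite -ltNge.
apply: norm_rV_lt => // i.
have : flat_exp 0 (r + (- 1) * x ord0 i) * flat_exp 0 (r + 1 * x ord0 i) != 0.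
  by move: bx; rewrite /bump (bigD1 i)//= mulf_eq0 negb_or => /andP[].
rewrite mulf_eq0 negb_or => /andP[h1 h2]; rewrite ltr_norml.
have p k t : flat_exp k t != 0 -> 0 < t.
  by apply: contraNT; rewrite -leNgt => /flat_exp_eq0 ->.
by have := p _ _ h1; have := p _ _ h2; lra.
Qed.

Lemma bump_gt0 r x : `|x| < r -> 0 < bump r x.
Proof.
move=> xr; apply: prodr_gt0 => i _.
have := le_lt_trans (coord_le_norm x i) xr; rewrite ltr_norml => /andP[? ?].
by rewrite mulr_gt0// flat_exp_gt0//; lra.
Qed.

Lemma fsupport_cball f r : (forall x, r < `|x| -> f x = 0) -> fsupport f `<=` cball r.
Proof.
move=> f0; rewrite /fsupport [X in _ `<=` X](closure_id _).1; last exact: closed_cball.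
apply: closure_subset => x /=; apply: contraNP => /negP; rewrite -ltNge => /f0 ->.
by rewrite eqxx.
Qed.

Lemma test_functionP f r : (forall k, class_C k f) -> (forall x, r < `|x| -> f x = 0) ->
  test_function f.
Proof.
move=> Cf f0; split=> //; apply: subclosed_compact (fsupport_cball f0).
  exact: closed_closure.
exact: compact_cball.
Qed.

Lemma uniformly_continuous_supp f (M e : R) : continuous f -> (forall x, M < `|x| -> f x = 0) -> 0 < e ->
  exists2 d : R, 0 < d & forall x z, `|z| < d -> `|f (x + z) - f x| <= e.
Proof.
move=> cf f0 e0.
have : nbhs (0 : V) (fun z => cball (M + 1) `<=` (fun x => `|f (x + z) - f x| <= e)).
  pose P (z x : V) : Prop := `|f (x + z) - f x| <= e.
  have := (compact_near_coveringP _).1 (@compact_cball R n (M + 1)) V (nbhs (0 : V)) P.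
  apply => x _.
  have e20 : 0 < e / 2 by rewrite divr_gt0.
  have cx : \forall y \near x, `|f y - f x| < e / 2.
    exact: ((@cvgrPdistC_lt R R^o V (nbhs x) _ f (f x)).1 (cf x) _ e20).
  have cx0 : \forall y \near x + 0, `|f y - f x| < e / 2 by rewrite addr0.
  have c1 := @add_continuous V (x, 0) _ cx0.
  have [[A B]/= [Ax B0] AB] := c1.
  exists (A `&` [set y | `|f y - f x| < e / 2], B); first by split=> //; exact: filterI.
  move=> [y z] /= [[Ay fy] Bz].
  have := AB (y, z) (conj Ay Bz) => /= h.
  have := ler_distD (f x) (f (y + z)) (f y); rewrite (distrC (f x)) => /le_trans; apply.
  by rewrite (splitr e) lerD// ltW.
move=> /nbhs_ballP[d /= d0 Hd].
exists (Num.min d 1) => [|x z]; first by rewrite lt_min d0 ltr01.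
rewrite lt_min => /andP[zd z1].
(* Compactness handles the ball of radius [M + 1]; beyond it a shift of norm below 1 leaves both
   points outside the support. *)
have [xM|xM] := leP `|x| (M + 1).
  by apply: (Hd z); [rewrite -ball_normE /= sub0r normrN|].
rewrite !f0 ?subrr ?normr0 ?(ltW e0)//; first by apply: lt_trans xM; rewrite ltrDl.
have := ler_normB (x + z) z; rewrite addrK => h; lra.
Qed.

Lemma cont_supp_bounded f (M : R) : continuous f -> (forall x, M < `|x| -> f x = 0) ->
  exists2 B : R, 0 <= B & forall x, `|f x| <= B.
Proof.
move=> cf f0.
have /compact_bounded[B [_ HB]] : compact (f @` cball M).
  by apply: continuous_compact; [exact: continuous_subspaceT|exact: compact_cball].
exists (Num.max (B + 1) 0) => [|x]; first by rewrite le_max lexx orbT.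
rewrite le_max; have [xM|/f0->] := leP `|x| M; last by rewrite normr0 lexx orbT.
by apply/orP; left; apply: HB; [rewrite ltrDl|exists x].
Qed.

Lemma integrableM_bounded f g (B : R) : leb.-integrable [set: T] (EFin \o f) ->
  measurable_fun [set: T] g -> 0 <= B -> (forall x, `|g x| <= B) ->
  leb.-integrable [set: T] (EFin \o (fun y => f y * g y)).
Proof.
move=> fi mg B0 gB.
have mf : measurable_fun [set: T] f by apply/measurable_EFinP; exact: measurable_int fi.
have Bi : leb.-integrable [set: T] (EFin \o (fun x => B * f x)).
  by rewrite (_ : _ \o _ = (fun x => B%:E * (f x)%:E)%E)//; exact: integrableZl.
apply: (le_integrable measurableT _ _ Bi).
  by apply/measurable_EFinP; apply: measurable_funM; [exact: mf|exact: mg].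
move=> x _; rewrite /= lee_fin !normrM mulrC ler_wpM2r// (le_trans (gB x))//.
exact: ler_norm.
Qed.

Lemma Rintegral_weight_le f g (B : R) : leb.-integrable [set: T] (EFin \o f) ->
  measurable_fun [set: T] g -> 0 <= B -> (forall x, `|g x| <= B) ->
  `|\int[leb]_y (f y * g y)| <= B * \int[leb]_y `|f y|.
Proof.
move=> fi mg B0 gB; have fgi := integrableM_bounded fi mg B0 gB.
apply: le_trans (le_normr_Rintegral measurableT fgi) _.
have nfi : leb.-integrable [set: T] (EFin \o (fun y => `|f y|)) by exact: integrable_norm.
rewrite -RintegralZl//; apply: le_Rintegral => //.
- exact: (integrable_norm fgi).
- rewrite (_ : _ \o _ = (fun x => B%:E * (`|f x|)%:E)%E)//; exact: integrableZl.
- by move=> x _; rewrite normrM mulrC ler_wpM2r.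
Qed.

Lemma measurable_reflect g x : continuous g -> measurable_fun [set: T] (fun y : T => g (x - y)).
Proof.
move=> /borel_continuous bg; apply: (borel_comp bg).
by apply: measurable_coordsB; [exact: measurable_coords_cst|exact: measurable_coord].
Qed.

(** * Smoothness of convolutions with an integrable function *)

Section convol_smooth.
Context (f : V -> R) (M : R) (fi : leb.-integrable [set: T] (EFin \o f)).

Let L := \int[leb]_y `|f y|.

Let L0 : 0 <= L. Proof. exact: Rintegral_ge0. Qed.

Lemma convol_dist_le phi x z (e : R) : continuous phi -> (forall x, M < `|x| -> phi x = 0) ->
  0 <= e -> (forall x, `|phi (x + z) - phi x| <= e) ->
  `|convol phi f (x + z) - convol phi f x| <= e * L.
Proof.
move=> cphi phi0 e0 h; have [B B0 phiB] := cont_supp_bounded cphi phi0.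
have m1 y := measurable_reflect y cphi.
have i1 y := integrableM_bounded fi (m1 y) B0 (fun=> phiB _).
rewrite /convol -RintegralB//.
rewrite (_ : (fun y => _ - _) = (fun y => f y * (phi (x + z - y) - phi (x - y)))); last first.
  by apply/funext => y; rewrite mulrBr.
apply: Rintegral_weight_le.
- exact: fi.
- by apply: measurable_funB; [exact: m1|exact: m1].
- exact: e0.
- by move=> y; rewrite addrAC; exact: h.
Qed.

Lemma continuous_convol phi : continuous phi -> (forall x, M < `|x| -> phi x = 0) ->
  continuous (convol phi f).
Proof.
move=> cphi phi0 x.
apply/(@cvgrPdist_le R R^o V (nbhs x) _ (convol phi f) (convol phi f x)) => e e0.
have L1 : 0 < L + 1 by rewrite ltr_wpDl.
have e10 : 0 < e / (L + 1) by rewrite divr_gt0.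
have [d d0 Hd] := uniformly_continuous_supp cphi phi0 e10.
apply/nbhs_ballP; exists d => //= y; rewrite -ball_normE /= distrC => xy.
have := convol_dist_le x cphi phi0 (ltW e10) (fun x' => Hd x' (y - x) xy).
rewrite (addrC x) subrK distrC => /le_trans; apply.
rewrite mulrAC ler_pdivrMr// ler_wpM2l ?(ltW e0)//; by rewrite lerDl.
Qed.

(** The derivative falls on [phi]. By the mean value theorem its difference quotient is [dphi] at a
    nearby point, hence uniformly close to [dphi]; integrating against [f] costs the factor [L].
    Division by [L + 1] covers the case L = 0. *)
Lemma is_derive_convol phi (dphi : V -> R) (v x : V) :
  continuous phi -> (forall x, M < `|x| -> phi x = 0) ->
  continuous dphi -> (forall x, M < `|x| -> dphi x = 0) ->
  (forall x, is_derive x v phi (dphi x)) ->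
  is_derive x v (convol phi f) (convol dphi f x).
Proof.
move=> cphi phi0 cdphi dphi0 dphiE.
have [B B0 phiB] := cont_supp_bounded cphi phi0.
have [B' B'0 dphiB] := cont_supp_bounded cdphi dphi0.
have m1 y := measurable_reflect y cphi.
have i1 y := integrableM_bounded fi (m1 y) B0 (fun=> phiB _).
have m2 y := measurable_reflect y cdphi.
have i2 y := integrableM_bounded fi (m2 y) B'0 (fun=> dphiB _).
suff H : (fun h : R => h^-1 *: ((convol phi f \o shift x) (h *: v) - convol phi f x)) @ 0^'
    --> (convol dphi f x : R).
  by apply: DeriveDef; [apply/cvg_ex; exists (convol dphi f x)|apply: cvg_lim => //; exact: H].
apply/cvgrPdist_le => e e0.
have L1 : 0 < L + 1 by rewrite ltr_wpDl.
have e10 : 0 < e / (L + 1) by rewrite divr_gt0.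
have [d d0 Hd] := uniformly_continuous_supp cdphi dphi0 e10.
have v1 : 0 < `|v| + 1 by rewrite ltr_wpDl.
near=> h.
have h0 : h != 0 by near: h; exact: nbhs_dnbhs_neq.
have hd : `|h| < d / (`|v| + 1).
  near: h; apply: nbhs_dnbhs; apply/nbhs_ballP; exists (d / (`|v| + 1)) => /=.
    by rewrite divr_gt0.
  by move=> h; rewrite -ball_normE /= sub0r normrN.
have mvt y : `|h^-1 * (phi (y + h *: v) - phi y) - dphi y| <= e / (L + 1).
  have der (t : R) : is_derive t (1 : R) (fun t => phi (t *: v + y)) (dphi (t *: v + y)).
    apply: is_derive_line.
    rewrite (_ : (fun h => _) = (fun h : R => phi (h *: v + (t *: v + y)))); last first.
      by apply/funext => k; rewrite [k *: 1]mulr1 scalerDl addrA.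
    exact: line_is_derive.
  have ct : continuous (fun t : R => phi (t *: v + y)).
    move=> t; apply/differentiable_continuous/derivable1_diffP.
    by have [] := der t.
  (* The intermediate point lies between 0 and [h]; the sign of [h] decides the orientation of the
     interval. *)
  have [c cin cE] : exists2 c : R, `|c| <= `|h| & phi (h *: v + y) - phi y = dphi (c *: v + y) * h.
    have [hn|hp|] := ltgtP h 0; last by move=> hE; rewrite hE eqxx in h0.
      have [c] := MVT hn (fun t _ => der t) (continuous_subspaceT ct).
      rewrite in_itv /= => /andP[c1 c2]; rewrite scale0r add0r sub0r => cE.
      exists c; first by rewrite !ler0_norm ?(ltW hn) ?(ltW c2)// lerN2 ltW.
      by rewrite -[LHS]opprB cE mulrN opprK.
    have [c] := MVT hp (fun t _ => der t) (continuous_subspaceT ct).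
    rewrite in_itv /= => /andP[c1 c2]; rewrite scale0r add0r subr0 => cE.
    by exists c => //; rewrite !ger0_norm ?(ltW hp) ?(ltW c1)// ltW.
  rewrite (addrC y) cE mulrCA mulVf// mulr1 (addrC (c *: v)); apply: Hd.
  rewrite normrZ; apply: (@le_lt_trans _ _ (`|h| * (`|v| + 1))).
    by apply: ler_pM => //; rewrite lerDl.
  by rewrite -ltr_pdivlMr.
rewrite -[h^-1 *: _]/(h^-1 * _) /= (addrC _ x) distrC /convol.
rewrite -RintegralB//.
have i3 : leb.-integrable [set: T] (EFin \o (fun y => f y * phi (x + h *: v - y) - f y * phi (x - y))).
  exact: (integrableB measurableT (i1 (x + h *: v)) (i1 x)).
rewrite -RintegralZl// -RintegralB//; last exact: (integrableZl measurableT h^-1 i3).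
rewrite (_ : (fun y => _ - _) = (fun y => f y * (h^-1 * (phi (x - y + h *: v) - phi (x - y)) - dphi (x - y)))); last first.
  by apply/funext => y; rewrite -mulrBr (addrAC x); ring.
apply: (@le_trans _ _ (e / (L + 1) * L)).
  apply: Rintegral_weight_le; [exact: fi| |exact: ltW|by move=> y; exact: mvt].
  apply: measurable_funB; last exact: m2.
  apply: measurable_funM; first exact: measurable_cst.
  apply: measurable_funB; last exact: m1.
  rewrite (_ : (fun y => _) = (fun y => phi (x + h *: v - y))); first exact: m1.
  by apply/funext => y; rewrite addrAC.
rewrite mulrAC ler_pdivrMr// ler_wpM2l ?(ltW e0)//; by rewrite lerDl.
Unshelve. all: by end_near.
Qed.

Lemma derive_supp phi (v x : V) : (forall x, M < `|x| -> phi x = 0) -> M < `|x| ->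
  'D_v phi x = 0.
Proof.
move=> phi0 xM; rewrite -(@derive_cst R V R 0 x v); apply: near_eq_derive.
have : \forall y \near x, M < `|y|.
  by apply: (cvgr_gt _ (@norm_continuous _ V x)).
by apply: filterS => y /phi0.
Qed.

(** The induction ranges over all [phi] at once: a partial derivative of [phi] vanishes off the same
    ball and takes its place. *)
Lemma class_C_convol k phi : class_C k phi -> (forall x, M < `|x| -> phi x = 0) ->
  class_C k (convol phi f).
Proof.
elim: k phi => [|k IH] phi Cphi phi0.
  by split=> //; apply: continuous_convol => //; exact: Cphi.1.
have cphi := class_C_continuous Cphi.
have dphi0 i x : M < `|x| -> 'D_(delta_mx ord0 i) phi x = 0 by exact: derive_supp.
apply: (@class_CS _ _ (fun i => convol ('D_(delta_mx ord0 i) phi) f)).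
- exact: continuous_convol.
- move=> i x; apply: is_derive_convol => //.
  + exact: (class_C_continuous (Cphi.2 i).2).
  + exact: dphi0.
  + by move=> y; exact: (class_C_derive _ _ Cphi).
- by move=> i; apply: IH; [exact: (Cphi.2 i).2|exact: dphi0].
Qed.

End convol_smooth.

(** All balls are dilates of one another, so if one is null, each is, and countably many cover the
    space. *)
Lemma leb_setT_eq0 (r : R) : 0 < r -> leb (cball r : set V) = 0%E -> leb [set: V] = 0%E.
Proof.
move=> r0 cr0; rewrite (_ : [set: V] = \bigcup_(m : nat) cball m.+1%:R); last first.
  apply/esym/seteqP; split=> // x _; exists (Num.bound `|x|) => //.
  apply: ltW; apply: lt_le_trans (archi_boundP _) _ => //.
  by rewrite ler_nat.
apply: leb_bigcup_null => m.
have c0 : 0 < r / m.+1%:R by rewrite divr_gt0.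
rewrite (_ : cball m.+1%:R = affine (r / m.+1%:R) 0 @^-1` cball r).
  by rewrite [LHS](lebesgue_outer_affine _ _ c0) [X in (_ * X)%E]cr0 mule0.
apply/seteqP; split=> x; rewrite /cball /affine /= addr0 normrZ gtr0_norm//.
  by rewrite mulrAC ler_pdivrMr// ler_pM2l.
by rewrite mulrAC ler_pdivrMr// ler_pM2l.
Qed.

Lemma bump_continuous r : continuous (bump r).
Proof. exact: class_C_continuous (class_C_bump 0 r). Qed.

Lemma bump_supp_gt r x : 0 < r -> r < `|x| -> bump r x = 0.
Proof. by move=> r0 /ltW; exact: bump_supp. Qed.

Lemma integrable_bump r : 0 < r -> leb.-integrable [set: T] (EFin \o bump r).
Proof.
move=> r0; have b0 x := @bump_supp_gt r x r0.
have [B B0 bB] := cont_supp_bounded (@bump_continuous r) b0.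
have i1 : leb.-integrable [set: T] (EFin \o (\1_(cball r) : V -> R)).
  apply/integrableP; split.
    by apply/measurable_EFinP; apply: measurable_indic; exact: measurable_cball.
  rewrite (_ : (fun x => _) = (fun x : T => (\1_(cball r) x)%:E)); last first.
    by apply/funext => x /=; rewrite ger0_norm.
  by rewrite integral_indic ?setIT; [exact: leb_cball_fin|exact: measurableT|exact: measurable_cball].
have mb : measurable_fun [set: T] (bump r).
  by apply: borel_measurable_fun; apply: borel_continuous; exact: bump_continuous.
have := integrableM_bounded i1 mb B0 bB; congr (_.-integrable _ (_ \o _)).
apply/funext => x; rewrite indicE; have [|] := boolP (x \in cball r).
  by rewrite mul1r.
by rewrite notin_setE /cball /= => /negP; rewrite -ltNge mul0r => /b0 ->.
Qed.

(** With a vanishing integral, [bump r] would be 0 off a null set; as it is positive on the ball of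
    radius r/2, that ball would be null, and so would the space. *)
Lemma bump_integral_gt0 r : 0 < r -> leb [set: V] != 0%E ->
  (0 < \int[leb]_x (bump r x)%:E)%E.
Proof.
move=> r0; apply: contraTT; rewrite -leNgt negbK => I0.
have r20 : 0 < r / 2 by rewrite divr_gt0.
apply/eqP; apply: (leb_setT_eq0 r20); apply/eqP.
rewrite eq_le lebesgue_outer_ge0 andbT.
have mb : measurable_fun [set: T] (EFin \o bump r) := measurable_int _ (integrable_bump r0).
have /(ae_eq_integral_abs leb measurableT mb) : (\int[leb]_x `|(EFin \o bump r) x| = 0)%E.
  apply/eqP; rewrite eq_le integral_ge0// andbT; apply: le_trans I0.
  rewrite le_eqVlt; apply/orP; left; apply/eqP; apply: eq_integral => x _ /=.
  by rewrite ger0_norm ?bump_ge0.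
move=> [A [mA A0 HA]]; rewrite -A0; apply: le_lebesgue_outer => x xr.
apply: HA => /= /(_ I); apply/eqP; rewrite eqe gt_eqF// bump_gt0//.
by apply: le_lt_trans xr _; rewrite ltr_pdivrMr// ltr_pMr// ltr1n.
Qed.

Lemma smooth_averaging r : 0 < r -> leb [set: V] != 0%E ->
  exists2 phi : V -> R, averaging r phi & forall k, class_C k phi.
Proof.
move=> r0 lT; have I0 := bump_integral_gt0 r0 lT.
have Ifin := integrable_fin_num measurableT (integrable_bump r0).
pose I := \int[leb]_x (bump r x).
have IE : (\int[leb]_x (bump r x)%:E = I%:E)%E by rewrite /I /Rintegral fineK.
have Ipos : 0 < I by rewrite -lte_fin -IE.
exists (fun x => I^-1 * bump r x); last first.
  by move=> k; apply: class_CM; [exact: class_C_cst|exact: class_C_bump].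
have b0 x := @bump_supp_gt r x r0.
have [B B0 bB] := cont_supp_bounded (@bump_continuous r) b0.
apply: Averaging.
- apply: measurable_funM; first exact: measurable_cst.
  by apply: borel_continuous; exact: bump_continuous.
- by move=> x; rewrite mulr_ge0 ?bump_ge0 ?invr_ge0 ?ltW.
- by move=> x; rewrite bump_even.
- by move=> x rx; rewrite bump_supp// mulr0.
- exists (I^-1 * B) => x; rewrite ler_wpM2l ?invr_ge0 ?(ltW Ipos)//.
  exact: le_trans (ler_norm _) (bB x).
- under eq_integral do rewrite EFinM.
  rewrite leb_integralZl.
  + by rewrite IE -EFinM mulVf// gt_eqF.
  + by rewrite lee_fin invr_ge0 ltW.
  + by move=> x; rewrite lee_fin bump_ge0.
  + exact: measurable_int (integrable_bump r0).
Qed.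

Lemma test_function_convol r phi f (M : R) : 0 < r -> averaging r phi -> (forall k, class_C k phi) ->
  leb.-integrable [set: T] (EFin \o f) -> (forall x, M < `|x| -> f x = 0) ->
  test_function (convol phi f).
Proof.
move=> r0 aphi Cphi fi f0.
have phi0 x : r < `|x| -> phi x = 0 by move=> /ltW; exact: averaging_supp.
apply: (@test_functionP _ (M + r)) => [k|x xM]; first exact: (class_C_convol fi (Cphi k) phi0).
rewrite /convol (_ : (fun y => _) = cst 0); first by rewrite Rintegral_cst// mul0r.
apply/funext => y; have [yM|/f0->] := leP `|y| M; last by rewrite mul0r.
rewrite phi0 ?mulr0//; have := ler_normB (x - y) (- y).
by rewrite opprK subrK normrN; lra.
Qed.

End smooth.

(** * Approximation by compactly supported smooth functions *)

Section smooth_approximation.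
Context {R : realType} {n : nat}.
Local Notation V := 'rV[R]_n.+1.
Local Notation T := (Rd R n).
Local Notation borelRd := (@borelRd R n).
Implicit Types (u v f g phi : V -> R) (s : R).

Lemma convol_bounds r phi u (x : V) : averaging r phi -> measurable_fun [set: T] u ->
  L1loc u -> (forall y, 0 <= u y <= 1) -> 0 <= convol phi u x <= 1.
Proof.
move=> aphi mu uL u01; have phi0 := averaging_ge0 aphi.
have u0 y : 0 <= u y by have /andP[] := u01 y.
rewrite -!lee_fin (convolE x aphi uL); apply/andP; split.
  by apply: integral_ge0 => z _; rewrite lee_fin mulr_ge0.
rewrite -(averaging_integral aphi); apply: le_leb_integral.
- by move=> z; rewrite lee_fin mulr_ge0.
- exact: measurable_int (convol_integrand_integrable x aphi uL).
- by apply/measurable_EFinP; exact: borel_measurable_fun (averaging_borel aphi).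
- by move=> z; rewrite lee_fin ler_piMl//; have /andP[] := u01 (x + z).
Qed.

Lemma cutoff_integrable m u : leb.-integrable [set: T] (EFin \o u) ->
  leb.-integrable [set: T] (EFin \o (fun x => cutoff m x * u x)).
Proof.
move=> ui; have mu : measurable_fun [set: T] u.
  by apply/measurable_EFinP; exact: measurable_int ui.
apply: (le_integrable measurableT _ _ ui).
  apply/measurable_EFinP; apply: measurable_funM; last exact: mu.
  exact: (borel_measurable_fun (borel_cutoff _)).
by move=> x _; rewrite lee_fin normrM ler_piMl// ger0_norm ?cutoff_ge0// cutoff_le1.
Qed.

Lemma pair_energy_mollified_cutoff_le s r phi m v : 0 < m -> 0 < r -> averaging r phi ->
  measurable_fun [set: borelRd] v -> leb.-integrable [set: T] (EFin \o v) ->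
  (pair_energy (riesz s) (convol phi (fun x => cutoff m x * v x)%R) <=
   pair_energy (riesz s) v +
   (\int[leb]_x (cutoff_kernel s m (x : V))%:E) * \int[leb]_x `|v x|%:E)%E.
Proof.
move=> m0 r0 aphi bv vi; have mv := borel_measurable_fun bv.
have rz0 (x y : V) : 0 <= riesz s x y by exact: riesz_ge0.
have mr : measurable2 (riesz s : V -> V -> R) by exact: measurable_riesz.
apply: le_trans (pair_energy_cutoff_le s m0 mv).
apply: (pair_energy_convol_le r0 aphi _ _ mr rz0).
- by apply: measurable_funM; [exact: borel_cutoff|exact: bv].
- by apply: integrable_L1loc; exact: cutoff_integrable.
- move=> z _; rewrite (_ : (fun x y : V => riesz s (x - z)%R (y - z)%R) = riesz s).
    exact: lexx.
  by apply/funext => x; apply/funext => y; exact: riesz_shift.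
Qed.

Lemma smooth_approximation s u : 0 < s < 1 -> sobolev_Ws1 s u ->
  exists u_ : nat -> V -> R,
    [/\ forall k, test_function (u_ k),
        ('N[leb]_1[EFin \o (u \- u_ k)%R])%E @[k --> \oo] --> 0%E,
        gagliardo_seminorm s (u_ k) @[k --> \oo] --> gagliardo_seminorm s u &
        forall E : set V, u = \1_E -> forall k x, 0 <= u_ k x <= 1].
Proof.
move=> s01 [ui ufin].
have mu : measurable_fun [set: T] u by apply/measurable_EFinP; exact: measurable_int ui.
have r0 (x y : V) : 0 <= riesz s x y by exact: riesz_ge0.
have mr : measurable2 (riesz s : V -> V -> R) by exact: measurable_riesz.
have m0 : measurable_fun [set: T] (fun _ : T => 0 : R) by exact: measurable_cst.
(* leb is in fact not null, but the degenerate case is immediate, so this needs no proof. *)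
have [lT|lT] := eqVneq (leb [set: V]) 0%E.
  exists (fun _ _ => 0); split.
  - by move=> k; apply: (@test_functionP _ _ _ 0) => // j; exact: class_C_cst.
  - rewrite (_ : (fun _ => _) = cst 0%E); first exact: cvg_cst.
    apply/funext => k; rewrite Lnorm1 /=.
    rewrite -[RHS](@integral0 _ T R leb setT); apply: (leb_integral_ae measurableT lT).
    + by move=> x; rewrite lee_fin.
    + by [].
    + by apply/measurable_EFinP; apply: measurable_norm; apply: measurable_funB; [exact: mu|exact: m0].
    + exact: measurable_cst.
    + by move=> x [].
  - rewrite !gagliardo_pair_energy (pair_energy_ae mr r0 mu m0 measurableT lT) => [|x []//].
    exact: cvg_cst.
  - by move=> *; rewrite lexx ler01.
have [v [N [bv mN N0 uv]]] := borel_ae_fun mu.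
have mv := borel_measurable_fun bv.
have mNT := borel_measurable mN.
have vi : leb.-integrable [set: T] (EFin \o v).
  apply/integrableP; split; first exact/measurable_EFinP.
  have [_] := integrableP _ _ _ ui; congr (_ < _)%E.
  apply: (leb_integral_ae mNT N0).
  - by move=> x; exact: abse_ge0.
  - by move=> x; exact: abse_ge0.
  - by apply: measurableT_comp; [|exact/measurable_EFinP].
  - by apply: measurableT_comp; [|exact/measurable_EFinP].
  - by move=> x Nx; rewrite /= uv.
pose w k (x : V) : R := cutoff k.+1%:R x * v x.
have bw k : measurable_fun [set: borelRd] (w k).
  by apply: measurable_funM; [exact: borel_cutoff|exact: bv].
have wi k : leb.-integrable [set: T] (EFin \o w k) by exact: cutoff_integrable.
have mw k := borel_measurable_fun (bw k).
(* The averaging radius is chosen after the cutoff, so that averaging moves the k-th truncated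
   function by at most 1/(k+1) in L^1. *)
have /choice[p Hp] k : exists p : R * (V -> R), [/\ 0 < p.1, averaging p.1 p.2,
    forall j, class_C j p.2 & (\int[leb]_x `|convol p.2 (w k) x - w k x|%:E <= (k.+1%:R^-1)%:E)%E].
  have k0 : 0 < k.+1%:R^-1 :> R by rewrite invr_gt0.
  have [r rpos H] := convol_L1_cvg k0 (bw k) (wi k).
  have [phi aphi Cphi] := smooth_averaging rpos lT.
  by exists (r, phi); split=> //=; apply: H aphi; rewrite rpos lexx.
(* The approximants are defined from [u], whose values are known everywhere when it is an indicator,
   whereas [v] is only known to agree with it off [N]. By [uE] they are also averages of the Borel
   functions [w k], as the energy estimates require. *)
pose w' k (x : V) : R := cutoff k.+1%:R x * u x.
have w'i k : leb.-integrable [set: T] (EFin \o w' k) by exact: cutoff_integrable.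
have mw' k : measurable_fun [set: T] (w' k).
  by apply/measurable_EFinP; exact: measurable_int (w'i k).
pose u_ k := convol (p k).2 (w' k).
have uE k : u_ k = convol (p k).2 (w k).
  have [_ ap _ _] := Hp k.
  by apply: (convol_ae ap (mw' k) (mw k) mNT N0) => x Nx; rewrite /w' uv.
have mu_ k : measurable_fun [set: T] (u_ k).
  by have [_ ap _ _] := Hp k; rewrite uE; exact: (measurable_convol ap (mw k)).
pose D k := (\int[leb]_x `|u_ k x - v x|%:E)%E.
have D0 : D k @[k --> \oo] --> 0%E.
  pose c k := (\int[leb]_x `|w k x - v x|%:E)%E.
  have Dc k : (0 <= D k <= (k.+1%:R^-1)%:E + c k)%E.
    apply/andP; split; first exact: integral_ge0.
    have [_ ap _ Hk] := Hp k.
    apply: le_trans (leeD2r _ Hk); rewrite -leb_integralD.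
    - apply: le_leb_integral.
      + by move=> x.
      + by apply: measurable_normB; [exact: mu_|exact: mv].
      + by apply: emeasurable_funD; apply: measurable_normB;
          [exact: measurable_convol ap (mw k)|exact: mw|exact: mw|exact: mv].
      + move=> x; rewrite -EFinD lee_fin uE.
        by apply: le_trans (ler_normD _ _); rewrite addrA subrK.
    - by move=> x.
    - by move=> x.
    - by apply: measurable_normB; [exact: measurable_convol ap (mw k)|exact: mw].
    - by apply: measurable_normB; [exact: mw|exact: mv].
  have c0 : ((k.+1%:R^-1)%:E + c k)%E @[k --> \oo] --> (0 : \bar R)%E.
    rewrite -[X in _ --> X]adde0; apply: cvgeD => //; last exact: cutoff_L1_cvg.
    by apply/fine_cvgP; split; [exact: nearW|exact: cvg_harmonic].
  by apply: (squeeze_cvge _ (cvg_cst (0 : \bar R)%E) c0); exact: nearW.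
have uvE : pair_energy (riesz s) u = pair_energy (riesz s) v.
  exact: (pair_energy_ae mr r0 mu mv mNT N0 uv).
rewrite gagliardo_pair_energy uvE in ufin *.
exists u_; split.
- move=> k; have [pk ap Cp _] := Hp k.
  apply: (test_function_convol (M := 2 * k.+1%:R) pk ap Cp (w'i k)) => x xk.
  by rewrite /w' (cutoff0 _ (ltW xk)) ?mul0r.
- apply: cvg_trans D0; apply: near_eq_cvg; near=> k; rewrite Lnorm1 /D.
  apply: (leb_integral_ae mNT N0).
  + by move=> x.
  + by move=> x; exact: abse_ge0.
  + by apply: measurable_normB; [exact: mu_|exact: mv].
  + by apply: (@measurable_normB _ _ u (u_ k)); [exact: mu|exact: mu_].
  + by move=> x Nx; rewrite /= uv// distrC.
- under eq_fun do rewrite gagliardo_pair_energy.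
  apply: cvge_squeeze.
  + by rewrite ge0_fin_numE// pair_energy_ge0.
  (* The global L^1 distance [D k] bounds the local one, so eventually the tolerance [d] is met. *)
  + move=> a av; have [M [d d0 H]] := pair_energy_lsc mr r0 mv av.
    near=> k; apply: (H _ (mu_ k)); apply: (@le_trans _ _ (D k)).
      have mD : measurable_fun [set: T] (fun x : T => `|u_ k x - v x|).
        by apply: measurable_norm; apply: measurable_funB; [exact: mu_|exact: mv].
      apply: le_leb_integral.
      * by move=> x; rewrite lee_fin mulr_ge0.
      * apply/measurable_EFinP; apply: measurable_indicM; first exact: measurable_cball.
        exact: mD.
      * by apply/measurable_EFinP; exact: mD.
      * move=> x; rewrite lee_fin ler_piMl// indicE; by case: (x \in _); rewrite ?ler01.
    apply: ltW; near: k; apply: (cvge_lt_near D0); by rewrite lte_fin.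
  + move=> e e0.
    pose L := (\int[leb]_x `|v x|%:E)%E.
    have Lfin : L \is a fin_num by exact: integrable_fin_num (integrable_norm vi).
    have JL : (\int[leb]_x (cutoff_kernel s k.+1%:R (x : V))%:E * L)%E @[k --> \oo] --> 0%E.
      by rewrite -(mul0e L); apply: cvgeZr => //; exact: cutoff_kernel_cvg.
    near=> k.
    have [pk ap Cp _] := Hp k.
    have k0 : 0 < k.+1%:R :> R by [].
    rewrite uE; apply: le_trans (pair_energy_mollified_cutoff_le s k0 pk ap bv vi) _.
    apply: leeD2l; apply: ltW; near: k; apply: (cvge_lt_near JL); by rewrite lte_fin.
- move=> E uE' k x; have [pk ap Cp _] := Hp k.
  apply: (convol_bounds x ap (mw' k) (integrable_L1loc (w'i k))) => y.
  have [c0 c1] := (cutoff_ge0 k.+1%:R y, cutoff_le1 k.+1%:R y).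
  rewrite /w' uE' indicE; case: (y \in E); first by rewrite mulr1 c0 c1.
  by rewrite mulr0 lexx ler01.
Unshelve. all: by end_near.
Qed.

End smooth_approximation.

Theorem lemma3p2 (R : realType) (n : nat) (s : R) (s01 : 0 < s < 1) :
  (forall eta : 'rV[R]_n.+1 -> R, symmetric_mollifier eta ->
    (forall (u : 'rV[R]_n.+1 -> R) (Omega : set 'rV[R]_n.+1),
       L1loc u -> open Omega -> (fractional_energy s u Omega < +oo)%E ->
       forall Omega' : set 'rV[R]_n.+1,
         open Omega' -> compactly_contained Omega' Omega ->
         fractional_energy s (mollify eta eps u) Omega' @[eps --> 0^'+]
           --> fractional_energy s u Omega')
    /\
    (forall u : 'rV[R]_n.+1 -> R, sobolev_Ws1 s u ->
       gagliardo_seminorm s (mollify eta eps u) @[eps --> 0^'+]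
         --> gagliardo_seminorm s u))
  /\
  (forall u : 'rV[R]_n.+1 -> R, sobolev_Ws1 s u ->
     exists u_ : nat -> 'rV[R]_n.+1 -> R,
       [/\ forall k, test_function (u_ k),
           ('N[leb]_1[EFin \o (u \- u_ k)%R])%E @[k --> \oo] --> 0%E,
           gagliardo_seminorm s (u_ k) @[k --> \oo]
             --> gagliardo_seminorm s u &
           forall E : set 'rV[R]_n.+1, u = \1_E ->
             forall k x, 0 <= u_ k x <= 1]).
Proof.
split=> [eta heta|u uW]; last exact: smooth_approximation.
split=> [u Omega uL oO uO Omega' oO' O'O|u uW]; last exact: gagliardo_mollify_cvg.
exact: (fractional_energy_mollify_cvg heta uL oO).
Qed.
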